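(* There exist absolute constants $C_0>1$ and $C,c,c'>0$ such that the following holds. Let $M\geq 2$ and $N$ be positive integers, let $\delta>0$, let $A\subseteq[N]$ with $|A|\geq\delta N$, and let $S\subseteq\mathbb{N}$ be multiplicatively $[M]$-syndetic. Suppose there do not exist $x\in A$ and $d\in S\cap[N/3]$ with $\{x,x+d,x+2d\}\subseteq A$. If $N>\exp(C_0\delta^{-C_0}M^{C_0})$, then there exists an arithmetic progression $P\subseteq[N]$ with $|P|\geq c' N^{c\delta^{C}M^{-C}}$ and $\frac{|A\cap P|}{|P|}\geq(1+c)\delta$.
   Context: $\mathbb{N}=\{1,2,3,\dots\}$, $[X]=\{n\in\mathbb{N}:1\le n\le X\}$. A set $S\subseteq\mathbb{N}$ is multiplicatively $[M]$-syndetic if for every $n\in\mathbb{N}$ there exists $t\in\{1,\dots,M\}$ with $nt\in S$. *)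

(* Defs.v *)
From HB Require Import structures.
From mathcomp Require Export all_boot all_order all_algebra.
From mathcomp Require Export finmap.
From mathcomp Require Export mathcomp_extra boolp classical_sets reals sequences exp.

Set Implicit Arguments.
Unset Strict Implicit.
Unset Printing Implicit Defensive.

Import Order.TTheory GRing.Theory Num.Theory.
Local Open Scope classical_set_scope.
Local Open Scope ring_scope.

(* The positive integers; Rocq's nat contains 0. *)
Definition posint : set nat := [set n | (0 < n)%N].

Definition initseg (R : realType) (X : R) : set nat :=
  [set n | posint n /\ n%:R <= X].

Definition mult_syndetic (M : nat) (S : set nat) : Prop :=
  forall n : nat, posint n -> exists t : nat, (1 <= t <= M)%N /\ S (n * t)%N.

(* L = 0 is allowed, giving the empty progression. *)
Definition arith_prog (P : {fset nat}) : Prop :=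
  exists a q L : nat,
    (0 < q)%N /\ P = [fset (a + i * q)%N | i in iota 0 L]%fset.

(* Main.v *)
(* Put N' = 2 N + 1 and work in Z/N'.  If the balanced part g of a function
   changes the number of progressions x, x + d, x + 2 d with d in S, then one
   application of Cauchy-Schwarz (in x, so the weight 1_S disappears) and Fourier
   analysis give frequencies phi(h) with g(x) g(x + h) correlating with the
   character of frequency phi(h) for many h.  The weights
   w(h, k) = |sum_x g(x) g(x + h) chi(k x)|^2 / N'^2 are self-dual under the
   symplectic Fourier transform, hence positive definite, so the graph of phi has
   large additive energy: Balog-Szemeredi-Gowers, small sumsets and a
   Bogolyubov-type argument make phi linear on a Bohr set of polynomially bounded
   rank, the associated bilinear form is almost symmetric, and g correlates with a
   function that is a quadratic phase along short progressions (Gowers, Green-Tao).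

   Boosting then builds a function H, depending in a Lipschitz way on boundedly
   many such structured functions, to which 1_A is close in the sense that neither
   a structured function, nor 1, nor (H - (1 + c) delta)_+ detects the difference.
   A Weyl estimate together with an iteration over the rank of the integer
   relations between the quadratic frequencies yields progressions on which all the
   structured functions, hence H, are almost constant.  If A had no density
   increment on these progressions, H would be at most about (1 + c) delta, hence
   at least delta / 2 on almost all of [N], and H would contain many progressions
   with difference in S; A would too, a contradiction. *)
Require Import Defs.
From HB Require Import structures.
From mathcomp Require Import all_boot all_order all_algebra.
From mathcomp Require Import finmap.
From mathcomp Require Import mathcomp_extra boolp classical_sets reals sequences exp.
From mathcomp Require Import topology normedtype derive realfun trigo complex.
From mathcomp Require Import ring lra zify.
From mathcomp Require Import fintype finset.

Set Implicit Arguments.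
Unset Strict Implicit.
Unset Printing Implicit Defensive.

Import Order.TTheory GRing.Theory Num.Theory.
Import ComplexField.Normc numFieldNormedType.Exports.
Local Open Scope ring_scope.
Local Notation Re := complex.Re.

(** * Complex sums *)

(** Quadratic phases enter because [S] is only multiplicatively syndetic: its indicator has no
    usable Fourier structure and must be removed by Cauchy-Schwarz. Correlation of [A] with one such
    phase would only give an increment polynomial in [delta / M]; the fixed factor [1 + c] forces a
    complete bounded model [H], and the test function [(H - (1 + c) delta)_+] turns the absence of
    increments into an upper bound for [H]. Losses are polynomial in [K], about [2 M / delta], with
    one exception: each boosting step may double the Lipschitz constant of [H], so after
    [kk = K ^ O(1)] steps the structured functions must be constant up to [2 ^ - O(kk)]. This is why
    the progressions have length [Z >= 2 ^ (40 kk)]; reaching them needs [N >= Z ^ (kk ^ 10)], the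
    origin of the exponential lower bound on [N] and of the root of [N] in the length of [P]. The
    modulus [2 N + 1] prevents wrap-around for differences up to [N / 3] and makes 2 invertible,
    which the third point of a progression and the quadratic form both need. *)

Section ComplexSums.
Variable R : realType.
Local Notation C := R[i].
Implicit Types z : C.

Lemma normc_ge0 z : 0 <= normc z.
Proof. by case: z => a b; exact: sqrtr_ge0. Qed.

Lemma normcD z z' : normc (z + z') <= normc z + normc z'.
Proof. exact: le_normcD. Qed.

Lemma normc_opp z : normc (- z) = normc z.
Proof. exact: normcN. Qed.

Lemma normcB z z' : normc (z - z') = normc (z' - z).
Proof. by rewrite -normc_opp opprB. Qed.

Lemma normc_sum (I : Type) (s : seq I) (P : pred I) (F : I -> C) :
  normc (\sum_(i <- s | P i) F i) <= \sum_(i <- s | P i) normc (F i).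
Proof.
elim/big_rec2: _ => [|i y x _ le]; first by rewrite normc0.
by apply: le_trans (normcD _ _) _; rewrite lerD2l.
Qed.

Lemma normc_real (x : R) : normc x%:C%C = `|x|.
Proof. by rewrite /normc /= expr0n /= addr0 sqrtr_sqr. Qed.

Lemma normc_conj z : normc (conjc z) = normc z.
Proof. by case: z => a b; rewrite /normc /= sqrrN. Qed.

Lemma mul_conjc z : z * conjc z = (normc z ^+ 2)%:C%C.
Proof.
case: z => a b; rewrite /normc sqr_sqrtr ?addr_ge0 ?sqr_ge0 //.
by apply/eqP; rewrite eq_complex /=; apply/andP; split; apply/eqP; ring.
Qed.

Lemma Re_le_normc z : Re z <= normc z.
Proof.
case: z => a b /=; apply: le_trans (ler_norm _) _.
by rewrite -sqrtr_sqr ler_wsqrtr // lerDl sqr_ge0.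
Qed.

Lemma normsq_sub1 z : normc z = 1 -> normc (1 - z) ^+ 2 = 2 - 2 * Re z.
Proof.
case: z => a b /= h; have := sqr_sqrtr (addr_ge0 (sqr_ge0 a) (sqr_ge0 b)).
rewrite h sqr_sqrtr ?addr_ge0 ?sqr_ge0 // => e; rewrite sub0r sqrrN; nra.
Qed.

Lemma ReM_real (x : R) z : Re (x%:C%C * z) = x * Re z.
Proof. by case: z => a b /=; ring. Qed.

Lemma Re_sum (I : Type) (s : seq I) (P : pred I) (F : I -> C) :
  Re (\sum_(i <- s | P i) F i) = \sum_(i <- s | P i) Re (F i).
Proof. by elim/big_rec2: _ => // i y [a b] _ <-; case: (F i). Qed.

Lemma RC_sum (I : Type) (s : seq I) (P : pred I) (F : I -> R) :
  (\sum_(i <- s | P i) F i)%:C%C = \sum_(i <- s | P i) (F i)%:C%C.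
Proof. exact: rmorph_sum. Qed.

Lemma RCM (x y : R) : (x * y)%:C%C = x%:C%C * y%:C%C.
Proof. exact: rmorphM. Qed.

Lemma RCB (x y : R) : (x - y)%:C%C = x%:C%C - y%:C%C.
Proof. exact: rmorphB. Qed.

Lemma conjcB z z' : conjc (z - z') = conjc z - conjc z'.
Proof. exact: rmorphB. Qed.

Lemma RC_nat n : (n%:R : R)%:C%C = n%:R.
Proof. exact: rmorph_nat. Qed.

Lemma conjcM z z' : conjc (z * z') = conjc z * conjc z'.
Proof. exact: rmorphM. Qed.

Lemma conjc_sum (I : Type) (s : seq I) (P : pred I) (F : I -> C) :
  conjc (\sum_(i <- s | P i) F i) = \sum_(i <- s | P i) conjc (F i).
Proof. exact: rmorph_sum. Qed.

Lemma normsq_sum (I : finType) (P : pred I) (F : I -> C) :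
  (normc (\sum_(i | P i) F i) ^+ 2)%:C%C
  = \sum_(i | P i) \sum_(j | P j) F i * conjc (F j).
Proof.
rewrite -mul_conjc conjc_sum mulr_suml; apply: eq_bigr => i _.
by rewrite mulr_sumr.
Qed.

Lemma normquad_sum (I : finType) (P : pred I) (F : I -> C) :
  (normc (\sum_(i | P i) F i) ^+ 4)%:C%C = \sum_(i | P i) \sum_(j | P j)
  \sum_(k | P k) \sum_(l | P l) F i * conjc (F j) * (F k * conjc (F l)).
Proof.
rewrite (exprD _ 2 2) RCM normsq_sum big_distrl; apply: eq_bigr => i _.
rewrite big_distrl; apply: eq_bigr => j _.
by rewrite big_distrr; apply: eq_bigr => k _; rewrite big_distrr.
Qed.

Lemma sqr_le (a b : R) : 0 <= b -> a ^+ 2 <= b ^+ 2 -> a <= b.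
Proof. by move=> b0 h; rewrite leNgt; apply/negP => lt; nra. Qed.

Lemma sum_le_const (I : finType) (P : pred I) (F : I -> R) (c : R) :
  (forall i, P i -> F i <= c) -> \sum_(i | P i) F i <= #|P|%:R * c.
Proof.
move=> h; apply: le_trans (ler_sum _ h) _.
by rewrite sumr_const mulr_natl.
Qed.

Lemma sum_bool (I : finType) (A : {set I}) (P : pred I) :
  \sum_(i in A) (P i)%:R = #|[set i in A | P i]|%:R :> R.
Proof.
by rewrite cardsE -sum1_card big_mkcondr natr_sum; apply: eq_bigr => x _; case: ifP.
Qed.

Lemma exists_ge_avg (I : finType) (P : pred I) (F : I -> R) (c : R) :
  0 < c -> c <= \sum_(i | P i) F i -> exists2 i, P i & c <= #|P|%:R * F i.
Proof.
move=> c0 h; apply: contrapT => hn.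
have k0 : (0 < #|P|)%N.
  rewrite lt0n; apply/eqP => k0; move: h; rewrite big_pred0; first by lra.
  by move=> i; apply: (card0_eq k0 i).
have K0 : 0 < #|P|%:R :> R by rewrite ltr0n.
have : \sum_(i | P i) F i < c; last by lra.
rewrite (_ : c = \sum_(i | P i) c / #|P|%:R); last first.
  by rewrite sumr_const -[X in _ = X]mulr_natl mulrC divfK // gt_eqF.
have /card_gt0P[i0 Pi0] := k0.
apply: ltr_sum; first by apply/hasP; exists i0; rewrite ?mem_index_enum.
move=> i Pi; rewrite ltNge; apply/negP => hle; apply: hn; exists i => //.
by move: hle; rewrite ler_pdivrMr // mulrC.
Qed.

(** Lagrange's identity: the sum of all [(a i * b j - a j * b i) ^+ 2] is twice the difference of
    the two sides. *)
Lemma CauchySchwarz (I : finType) (P : pred I) (a b : I -> R) :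
  (\sum_(i | P i) a i * b i) ^+ 2
  <= (\sum_(i | P i) a i ^+ 2) * (\sum_(i | P i) b i ^+ 2).
Proof.
have h : 0 <= \sum_(i | P i) \sum_(j | P j) (a i * b j - a j * b i) ^+ 2.
  by apply: sumr_ge0 => i _; apply: sumr_ge0 => j _; exact: sqr_ge0.
have e : \sum_(i | P i) \sum_(j | P j) (a i * b j - a j * b i) ^+ 2 =
  2 * ((\sum_(i | P i) a i ^+ 2) * (\sum_(i | P i) b i ^+ 2))
  - 2 * (\sum_(i | P i) a i * b i) ^+ 2.
  transitivity (\sum_(i | P i) \sum_(j | P j) (a i ^+ 2 * b j ^+ 2)
    + \sum_(i | P i) \sum_(j | P j) (b i ^+ 2 * a j ^+ 2)
    - 2 * \sum_(i | P i) \sum_(j | P j) (a i * b i) * (a j * b j)).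
    rewrite mulr_sumr -big_split -sumrB; apply: eq_bigr => i _ /=.
    rewrite mulr_sumr -big_split -sumrB; apply: eq_bigr => j _ /=; ring.
  have dist (u v : I -> R) : \sum_(i | P i) \sum_(j | P j) u i * v j =
      (\sum_(i | P i) u i) * (\sum_(j | P j) v j).
    by rewrite mulr_suml; apply: eq_bigr => i _; rewrite mulr_sumr.
  by rewrite !dist; ring.
move: h; rewrite e; lra.
Qed.

Lemma CauchySchwarzC (I : finType) (P : pred I) (a b : I -> C) :
  normc (\sum_(i | P i) a i * b i) ^+ 2
  <= (\sum_(i | P i) normc (a i) ^+ 2) * (\sum_(i | P i) normc (b i) ^+ 2).
Proof.
apply: le_trans (CauchySchwarz P (fun i => normc (a i) : R) (fun i => normc (b i) : R)).
rewrite ler_sqr ?nnegrE ?normc_ge0 ?sumr_ge0 //; last first.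
  by move=> i _; rewrite mulr_ge0 ?normc_ge0.
by apply: le_trans (normc_sum _ _ _) _; apply: ler_sum => i _; rewrite normcM.
Qed.

Lemma sum_sq_le (I : finType) (P : pred I) (a : I -> R) :
  (\sum_(i | P i) a i) ^+ 2 <= #|P|%:R * \sum_(i | P i) a i ^+ 2.
Proof.
have := CauchySchwarz P (fun _ => 1) a.
under eq_bigr do rewrite mul1r.
by under [in X in _ <= X * _]eq_bigr do rewrite expr1n; rewrite sumr_const.
Qed.

Lemma sumC_sq_le (I : finType) (P : pred I) (a : I -> C) :
  normc (\sum_(i | P i) a i) ^+ 2 <= #|P|%:R * \sum_(i | P i) normc (a i) ^+ 2.
Proof.
apply: le_trans (sum_sq_le P (fun i => normc (a i) : R)).
rewrite ler_sqr ?nnegrE ?normc_ge0 ?sumr_ge0 // => [|i _]; last exact: normc_ge0.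
exact: normc_sum.
Qed.

Lemma normc_sq_le1 z : normc z <= 1 -> normc z ^+ 2 <= 1.
Proof. by move=> h; rewrite exprn_ile1 // normc_ge0. Qed.

End ComplexSums.

(** * Characters and the ambiguity function *)

Section Characters.
Variables (R : realType) (G : finComNzRingType).
Local Notation C := R[i].
Local Notation N := (#|G|%:R : R).

(** A primitive additive character of the ring [G]: by the third clause the functions
    [x |-> chi (k * x)] are pairwise orthogonal, so frequencies are again elements of [G]. *)
Definition good_char (chi : G -> C) : Prop :=
  [/\ forall x y, chi (x + y) = chi x * chi y,
      forall x, normc (chi x) = 1
    & forall x, x != 0 -> \sum_y chi (y * x) = 0].

Variable chi : G -> C.
Hypothesis hchi : good_char chi.

Lemma chiD x y : chi (x + y) = chi x * chi y. Proof. by case: hchi. Qed.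
Lemma chi_norm x : normc (chi x) = 1. Proof. by case: hchi. Qed.

Lemma card_G_gt0 : 0 < N.
Proof. by rewrite ltr0n; apply/card_gt0P; exists 0. Qed.

Lemma chi_neq0 x : chi x != 0.
Proof. by apply/eqP => h; have := chi_norm x; rewrite h normc0; lra. Qed.

Lemma chi0 : chi 0 = 1.
Proof. by apply: (mulfI (chi_neq0 0)); rewrite -chiD addr0 mulr1. Qed.

Lemma chiN x : chi (- x) = conjc (chi x).
Proof.
apply: (mulfI (chi_neq0 x)).
by rewrite -chiD subrr chi0 mul_conjc chi_norm expr1n.
Qed.

Lemma chiB x y : chi (x - y) = chi x * conjc (chi y).
Proof. by rewrite chiD chiN. Qed.

Lemma chi_sum x : \sum_y chi (y * x) = ((x == 0)%:R * N)%:C%C.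
Proof.
case: hchi => _ _ orth; case: eqVneq => [->|/orth ->]; last by rewrite mul0r.
rewrite (eq_bigr (fun=> 1)) => [|y _]; last by rewrite mulr0 chi0.
by rewrite sumr_const mul1r RC_nat.
Qed.

Lemma chi_sumC x : \sum_y chi (y * x) = (x == 0)%:R * N%:C%C.
Proof. by rewrite chi_sum RCM RC_nat. Qed.

Lemma sum_delta (F : G -> C) (a : G) :
  \sum_x ((x == a)%:R : C) * F x = F a.
Proof.
rewrite (bigD1 a) //= eqxx mul1r big1 ?addr0 // => x /negbTE ->.
by rewrite mul0r.
Qed.

Lemma chi_sum2 x y : \sum_z chi (z * x) * conjc (chi (z * y)) = (x == y)%:R * N%:C%C.
Proof.
under eq_bigr do rewrite -chiB -mulrBr.
by rewrite chi_sum subr_eq0 RCM RC_nat.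
Qed.

Lemma parseval (f : G -> C) :
  \sum_k normc (\sum_x f x * chi (k * x)) ^+ 2 = N * \sum_x normc (f x) ^+ 2.
Proof.
apply: complexI; rewrite RC_sum.
under eq_bigr do rewrite normsq_sum.
rewrite exchange_big /=.
transitivity (\sum_x \sum_y f x * conjc (f y) * ((x == y)%:R * N%:C%C)).
  apply: eq_bigr => x _; rewrite exchange_big /=; apply: eq_bigr => y _.
  rewrite -chi_sum2 mulr_sumr; apply: eq_bigr => z _.
  by rewrite conjcM; ring.
rewrite RCM RC_sum mulr_sumr; apply: eq_bigr => x _ /=.
rewrite -mul_conjc -[RHS](sum_delta (fun y => N%:C%C * (f x * conjc (f y)))).
by apply: eq_bigr => y _; rewrite [y == x]eq_sym; ring.
Qed.

(** Expanding the constraint [v = u + d] in characters turns the sum into a mean of products of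
    three transforms; that of [P] is bounded by its supremum, the other two by Cauchy-Schwarz and
    Parseval. *)
Lemma trilinear (P Q S : G -> C) (M : R) :
  (forall k, normc (\sum_x P x * chi (k * x)) <= M) ->
  (forall x, normc (Q x) <= 1) -> (forall x, normc (S x) <= 1) ->
  normc (\sum_u \sum_d P u * Q (u + d) * S d) <= N * M.
Proof.
move=> hP hQ hS.
pose ft (f : G -> C) k := \sum_x f x * chi (k * x).
have e : N%:C%C * (\sum_u \sum_d P u * Q (u + d) * S d) =
    \sum_k ft P k * (\sum_v Q v * chi (k * - v)) * ft S k.
  transitivity (\sum_u \sum_d \sum_v P u * Q v * S d * ((v == u + d)%:R * N%:C%C)).
    rewrite mulr_sumr; apply: eq_bigr => u _.
    rewrite mulr_sumr; apply: eq_bigr => d _.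
    rewrite -(sum_delta (fun v => N%:C%C * (P u * Q v * S d))).
    by apply: eq_bigr => v _; ring.
  rewrite /ft; under [RHS]eq_bigr do rewrite big_distrlr /= mulr_suml.
  rewrite [RHS]exchange_big /=; apply: eq_bigr => u _.
  under [RHS]eq_bigr do rewrite big_distrlr /=.
  rewrite [RHS]exchange_big /= [LHS]exchange_big /=; apply: eq_bigr => v _.
  rewrite [RHS]exchange_big /=; apply: eq_bigr => d _.
  rewrite (_ : (v == u + d) = (u + d - v == 0)); last by rewrite subr_eq0 eq_sym.
  rewrite -chi_sumC.
  rewrite mulr_sumr; apply: eq_bigr => k _.
  by rewrite !mulrDr !chiD; ring.
have N0 := card_G_gt0.
have M0 : 0 <= M by apply: le_trans (hP 0); exact: normc_ge0.
have bd (f : G -> C) : (forall x, normc (f x) <= 1) ->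
    \sum_k normc (ft f k) ^+ 2 <= N ^+ 2.
  move=> hf; rewrite parseval expr2 ler_pM2l //.
  apply: le_trans (ler_sum _ (fun x _ => normc_sq_le1 (hf x))) _.
  by rewrite sumr_const.
have bQ : \sum_k normc (\sum_v Q v * chi (k * - v)) ^+ 2 <= N ^+ 2.
  rewrite (reindex_inj oppr_inj) /=.
  by under eq_bigr do under eq_bigr do rewrite mulrNN; exact: bd.
rewrite -(ler_pM2l N0) -{1}[N](ger0_norm (ltW N0)) -normc_real -normcM e.
apply: le_trans (normc_sum _ _ _) _.
apply: (@le_trans _ _ (M * \sum_k normc (\sum_v Q v * chi (k * - v)) * normc (ft S k))).
  rewrite mulr_sumr; apply: ler_sum => k _; rewrite !normcM -mulrA.
  by apply: ler_wpM2r; [rewrite mulr_ge0 ?normc_ge0 | exact: hP].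
rewrite mulrA [_ * M]mulrC; apply: ler_wpM2l => //.
apply: sqr_le; first by rewrite mulr_ge0 // ltW.
apply: le_trans (CauchySchwarz _ _ _) _.
rewrite exprMn; apply: ler_pM => //; try exact: bd.
all: by apply: sumr_ge0 => k _; exact: sqr_ge0.
Qed.

Section Ambiguity.
Variable g : G -> R.
Hypothesis g1 : forall x, `|g x| <= 1.

Definition amb h k : C := \sum_x (g x * g (x + h))%:C%C * chi (k * x).
Definition wt h k : R := normc (amb h k) ^+ 2 / N ^+ 2.

Lemma wt_ge0 h k : 0 <= wt h k.
Proof. by rewrite divr_ge0 ?sqr_ge0. Qed.

Lemma amb_le h k : normc (amb h k) <= N.
Proof.
apply: le_trans (normc_sum _ _ _) _.
apply: le_trans (sum_le_const (c := 1) _) _; last by rewrite mulr1.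
move=> x _; rewrite normcM chi_norm mulr1 normc_real normrM.
by rewrite -[leRHS]mulr1 ler_pM.
Qed.

Lemma wt_le1 h k : wt h k <= 1.
Proof.
have N0 := card_G_gt0.
rewrite ler_pdivrMr ?exprn_gt0 // mul1r ler_sqr ?nnegrE ?normc_ge0 ?(ltW N0) //.
exact: amb_le.
Qed.

Lemma wtE h k : (N ^+ 2 * wt h k)%:C%C = \sum_x \sum_y
  (g x * g (x + h) * (g y * g (y + h)))%:C%C * chi (k * (x - y)).
Proof.
have N0 := card_G_gt0.
rewrite /wt mulrC divfK ?expf_neq0 ?gt_eqF // normsq_sum.
apply: eq_bigr => x _; apply: eq_bigr => y _.
rewrite conjcM conjc_real mulrBr chiB !RCM; ring.
Qed.

(** Summing over [l] forces [x = y + k]. What remains is the product of [g] over the parallelogram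
    [y], [y + k], [y + h], [y + k + h], which is symmetric in [h] and [k]; exchanging them gives
    [wt k z] back. *)
Lemma wt_dual k z : \sum_h \sum_l (wt h l)%:C%C * chi (h * z - l * k) = (N * wt k z)%:C%C.
Proof.
have N0 := card_G_gt0.
have NC0 : (N ^+ 2)%:C%C != 0 :> C by rewrite fmorph_eq0 expf_neq0 // gt_eqF.
apply: (mulfI NC0); rewrite mulr_sumr -RCM.
rewrite (_ : N ^+ 2 * (N * wt k z) = N * (N ^+ 2 * wt k z)); last by ring.
rewrite RCM wtE mulr_sumr.
transitivity (\sum_h \sum_l \sum_x \sum_y
    (g x * g (x + h) * (g y * g (y + h)))%:C%C * chi (l * (x - y - k)) * chi (h * z)).
  apply: eq_bigr => h _; rewrite mulr_sumr; apply: eq_bigr => l _.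
  rewrite mulrA -RCM wtE mulr_suml; apply: eq_bigr => x _.
  rewrite mulr_suml; apply: eq_bigr => y _.
  by rewrite !mulrBr !chiD !chiN; ring.
transitivity (\sum_h \sum_x \sum_y ((x - y - k == 0)%:R * N%:C%C) *
    ((g x * g (x + h) * (g y * g (y + h)))%:C%C * chi (h * z))).
  apply: eq_bigr => h _; rewrite exchange_big; apply: eq_bigr => x _ /=.
  rewrite exchange_big; apply: eq_bigr => y _ /=.
  rewrite -chi_sumC mulr_suml.
  by apply: eq_bigr => l _; ring.
transitivity (\sum_h \sum_y N%:C%C *
    ((g (y + k) * g (y + k + h) * (g y * g (y + h)))%:C%C * chi (h * z))).
  apply: eq_bigr => h _; rewrite exchange_big; apply: eq_bigr => y _ /=.
  rewrite -(sum_delta (fun x => N%:C%C * ((g x * g (x + h) * (g y * g (y + h)))%:C%C * chi (h * z)))).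
  apply: eq_bigr => x _.
  have -> : (x - y - k == 0) = (x == y + k) by rewrite -addrA -opprD subr_eq0.
  by ring.
rewrite [RHS](eq_bigr _ (fun x _ => mulr_sumr _ _ _ _)) [RHS]exchange_big [LHS]exchange_big /=.
apply: eq_bigr => y _; rewrite (reindex_inj (addrI (- y))) /=; apply: eq_bigr => x _.
rewrite (_ : y + k + (- y + x) = x + k); last by ring.
rewrite (_ : y + (- y + x) = x); last by ring.
rewrite (_ : (- y + x) * z = z * (x - y)); last by ring.
by congr (_ * (_%:C%C * _)); ring.
Qed.

Lemma wtN h k : wt (- h) (- k) = wt h k.
Proof.
rewrite /wt -(normc_conj (amb h k)); congr (_ ^+ 2 / _).
rewrite -[RHS]mul1r -(chi_norm (- (k * h))) -normcM; congr normc.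
rewrite /amb conjc_sum mulr_sumr (reindex_inj (addrI h)) /=.
apply: eq_bigr => x _; rewrite conjcM conjc_real -chiN.
rewrite (_ : h + x - h = x); last by ring.
rewrite (_ : - k * (h + x) = - (k * h) + - (k * x)); last by ring.
by rewrite chiD [h + x]addrC [g (x + h) * _]mulrC; ring.
Qed.

Definition om (a b : G * G) : G := a.1 * b.2 - a.2 * b.1.
Definition wp (a : G * G) : R := wt a.1 a.2.

Lemma wp_dual a : \sum_b (wp b)%:C%C * chi (om b a) = (N * wp a)%:C%C.
Proof. by rewrite -wt_dual pair_big. Qed.

Lemma omD b a a' : om b (a + a') = om b a + om b a'.
Proof. by rewrite /om /=; ring. Qed.

Lemma omN b a : om b (- a) = - om b a.
Proof. by rewrite /om /=; ring. Qed.

Lemma wpN a : wp (- a) = wp a.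
Proof. exact: wtN. Qed.

Lemma wp_ge0 a : 0 <= wp a. Proof. exact: wt_ge0. Qed.

Lemma wp_le1 a : wp a <= 1. Proof. exact: wt_le1. Qed.

Lemma sum_wp : \sum_a wp a <= N.
Proof.
have N0 := card_G_gt0.
have : (\sum_a wp a)%:C%C = (N * wp 0)%:C%C :> C.
  rewrite -wp_dual RC_sum; apply: eq_bigr => b _.
  by rewrite /om /= !mulr0 subrr chi0 mulr1.
move/complexI => ->; rewrite -[leRHS]mulr1 ler_pM2l //; exact: wp_le1.
Qed.

Definition spec (A : {set G * G}) (b : G * G) : C := \sum_(a in A) chi (om b a).

Lemma wp_pd2 (A : {set G * G}) :
  N * (\sum_(a in A) \sum_(a' in A) wp (a - a')) = \sum_b wp b * normc (spec A b) ^+ 2.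
Proof.
apply: complexI; rewrite RCM RC_sum mulr_sumr.
rewrite RC_sum [RHS](eq_bigr (fun b => \sum_(a in A) \sum_(a' in A)
   (wp b)%:C%C * chi (om b (a - a')))); last first.
  move=> b _; rewrite RCM normsq_sum mulr_sumr; apply: eq_bigr => a _.
  rewrite mulr_sumr; apply: eq_bigr => a' _.
  by rewrite omD omN chiD chiN.
rewrite [RHS]exchange_big /=; apply: eq_bigr => a _.
rewrite [RHS]exchange_big /= RC_sum mulr_sumr; apply: eq_bigr => a' _.
by rewrite wp_dual RCM.
Qed.

Lemma wp_pd4 (A : {set G * G}) :
  N * (\sum_(a in A) \sum_(a' in A) \sum_(b in A) \sum_(b' in A) wp (a - a' + (b - b')))
  = \sum_c wp c * normc (spec A c) ^+ 4.
Proof.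
apply: complexI; rewrite RCM RC_sum mulr_sumr.
rewrite RC_sum [RHS](eq_bigr (fun c => \sum_(a in A) \sum_(a' in A)
  \sum_(b in A) \sum_(b' in A) (wp c)%:C%C * chi (om c (a - a' + (b - b'))))); last first.
  move=> c _; rewrite RCM normquad_sum mulr_sumr; apply: eq_bigr => a _.
  rewrite mulr_sumr; apply: eq_bigr => a' _.
  rewrite mulr_sumr; apply: eq_bigr => b _.
  rewrite mulr_sumr; apply: eq_bigr => b' _.
  by rewrite omD (omD c a) (omD c b) !omN chiD (chiD (om c a)) (chiD (om c b)) !chiN.
rewrite [RHS]exchange_big /=; apply: eq_bigr => a _.
rewrite [RHS]exchange_big /= RC_sum mulr_sumr; apply: eq_bigr => a' _.
rewrite [RHS]exchange_big /= RC_sum mulr_sumr; apply: eq_bigr => b _.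
rewrite [RHS]exchange_big /= RC_sum mulr_sumr; apply: eq_bigr => b' _.
by rewrite wp_dual RCM.
Qed.

(* [wp] is positive definite, so the unit vectors it represents that correlate
   with a fixed one also correlate with each other on average. *)
Lemma wp_pairs (A : {set G * G}) :
  (\sum_(a in A) wp a) ^+ 2 <= \sum_(a in A) \sum_(a' in A) wp (a - a').
Proof.
have N0 := card_G_gt0.
have e : (N * \sum_(a in A) wp a)%:C%C = \sum_b (wp b)%:C%C * spec A b.
  rewrite RCM RC_sum mulr_sumr.
  under [RHS]eq_bigr do rewrite mulr_sumr.
  by rewrite [RHS]exchange_big; apply: eq_bigr => a _; rewrite wp_dual RCM.
have h1 : N * \sum_(a in A) wp a <= \sum_b wp b * normc (spec A b).
  apply: le_trans (ler_norm _) _; rewrite -normc_real e.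
  apply: le_trans (normc_sum _ _ _) _; apply: ler_sum => b _.
  by rewrite normcM normc_real ger0_norm ?wp_ge0.
have h2 : (\sum_b wp b * normc (spec A b)) ^+ 2 <=
    (\sum_b wp b) * (N * \sum_(a in A) \sum_(a' in A) wp (a - a')).
  rewrite wp_pd2.
  have := CauchySchwarz predT (fun b => Num.sqrt (wp b))
    (fun b => Num.sqrt (wp b) * normc (spec A b)).
  under eq_bigr do rewrite mulrA -expr2 sqr_sqrtr ?wp_ge0 //.
  under [X in _ <= X * _]eq_bigr do rewrite sqr_sqrtr ?wp_ge0 //.
  by under [X in _ <= _ * X]eq_bigr do rewrite exprMn sqr_sqrtr ?wp_ge0 //.
have s0 : 0 <= \sum_(a in A) wp a by apply: sumr_ge0 => a _; exact: wp_ge0.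
have S0 : 0 <= \sum_(a in A) \sum_(a' in A) wp (a - a').
  by do 2!apply: sumr_ge0 => ? _; exact: wp_ge0.
have h3 : (N * \sum_(a in A) wp a) ^+ 2 <= (\sum_b wp b * normc (spec A b)) ^+ 2.
  rewrite ler_sqr ?nnegrE ?mulr_ge0 ?(ltW N0) //.
  by apply: sumr_ge0 => b _; rewrite mulr_ge0 ?wp_ge0 ?normc_ge0.
rewrite -(@ler_pM2l _ (N ^+ 2)) ?exprn_gt0 // -exprMn.
apply: le_trans h3 (le_trans h2 _); rewrite expr2 -mulrA.
by apply: ler_wpM2r sum_wp; rewrite mulr_ge0 // ltW.
Qed.

(** On the dual side this compares the second and fourth moments of [spec A] against the weights
    [wp], whose total mass is at most [N]. *)
Lemma wp_quads (A : {set G * G}) :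
  (\sum_(a in A) \sum_(a' in A) wp (a - a')) ^+ 2 <=
  \sum_(a in A) \sum_(a' in A) \sum_(b in A) \sum_(b' in A) wp (a - a' + (b - b')).
Proof.
have N0 := card_G_gt0.
rewrite -(@ler_pM2l _ (N ^+ 2)) ?exprn_gt0 // -exprMn wp_pd2 expr2 -mulrA wp_pd4.
have := CauchySchwarz predT (fun b => Num.sqrt (wp b))
  (fun b => Num.sqrt (wp b) * normc (spec A b) ^+ 2).
under eq_bigr do rewrite mulrA -expr2 sqr_sqrtr ?wp_ge0 //.
under [X in _ <= X * _]eq_bigr do rewrite sqr_sqrtr ?wp_ge0 //.
under [X in _ <= _ * X]eq_bigr do rewrite exprMn sqr_sqrtr ?wp_ge0 // -exprM.
move/le_trans; apply; apply: ler_wpM2r sum_wp.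
by apply: sumr_ge0 => b _; rewrite mulr_ge0 ?wp_ge0 ?exprn_ge0 ?normc_ge0.
Qed.

Lemma trilinear_amb h (Q S : G -> R) (M : R) :
  (forall k, normc (amb h k) <= M) ->
  (forall x, `|Q x| <= 1) -> (forall x, `|S x| <= 1) ->
  \sum_u \sum_d (g u * g (u + h)) * Q (u + d) * S d <= N * M.
Proof.
move=> hM hQ hS; apply: le_trans (ler_norm _) _; rewrite -normc_real RC_sum.
have hQ' x : normc (Q x)%:C%C <= 1 by rewrite normc_real.
have hS' x : normc (S x)%:C%C <= 1 by rewrite normc_real.
apply: le_trans (trilinear (P := fun x => (g x * g (x + h))%:C%C) hM hQ' hS').
rewrite (eq_bigr (fun u => \sum_d (g u * g (u + h))%:C%C * (Q (u + d))%:C%C * (S d)%:C%C)) //.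
by move=> u _; rewrite RC_sum; apply: eq_bigr => d _; rewrite !RCM.
Qed.

Definition peak h : G := [arg max_(k > 0) normc (amb h k)]%O.

Lemma peakP h k : normc (amb h k) <= normc (amb h (peak h)).
Proof. by rewrite /peak; case: arg_maxP => // i _; apply. Qed.

Lemma peak_energy (eta : R) : 0 <= eta ->
  eta ^+ 2 * N ^+ 2 <= \sum_h normc (amb h (peak h)) ->
  eta ^+ 4 * N <= \sum_h wt h (peak h).
Proof.
have N0 := card_G_gt0.
move=> e0 h; rewrite /wt -mulr_suml ler_pdivlMr ?exprn_gt0 // -(ler_pM2l N0).
apply: le_trans (sum_sq_le _ _); apply: le_trans (_ : (eta ^+ 2 * N ^+ 2) ^+ 2 <= _).
  by rewrite le_eqVlt; apply/orP; left; apply/eqP; ring.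
rewrite ler_sqr ?nnegrE ?mulr_ge0 ?sqr_ge0 ?sumr_ge0 // => i _; exact: normc_ge0.
Qed.

End Ambiguity.
End Characters.

(** * Additive combinatorics *)

HB.instance Definition _ (G H : finZmodType) := GRing.Zmodule.on (G * H)%type.

Section PathsAndSumsets.
Variable R : realType.

(* Balog-Szemeredi-Gowers in graph form: a random neighbourhood contains few
   pairs with a small common neighbourhood. *)
Lemma bsg_paths (V : finType) (A : {set V}) (e : rel V) (k : R) :
  symmetric e -> 0 < k -> (0 < #|A|)%N ->
  k * #|A|%:R ^+ 2 <= \sum_(x in A) \sum_(y in A) (e x y)%:R ->
  exists B : {set V}, [/\ B \subset A, k * #|A|%:R <= 2 * #|B|%:R &
    forall x y, x \in B -> y \in B ->
    k ^+ 5 / 4096 * #|A|%:R ^+ 3 <=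
      \sum_(z in A) \sum_(u in A) \sum_(v in A) (e x z && e z u && e u v && e v y)%:R].
Proof.
move=> esym k0 A0 hk; set m : R := #|A|%:R in hk *.
have m0 : 0 < m by rewrite ltr0n.
have k1 : k <= 1.
  have : \sum_(x in A) \sum_(y in A) (e x y)%:R <= m * (m * 1) :> R.
    apply: sum_le_const => x _; apply: sum_le_const => y _; by rewrite lern1 leq_b1.
  by move=> h; move: (le_trans hk h); rewrite mulr1 -expr2 ger_pMl ?exprn_gt0.
pose cod x y : R := \sum_(z in A) (e x z && e z y)%:R.
pose ep : R := k ^+ 2 / 32.
pose bad x y := cod x y < ep * m.
pose nb z := [set x in A | e x z].
have S1 : k ^+ 2 * m ^+ 3 <= \sum_(z in A) #|nb z|%:R ^+ 2.
  have e1 : \sum_(z in A) #|nb z|%:R = \sum_(x in A) \sum_(y in A) (e x y)%:R :> R.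
    rewrite exchange_big /=; apply: eq_bigr => z _.
    by rewrite cardsE -sum1_card big_mkcondr natr_sum; apply: eq_bigr => x _; case: ifP.
  have := sum_sq_le (mem A) (fun z => #|nb z|%:R : R); rewrite e1 -/m.
  have h2 : (k * m ^+ 2) ^+ 2 <= (\sum_(x in A) \sum_(y in A) (e x y)%:R) ^+ 2.
    rewrite ler_sqr ?nnegrE ?mulr_ge0 ?sqr_ge0 ?(ltW k0) //.
    by do 2!apply: sumr_ge0 => ? _.
  move=> h3; rewrite -(ler_pM2l m0).
  by apply: le_trans (le_trans h2 h3); rewrite le_eqVlt; apply/orP; left; apply/eqP; ring.
have S2 : \sum_(z in A) \sum_(x in nb z) \sum_(y in nb z) (bad x y)%:R <= ep * m ^+ 3.
  apply: (@le_trans _ _ (\sum_(x in A) \sum_(y in A) (bad x y)%:R * cod x y)).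
    rewrite le_eqVlt; apply/orP; left; apply/eqP.
    transitivity (\sum_(z in A) \sum_(x in A) \sum_(y in A)
        (bad x y)%:R * (e x z && e z y)%:R : R).
      apply: eq_bigr => z _; rewrite [LHS](eq_bigl (fun x => (x \in A) && e x z)); last by move=> x; rewrite inE.
      rewrite big_mkcondr; apply: eq_bigr => x _; case: ifP => exz; last first.
        by rewrite big1 // => y _; rewrite mulr0.
      rewrite [LHS](eq_bigl (fun x => (x \in A) && e x z)); last by move=> y; rewrite inE.
      rewrite big_mkcondr; apply: eq_bigr => y _; rewrite esym /=.
      by case: ifP; rewrite ?mulr1 ?mulr0.
    rewrite exchange_big /=; apply: eq_bigr => x _.
    by rewrite exchange_big /=; apply: eq_bigr => y _; rewrite mulr_sumr.
  apply: le_trans (sum_le_const (c := m * (ep * m)) _) _.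
    move=> x _; apply: sum_le_const => y _; rewrite /bad.
    case: ltP => h; rewrite ?mul0r ?mul1r; first exact: ltW.
    by rewrite mulr_ge0 ?(ltW m0) // /ep divr_ge0 ?sqr_ge0.
  by rewrite -/m le_eqVlt; apply/orP; left; apply/eqP; ring.
(* The neighbourhood [U] of this [z] is large and at most a sixteenth of its pairs are bad. Hence
   three quarters of [U] are bad with at most a quarter of [U], and two such vertices share at least
   half of [U] as good midpoints. *)
have [z zA hz] : exists2 z, z \in A & k ^+ 2 / 2 * m ^+ 3 <= m * (#|nb z|%:R ^+ 2 -
    16 * \sum_(x in nb z) \sum_(y in nb z) (bad x y)%:R).
  apply: exists_ge_avg; first by rewrite !mulr_gt0 ?exprn_gt0 ?invr_gt0.
  rewrite sumrB -mulr_sumr.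
  have : 16 * \sum_(z in A) \sum_(x in nb z) \sum_(y in nb z) (bad x y)%:R <= k ^+ 2 / 2 * m ^+ 3.
    apply: le_trans (ler_wpM2l _ S2) _ => //.
    by rewrite le_eqVlt; apply/orP; left; apply/eqP; rewrite /ep; field.
  by move=> h; lra.
set U := nb z in hz; set u : R := #|U|%:R in hz.
set b := \sum_(x in U) \sum_(y in U) (bad x y)%:R in hz.
have b0 : 0 <= b by do 2!apply: sumr_ge0 => ? _.
have hz2 : k ^+ 2 / 2 * m ^+ 2 <= u ^+ 2 - 16 * b.
  by rewrite -(ler_pM2l m0); apply: le_trans hz; rewrite le_eqVlt; apply/orP; left; apply/eqP; ring.
have u0 : 0 < u.
  rewrite lt_def ler0n andbT; apply/eqP => uz; move: hz2; rewrite uz expr0n /=.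
  have p : 0 < k ^+ 2 / 2 * m ^+ 2 by rewrite !mulr_gt0 ?exprn_gt0 ?invr_gt0.
  by lra.
pose dg x : R := \sum_(y in U) (bad x y)%:R.
pose B := [set x in U | dg x <= u / 4].
have UA : U \subset A by apply/subsetP => x; rewrite inE => /andP[].
have BU : B \subset U by apply/subsetP => x; rewrite inE => /andP[].
have cB : 3 / 4 * u <= #|B|%:R.
  have h1 : (u - #|B|%:R) * (u / 4) <= b.
    have eU : u = #|B|%:R + #|U :\: B|%:R.
      by rewrite /u -(cardsID B U) natrD (setIidPr BU).
    rewrite eU addrAC subrr add0r -eU; rewrite /b (big_setID B) /= (setIidPr BU).
    apply: (@le_trans _ _ (\sum_(x in U :\: B) dg x)); last first.
      by rewrite lerDr; do 2!apply: sumr_ge0 => ? _.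
    rewrite -sum1_card natr_sum mulr_suml; apply: ler_sum => x.
    by rewrite !inE mul1r => /andP[+ xU]; rewrite xU /= -ltNge => /ltW.
  have h2 : b * 16 <= u ^+ 2.
    have : 0 <= k ^+ 2 / 2 * m ^+ 2 by rewrite mulr_ge0 ?sqr_ge0 // divr_ge0 ?sqr_ge0.
    by lra.
  rewrite leNgt; apply/negP => h3; nra.
have cU : k * m <= 3 / 2 * u.
  apply: sqr_le; first by lra.
  by rewrite !exprMn; have := sqr_ge0 u; lra.
exists B; split; first exact: subset_trans BU UA.
  by rewrite -/m; lra.
move=> x y xB yB.
pose good w := [&& w \in U, ~~ bad x w & ~~ bad w y].
have badC a c : bad a c = bad c a.
  by rewrite /bad /cod; congr (_ < _); apply: eq_bigr => w _; rewrite esym [e w c]esym andbC.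
have cg : u / 2 <= \sum_(w in U) (good w)%:R.
  have : u <= \sum_(w in U) ((good w)%:R + (bad x w)%:R + (bad y w)%:R) :> R.
    rewrite /u -sum1_card natr_sum; apply: ler_sum => w wU.
    rewrite /good wU /= [bad w y]badC; case: (bad x w); case: (bad y w) => /=; lra.
  rewrite !big_split /=; move: xB yB; rewrite !inE => /andP[_ h1] /andP[_ h2].
  by rewrite -/(dg x) -/(dg y); lra.
rewrite [leRHS]exchange_big /=.
apply: (@le_trans _ _ (\sum_(w in A) cod x w * cod w y)); last first.
  apply: ler_sum => w wA; rewrite /cod mulr_suml; apply: ler_sum => z1 _.
  rewrite mulr_sumr; apply: ler_sum => z2 _.
  by rewrite -natrM mulnb -andbA -andbA andbA; rewrite !andbA.
apply: (@le_trans _ _ (\sum_(w in U) (good w)%:R * (ep * m) ^+ 2)).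
  rewrite -mulr_suml; apply: le_trans (ler_wpM2r (sqr_ge0 _) cg).
  apply: (@le_trans _ _ (k * m / 3 * (ep * m) ^+ 2)); last first.
    by apply: ler_wpM2r; [exact: sqr_ge0 | lra].
  rewrite /ep; have -> : k * m / 3 * (k ^+ 2 / 32 * m) ^+ 2 = k ^+ 5 * m ^+ 3 / 3072 by field.
  have : 0 < k ^+ 5 * m ^+ 3 by rewrite mulr_gt0 ?exprn_gt0.
  by move=> h; lra.
rewrite [leRHS](big_setID U) /= (setIidPr UA).
apply: (@le_trans _ _ (\sum_(w in U) cod x w * cod w y)); last first.
  rewrite lerDl; apply: sumr_ge0 => w _; rewrite mulr_ge0 //; exact: sumr_ge0.
apply: ler_sum => w wU; rewrite /good wU /= /bad -!leNgt.
have c0 a c : 0 <= cod a c by apply: sumr_ge0.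
have e0 : 0 <= ep * m by rewrite mulr_ge0 ?(ltW m0) // /ep divr_ge0 ?sqr_ge0.
case: (leP _ (cod x w)) => h1 /=; last by rewrite mul0r mulr_ge0.
case: (leP _ (cod w y)) => h2 /=; last by rewrite mul0r mulr_ge0.
by rewrite mul1r expr2 ler_pM.
Qed.

Section Sumsets.
Variable V : finZmodType.
Implicit Types A B Y S : {set V}.

Definition sums A B : {set V} := [set a + b | a in A, b in B].
Definition diffs A B : {set V} := [set a - b | a in A, b in B].
Fixpoint nsums n S : {set V} := if n is m.+1 then sums (nsums m S) S else [set 0].

Lemma card_fibers (T : finType) (D : {set T}) (f : T -> V) (X : {set V}) (k : R) :
  (forall x, x \in X -> k <= \sum_(t in D) (f t == x)%:R) -> k * #|X|%:R <= #|D|%:R.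
Proof.
move=> h; apply: (@le_trans _ _ (\sum_(x in X) \sum_(t in D) (f t == x)%:R)).
  by rewrite mulrC -sum1_card natr_sum mulr_suml; apply: ler_sum => x xX; rewrite mul1r h.
rewrite exchange_big /= -[leRHS]mulr1; apply: sum_le_const => t _.
case: (boolP (f t \in X)) => ftX.
  rewrite (bigD1 (f t)) //= eqxx big1 ?addr0 // => x /andP[_ /negbTE].
  by rewrite eq_sym => ->.
rewrite big1 // => x xX; case: eqP => // e; by rewrite e xX in ftX.
Qed.

Definition popular A (k : R) : {set V} :=
  [set s | k <= \sum_(a in A) (a - s \in A)%:R].

(** A Ruzsa triangle inequality with multiplicity: for [x = y + s - a], every [c] in [A] with
    [c - s] in [A] writes [x] as [(y - (c - s)) - (a - c)], and popularity of [s] supplies at least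
    [k] such [c]. *)
Lemma popular_sums A Y (k : R) : 0 < k ->
  k * #|diffs (sums Y (popular A k)) A|%:R <= #|diffs Y A|%:R * #|diffs A A|%:R.
Proof.
move=> k0; rewrite -natrM -cardsX.
apply: (card_fibers (f := fun p => p.1 - p.2)) => x /imset2P[ys a /imset2P[y s yY sS ->] aA ->].
move: sS; rewrite inE => /le_trans; apply.
rewrite big_mkcond [leRHS]big_mkcond /=.
pose f (c : V) : V * V := (y - (c - s), a - c).
have fi : injective f by move=> c c' [_ /addrI/oppr_inj].
rewrite [leRHS](bigID (mem (f @: setT))) /= -[leLHS]addr0 lerD //; last first.
  by apply: sumr_ge0 => p _; case: ifP.
rewrite big_imset /=; last by move=> ? ? _ _; exact: fi.
rewrite [leRHS](eq_bigl xpredT) => [|c]; last by rewrite inE.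
apply: ler_sum => c _; rewrite inE /f /=.
case: ifP => cA; last by case: ifP.
case: (boolP (c - s \in A)) => csA; last by case: ifP.
have -> : y - (c - s) \in diffs Y A by apply: imset2_f.
have -> : a - c \in diffs A A by apply: imset2_f.
by rewrite /= !opprB addrA -(addrA y) subrK eqxx.
Qed.

Lemma nsumsD m n S x y : x \in nsums m S -> y \in nsums n S -> x + y \in nsums (m + n) S.
Proof.
move=> hx; elim: n y => [|n IH] y; first by rewrite inE => /eqP ->; rewrite addr0 addn0.
by rewrite addnS => /imset2P[y' s y'S sS ->]; rewrite addrA; apply: imset2_f => //; exact: IH.
Qed.

Lemma nsums1 S s : s \in S -> s \in nsums 1 S.
Proof. by move=> sS; rewrite -[s]add0r; apply: imset2_f; rewrite ?inE. Qed.

Lemma popularN A k s : s \in popular A k -> - s \in popular A k.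
Proof.
rewrite !inE => /le_trans; apply; rewrite big_mkcond [leRHS]big_mkcond /=.
rewrite (reindex_inj (addIr s)) /=; apply: ler_sum => a _.
by rewrite addrK opprK; case: (a \in A); case: (a + s \in A).
Qed.

(* Iterated sums of popular differences stay small; this replaces the
   Pluennecke inequality. *)
Lemma nsums_popular A (K : R) n : (0 < #|A|)%N -> 0 < K ->
  #|diffs A A|%:R <= K * #|A|%:R ->
  #|nsums n (popular A (#|A|%:R / (2 * K)))|%:R <= (2 * K ^+ 2) ^+ n * #|A|%:R.
Proof.
move=> A0 K0 hK; set k := _ / _; have a0 : 0 < #|A|%:R :> R by rewrite ltr0n.
have k0 : 0 < k by rewrite divr_gt0 // mulr_gt0.
have step m : #|diffs (nsums m (popular A k)) A|%:R <= (2 * K ^+ 2) ^+ m * #|A|%:R.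
  elim: m => [|m IH].
    rewrite expr0 mul1r ler_nat -(card_imset _ (@oppr_inj V)) subset_leq_card //.
    apply/subsetP => ? /imsetP[x /imset2P[y a + aA ->] ->]; rewrite inE => /eqP ->.
    by rewrite sub0r opprK.
  have h := popular_sums A (nsums m (popular A k)) k0.
  have e : (2 * K ^+ 2) ^+ m.+1 * #|A|%:R = ((2 * K ^+ 2) ^+ m * #|A|%:R) * (K * #|A|%:R) / k.
    by rewrite /k exprS; field; rewrite !gt_eqF.
  rewrite e ler_pdivlMr // mulrC; apply: le_trans h _.
  by apply: ler_pM.
apply: le_trans (step n); have /card_gt0P[a aA] := A0.
rewrite ler_nat -(card_imset _ (addIr (- a))); apply: subset_leq_card.
by apply/subsetP => x /imsetP[y yS ->]; apply: imset2_f.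
Qed.

(** There are at most [K * #|A|] differences, so with the threshold [#|A| / (2 K)] the unpopular
    ones account for at most half of the pairs; [a0] is found by averaging. *)
Lemma popular_part A (K : R) : (0 < #|A|)%N -> 0 < K ->
  #|diffs A A|%:R <= K * #|A|%:R ->
  exists2 a0, a0 \in A &
    (#|A|%:R : R) <= 2 * #|[set a in A | a - a0 \in popular A (#|A|%:R / (2 * K))]|%:R.
Proof.
move=> A0 K0 hK; set k := _ / _; have a0 : 0 < #|A|%:R :> R by rewrite ltr0n.
have k0 : 0 < k by rewrite divr_gt0 // mulr_gt0.
set m : R := #|A|%:R in hK a0 *.
have h1 : m ^+ 2 <= \sum_(c in A) (2 * #|[set a in A | a - c \in popular A k]|%:R).
  rewrite -mulr_sumr.
  have e1 : \sum_(c in A) #|[set a in A | a - c \in popular A k]|%:R =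
     \sum_(c in A) \sum_(a in A) (a - c \in popular A k)%:R :> R.
    apply: eq_bigr => c _; rewrite cardsE -sum1_card big_mkcondr natr_sum.
    by apply: eq_bigr => x _; case: ifP.
  have e2 : m ^+ 2 = \sum_(c in A) \sum_(a in A) (a - c \in popular A k)%:R +
      \sum_(c in A) \sum_(a in A) (a - c \notin popular A k)%:R.
    rewrite -big_split /= (eq_bigr (fun=> m)); last first.
      move=> c _; rewrite -big_split /= (eq_bigr (fun=> 1)) ?sumr_const //.
      by move=> a _; case: (a - c \in popular A k); rewrite ?addr0 ?add0r.
    by rewrite sumr_const -mulr_natl expr2.
  have e3 : \sum_(c in A) \sum_(a in A) (a - c \notin popular A k)%:R <= m ^+ 2 / 2 :> R.
    apply: (@le_trans _ _ (\sum_(s in diffs A A) k)); last first.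
      rewrite sumr_const -[leLHS]mulr_natl; apply: le_trans (ler_wpM2r (ltW k0) hK) _.
      by rewrite /k -/m le_eqVlt; apply/orP; left; apply/eqP; field; rewrite gt_eqF.
    apply: (@le_trans _ _ (\sum_(s in diffs A A) \sum_(c in A) \sum_(a in A)
       ((a - c == s) && (s \notin popular A k))%:R)).
      rewrite [leRHS]exchange_big /=; apply: ler_sum => c cA.
      rewrite [leRHS]exchange_big /=; apply: ler_sum => a aA.
      rewrite (bigD1 (a - c)) /=; last by apply: imset2_f.
      by rewrite eqxx /= lerDl; apply: sumr_ge0.
    apply: ler_sum => s _; case: (boolP (s \in popular A k)) => hs /=.
      by rewrite big1 ?ltW // => c _; rewrite big1 // => a _; rewrite andbF.
    move: hs; rewrite inE -ltNge => /ltW; apply: le_trans.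
    rewrite exchange_big /=; apply: ler_sum => a aA.
    case: (boolP (a - s \in A)) => has.
      rewrite (bigD1 (a - s)) //= big1 => [|c /andP[_ hc]].
        by rewrite addr0; case: (_ && _).
      by case: eqP => // e; move: hc; rewrite -e opprB addrC subrK eqxx.
    rewrite big1 // => c cA; case: eqP => //= e.
    by move: has; rewrite -e opprB addrC subrK cA.
  by rewrite e1; lra.
have [c cA hc] := exists_ge_avg (exprn_gt0 2 a0) h1.
exists c => //; rewrite -(ler_pM2l a0) -expr2; exact: hc.
Qed.

End Sumsets.
End PathsAndSumsets.

(** * A Freiman model for the peaks *)

Section FreimanModel.
Variables (R : realType) (G : finComNzRingType) (chi : G -> R[i]).
Hypothesis hchi : good_char chi.
Local Notation N := (#|G|%:R : R).
Variable g : G -> R.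
Hypothesis g1 : forall x, `|g x| <= 1.
Local Notation wp := (wp chi g).
Local Notation wt := (wt chi g).

Definition doubling_const (eta : R) : R := 2 ^+ 47 / eta ^+ 24.

(** Two points of the graph of [phi] are joined when their difference has weight at least [tau]. A
    path of length three between them and one more edge write a difference of [B] as a sum of four
    heavy elements in many ways, while at most [N / tau] elements are heavy. *)
Lemma small_difference_set (phi : G -> G) (eta : R) : 0 < eta -> eta <= 1 ->
  eta * N <= \sum_h wt h (phi h) ->
  exists B : {set G * G},
    [/\ forall a, a \in B -> a.2 = phi a.1 /\ eta / 2 <= wp a,
        eta ^+ 3 * N <= 32 * #|B|%:R
      & #|diffs B B|%:R <= doubling_const eta * #|B|%:R].
Proof.
move=> e0 e1 hw; have N0 := card_G_gt0 R G.
pose H := [set h in [set: G] | eta / 2 <= wt h (phi h)].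
pose Ga := [set (h, phi h) | h in H].
have GaP a : a \in Ga -> a.2 = phi a.1 /\ eta / 2 <= wp a.
  by case/imsetP => h; rewrite inE => /andP[_ hh] ->.
have cGa : eta / 2 * N <= #|Ga|%:R.
  rewrite card_imset; last by move=> ? ? [].
  rewrite -sum_bool.
  have : eta * N <= \sum_(h in [set: G]) (((eta / 2 <= wt h (phi h))%R%:R : R) + eta / 2).
    apply: le_trans hw _; rewrite [leRHS](eq_bigl xpredT) => [|h]; last by rewrite inE.
    apply: ler_sum => h _; case: (leP (eta / 2)) => hle /=; last by rewrite add0r ltW.
    by have := wt_le1 hchi g1 h (phi h); lra.
  rewrite big_split /= sumr_const cardsT -[X in _ <= _ + X]mulr_natl; lra.
set m : R := #|Ga|%:R in cGa.
have m0 : 0 < m by apply: lt_le_trans cGa; rewrite !mulr_gt0 // invr_gt0.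
have Ga0 : (0 < #|Ga|)%N by move: m0; rewrite /m ltr0n.
(* Half of [(eta / 2) ^+ 2]: by [wp_pairs] the pairs lighter than [tau] carry at most half of the
   energy. *)
pose tau := eta ^+ 2 / 8; have tau0 : 0 < tau by rewrite divr_gt0 ?exprn_gt0.
pose e (a b : G * G) := tau <= wp (a - b).
have esym : symmetric e by move=> a b; rewrite /e -(wpN hchi) opprB.
have he : tau * m ^+ 2 <= \sum_(x in Ga) \sum_(y in Ga) (e x y)%:R.
  have h1 : (eta / 2 * m) ^+ 2 <= \sum_(a in Ga) \sum_(a' in Ga) wp (a - a').
    apply: le_trans (wp_pairs hchi g1 Ga).
    rewrite ler_sqr ?nnegrE ?mulr_ge0 ?invr_ge0 ?(ltW e0) ?(ltW m0) //; last first.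
      by apply: sumr_ge0 => a _; exact: wp_ge0.
    rewrite mulrC /m -sum1_card natr_sum mulr_suml; apply: ler_sum => a.
    by rewrite mul1r => /GaP[].
  have h2 : \sum_(a in Ga) \sum_(a' in Ga) wp (a - a') <=
      \sum_(a in Ga) \sum_(a' in Ga) (((e a a')%:R : R) + tau).
    apply: ler_sum => a _; apply: ler_sum => a' _; rewrite /e.
    case: (leP tau) => h /=; last by rewrite add0r ltW.
    by have := wp_le1 hchi g1 (a - a'); lra.
  have h3 : \sum_(a in Ga) \sum_(a' in Ga) (((e a a')%:R : R) + tau) =
     \sum_(a in Ga) \sum_(a' in Ga) (e a a')%:R + tau * m ^+ 2.
    under eq_bigr do rewrite big_split /= sumr_const.
    rewrite big_split /= sumr_const; congr (_ + _).
    by rewrite -mulrnA -mulr_natr natrM -/m -expr2.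
  move: (le_trans h1 h2); rewrite h3 /tau; lra.
have [B [BGa cB hpath]] := bsg_paths esym tau0 Ga0 he.
have B0 : 0 < #|B|%:R :> R.
  by have p : 0 < tau * m by [rewrite mulr_gt0]; move: cB; rewrite -/m; lra.
exists B; split; first by move=> a /(subsetP BGa)/GaP.
  have : eta ^+ 3 * N = 16 * (tau * (eta / 2 * N)) by rewrite /tau; field.
  by have := ler_wpM2l (ltW tau0) cGa; move: cB; rewrite -/m; lra.
pose Gt := [set a | tau <= wp a].
have cGt : tau * #|Gt|%:R <= N.
  apply: le_trans (sum_wp hchi g1); rewrite mulrC -sum1_card natr_sum mulr_suml.
  apply: (@le_trans _ _ (\sum_(i in Gt) wp i)).
    by apply: ler_sum => a; rewrite inE mul1r.
  rewrite [leRHS](bigID (mem Gt)) /= lerDl; apply: sumr_ge0 => a _; exact: wp_ge0.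
have hf := @card_fibers R _ _ (setX (setX Gt Gt) (setX Gt Gt))
  (fun p => p.1.1 + p.1.2 + (p.2.1 + p.2.2)) (diffs B B) (tau ^+ 5 / 4096 * m ^+ 3).
have {}hf : tau ^+ 5 / 4096 * m ^+ 3 * #|diffs B B|%:R <= #|Gt|%:R ^+ 4.
  have -> : #|Gt|%:R ^+ 4 = #|setX (setX Gt Gt) (setX Gt Gt)|%:R :> R.
    by rewrite !cardsX !natrM; ring.
  apply: hf => _ /imset2P[v v' vB v'B ->].
  apply: le_trans (hpath v v' vB v'B) _.
  rewrite pair_big pair_big /=.
  pose f (p : (G * G) * (G * G) * (G * G)) :=
    ((v - p.1.1, p.1.1 - p.1.2), (p.1.2 - p.2, p.2 - v')).
  have fi : injective f.
    move=> [[z u] w] [[z' u'] w'] h.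
    have E1 := congr1 (fun p => p.1.1) h; have E2 := congr1 (fun p => p.1.2) h.
    have E3 := congr1 (fun p => p.2.1) h; move: E1 E2 E3; rewrite /=.
    move=> /addrI/oppr_inj -> /addrI/oppr_inj -> /addrI/oppr_inj ->.
    by [].
  rewrite big_mkcond [leRHS]big_mkcond /=.
  rewrite [leRHS](bigID (mem (f @: finset.setT))) /= -[leLHS]addr0 lerD //; last first.
    by apply: sumr_ge0 => p _; case: ifP.
  rewrite big_imset /=; last by move=> ? ? _ _; exact: fi.
  rewrite [leRHS](eq_bigl xpredT) => [|c]; last by rewrite inE.
  apply: ler_sum => -[[z u] w] _; rewrite /f /= !inE /e /=.
  case: ifP => _; last by case: ifP.
  case: (tau <= wp (v - z)); case: (tau <= wp (z - u)) => //=.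
  case: (tau <= wp (u - w)); case: (tau <= wp (w - v')) => //=.
  by rewrite !addrA !subrK eqxx.
have c4 : #|Gt|%:R ^+ 4 <= (N / tau) ^+ 4.
  have h : #|Gt|%:R <= N / tau by rewrite ler_pdivlMr // mulrC.
  by apply: lerXn2r => //; rewrite nnegrE // divr_ge0 // ltW.
have m3 : (eta / 2 * N) ^+ 3 <= m ^+ 3.
  by apply: lerXn2r => //; rewrite nnegrE ?(ltW m0) // mulr_ge0 ?divr_ge0 ?(ltW e0).
have cB2 : eta ^+ 3 / 32 * N <= #|B|%:R.
  have : eta ^+ 3 / 32 * N = (tau * (eta / 2 * N)) / 2 by rewrite /tau; field.
  by have := ler_wpM2l (ltW tau0) cGa; move: cB; rewrite -/m; lra.
pose c := tau ^+ 5 / 4096 * (eta / 2 * N) ^+ 3.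
have c0 : 0 < c by rewrite /c mulr_gt0 ?divr_gt0 ?exprn_gt0 // mulr_gt0 // divr_gt0.
apply: (@le_trans _ _ ((N / tau) ^+ 4 / c)).
  rewrite ler_pdivlMr // mulrC; apply: le_trans c4; apply: le_trans hf.
  apply: ler_wpM2r => //; rewrite /c; apply: ler_wpM2l m3.
  by rewrite divr_ge0 ?exprn_ge0 // ltW.
have -> : (N / tau) ^+ 4 / c = doubling_const eta * (eta ^+ 3 / 32 * N).
  by rewrite /c /doubling_const /tau; field; rewrite !gt_eqF.
by apply: ler_wpM2l cB2; rewrite divr_ge0 ?exprn_ge0 // ltW.
Qed.

Lemma chi_sub1_sum y : y != 0 -> \sum_z normc (1 - chi (z * y)) ^+ 2 = 2 * N.
Proof.
move=> y0; rewrite (eq_bigr (fun z => 2 - 2 * Re (chi (z * y)))); last first.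
  by move=> z _; rewrite normsq_sub1 ?(chi_norm hchi).
rewrite sumrB sumr_const -mulr_sumr -Re_sum.
have -> : \sum_z chi (z * y) = 0 by case: hchi => _ _; apply.
by rewrite mulr0 subr0 mulr_natr.
Qed.

Variable cell : G -> 'I_128.
Hypothesis cellP : forall x y, cell x = cell y -> normc (1 - chi (x - y)) <= 8^-1.

Lemma normc_sub1_prod (I : Type) (s : seq I) (u : I -> R[i]) :
  (forall i, normc (u i) = 1) ->
  normc (1 - \prod_(i <- s) u i) <= \sum_(i <- s) normc (1 - u i).
Proof.
move=> hu; elim: s => [|i s IH]; first by rewrite !big_nil subrr normc0.
rewrite !big_cons.
have -> : 1 - u i * \prod_(j <- s) u j = (1 - u i) + u i * (1 - \prod_(j <- s) u j) by ring.
by apply: le_trans (normcD _ _) _; rewrite lerD2l normcM hu mul1r.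
Qed.

Lemma chi_big (I : Type) (s : seq I) (u : I -> G) :
  chi (\sum_(i <- s) u i) = \prod_(i <- s) chi (u i).
Proof. by elim/big_rec2: _ => [|i y x _ <-]; rewrite ?(chi0 hchi) ?(chiD hchi). Qed.

(* Each frequency [z] separates a third of the remaining nonzero elements of
   [Y] from 0, at the cost of restricting to one of 128 arcs. *)
Lemma kill_fibre m (Y : {set G}) (A : {set G}) (phi : G -> G) :
  (#|Y :\ 0%R| * 2 ^ m < 3 ^ m)%N ->
  exists A' : {set G}, [/\ A' \subset A, (#|A| <= 128 ^ m * #|A'|)%N &
    forall s t : 'I_6 -> G, (forall i, s i \in A') -> (forall i, t i \in A') ->
      \sum_i (phi (s i) - phi (t i)) \in Y -> \sum_i (phi (s i) - phi (t i)) = 0].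
Proof.
elim: m Y A => [|m IH] Y A.
  rewrite !expn0 muln1 ltnS leqn0 cards_eq0 => /eqP Y0.
  exists A; split; rewrite ?mul1n // => s t _ _ hy; apply/eqP.
  by apply: contraT => ny; move: (in_set0 (\sum_i (phi (s i) - phi (t i)))); rewrite -Y0 !inE ny hy.
move=> hY; have N0 := card_G_gt0 R G.
pose near z y := normc (1 - chi (z * y)) < 1.
(* The mean over [z] of [normc (1 - chi (z * y)) ^+ 2] is 2 and its maximum is at most 4, so it is
   at least 1 for a third of the [z]. *)
have few y : y != 0 -> \sum_z (near z y)%:R <= 2 / 3 * N.
  move=> y0; have e := chi_sub1_sum y0.
  have : \sum_z normc (1 - chi (z * y)) ^+ 2 <= \sum_z (4 - 3 * (near z y)%:R).
    apply: ler_sum => z _; rewrite /near; case: ltP => h /=.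
      have : normc (1 - chi (z * y)) ^+ 2 <= 1 by apply: normc_sq_le1; exact: ltW.
      by lra.
    have : normc (1 - chi (z * y)) <= 2.
      by apply: le_trans (normcD _ _) _; rewrite normc1 normc_opp (chi_norm hchi); lra.
    by have := normc_ge0 (1 - chi (z * y)); nra.
  rewrite e sumrB -mulr_sumr sumr_const -[_ *+ _]mulr_natl; lra.
have [z hz] : exists z, (3 * #|[set y in Y :\ 0%R | near z y]| <= 2 * #|Y :\ 0%R|)%N.
  apply: contrapT => hn.
  have h1 : \sum_z \sum_(y in Y :\ 0%R) (near z y)%:R <= #|Y :\ 0%R|%:R * (2 / 3 * N).
    rewrite exchange_big /=; apply: sum_le_const => y; rewrite !inE => /andP[y0 _].
    exact: few.
  have h2 : \sum_(z : G) (2 / 3 * #|Y :\ 0%R|%:R) < \sum_z \sum_(y in Y :\ 0%R) ((near z y)%:R : R).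
    apply: ltr_sum; first by apply/hasP; exists 0; rewrite ?mem_index_enum.
    move=> z _; rewrite sum_bool; have : ~ (3 * #|[set y in Y :\ 0%R | near z y]| <= 2 * #|Y :\ 0%R|)%N.
      by move=> h; apply: hn; exists z.
    move/negP; rewrite -ltnNge -(ltr_nat R) !natrM; lra.
  move: h2; rewrite sumr_const -[_ *+ _]mulr_natl; move: h1; lra.
pose Y1 := [set y in Y | near z y].
have [c hc] : exists c : 'I_128, (#|A| <= 128 * #|[set h in A | cell (z * phi h)%R == c]|)%N.
  apply: contrapT => hn.
  have : (\sum_(c : 'I_128) 128 * #|[set h in A | cell (z * phi h)%R == c]| < \sum_(c : 'I_128) #|A|)%N.
    apply: (@leq_ltn_trans (\sum_(c : 'I_128) (#|A|.-1))); last first.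
      rewrite !sum_nat_const ltn_mul2l card_ord /=; case: (posnP #|A|) => [A0|]; last by case: #|A|.
      by exfalso; apply: hn; exists ord0; rewrite A0.
    apply: leq_sum => c _; rewrite -ltnS; apply: leq_trans (leqSpred _).
    by rewrite ltnNge; apply/negP => h; apply: hn; exists c.
  rewrite sum_nat_const card_ord -big_distrr /= ltn_mul2l /= => h.
  have : (\sum_(c : 'I_128) #|[set h in A | cell (z * phi h)%R == c]|)%N = #|A|.
    rewrite -sum1_card (partition_big (fun h => cell (z * phi h)%R) predT) //=.
    by apply: eq_bigr => c _; rewrite sum1dep_card; apply: eq_card => h'; rewrite !inE.
  by move=> e; rewrite e ltnn in h.
set A1 := [set h in A | _ == c] in hc.
have hY1 : (#|Y1 :\ 0%R| * 2 ^ m < 3 ^ m)%N.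
  have -> : Y1 :\ 0%R = [set y in Y :\ 0%R | near z y] by apply/setP => y; rewrite !inE andbA.
  move: hz hY; rewrite !expnS; set a := #|_|; set b := #|_|; nia.
have [A' [sA' cA' hA']] := IH Y1 A1 hY1.
exists A'; split.
- apply: subset_trans sA' _; by apply/subsetP => h; rewrite inE => /andP[].
- by apply: leq_trans hc _; rewrite expnS -mulnA leq_mul2l.
move=> s t sA tA hy; apply: hA' => //; rewrite inE hy /= /near.
rewrite mulr_sumr chi_big; apply: le_lt_trans (normc_sub1_prod _ _) _.
  by move=> i; rewrite (chi_norm hchi).
(* Six differences inside one arc, each within an eighth of 1, stay below the threshold 1 that
   defines [near]. *)
apply: le_lt_trans (sum_le_const (c := 8^-1) _) _ => [i _|].
  rewrite mulrBr; apply: cellP.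
  move: (subsetP sA' _ (sA i)) (subsetP sA' _ (tA i)); rewrite !inE.
  by move=> /andP[_ /eqP ->] /andP[_ /eqP ->].
by rewrite cardT size_enum_ord; lra.
Qed.

(** The exponent is 12 + 1: the fibre lies in a twelvefold sumset, and translating it by points of
    the graph takes one more summand. *)
Definition fibre_bound (eta : R) : R := 2 * (2 * doubling_const eta ^+ 2) ^+ 13.
Definition model_density (eta : R) : R := eta ^+ 3 / (64 * 128 * fibre_bound eta ^+ 14).

Lemma nsums_big (V : finZmodType) (S : {set V}) n k (x : 'I_n -> V) :
  (forall i, x i \in nsums k S) -> \sum_i x i \in nsums (n * k) S.
Proof.
elim: n x => [|n IH] x hx; first by rewrite big_ord0 inE.
by rewrite big_ord_recl mulSn; apply: nsumsD => //; apply: IH.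
Qed.

Lemma expn_lt3 n : (n * 2 ^ n < 3 ^ n)%N.
Proof.
elim: n => // -[|[|n]] // IH; rewrite !(expnS _ n.+2).
by move: IH; set x := (2 ^ _)%N; set y := (3 ^ _)%N; nia.
Qed.

Lemma leq_pow m a b : (a <= b)%N -> (a ^ m <= b ^ m)%N.
Proof. by move=> h; elim: m => // m IH; rewrite !expnS leq_mul. Qed.

(** For the least admissible exponent [m.+1], minimality gives [3 ^ m <= n * 2 ^ m], and
    [8 ^ m <= 9 ^ m] then yields [2 ^ m <= n ^ 2]. So the loss [128 ^ m = (2 ^ m) ^ 7] stays
    polynomial in [n]. *)
Lemma kill_steps n : exists m, (n * 2 ^ m < 3 ^ m)%N /\ (128 ^ m <= 128 * (maxn n 1) ^ 14)%N.
Proof.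
have ex : exists m, (n * 2 ^ m < 3 ^ m)%N by exists n; exact: expn_lt3.
case: (ex_minnP ex) => -[|m] hm min; first by exists 0%N; split => //; rewrite muln_gt0 expn_gt0 leq_maxr.
exists m.+1; split => //.
have h : (3 ^ m <= n * 2 ^ m)%N.
  by rewrite leqNgt; apply/negP => /min; rewrite ltnn.
have h2 : (2 ^ m <= n ^ 2)%N.
  rewrite -(@leq_pmul2r ((2 ^ m) ^ 2)) ?expn_gt0 // -expnMn.
  apply: (@leq_trans ((3 ^ m) ^ 2)); last by rewrite leq_exp2r.
  by rewrite -!expnM ![(m * 2)%N]mulnC !expnM -expnMn; apply: leq_pow.
rewrite expnS leq_mul2l; apply/orP; right.
have -> : (128 ^ m = (2 ^ m) ^ 7)%N by rewrite -expnM mulnC expnM.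
apply: (@leq_trans ((n ^ 2) ^ 7)); first exact: leq_pow.
by rewrite -expnM; apply: leq_pow; exact: leq_maxl.
Qed.

Lemma pair_sum (I : finType) (a b : I -> G) :
  \sum_i ((a i, b i) : G * G) = (\sum_i a i, \sum_i b i).
Proof.
apply: injective_projections => /=.
  by rewrite (big_morph fst (fun _ _ => erefl) erefl).
by rewrite (big_morph snd (fun _ _ => erefl) erefl).
Qed.

Lemma chain_bounds (x b c a z : R) :
  x <= 32 * b -> b <= 2 * c -> c <= 128 * z * a -> x <= a * (64 * 128 * z).
Proof. by move=> h1 h2 h3; lra. Qed.

(** Popular differences have small iterated sumsets, so a twelvefold one contains few points
    [(0, y)]: translated along the graph they stay distinct inside the thirteenfold one.
    [kill_fibre] then passes to a subset on which 0 is the only [y] that six differences can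
    produce. *)
Lemma freiman_model (phi : G -> G) (eta : R) : 0 < eta -> eta <= 1 ->
  eta * N <= \sum_h wt h (phi h) ->
  exists A : {set G}, [/\ model_density eta * N <= #|A|%:R,
    forall h, h \in A -> eta / 2 <= wt h (phi h) &
    forall s t : 'I_6 -> G, (forall i, s i \in A) -> (forall i, t i \in A) ->
      \sum_i (s i - t i) = 0 -> \sum_i (phi (s i) - phi (t i)) = 0].
Proof.
move=> e0 e1 hw; have N0 := card_G_gt0 R G.
have [B [BP cB dB]] := small_difference_set e0 e1 hw.
set K := doubling_const eta in dB; have K1 : 1 <= K.
  rewrite /K /doubling_const ler_pdivlMr ?exprn_gt0 // mul1r.
  apply: (@le_trans _ _ 1); last by apply: exprn_ege1; lra.
  by apply: exprn_ile1 => //; exact: ltW.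
have K0 : 0 < K by apply: lt_le_trans K1.
have B0r : 0 < #|B|%:R :> R.
  by have p : 0 < eta ^+ 3 * N by [rewrite mulr_gt0 ?exprn_gt0]; lra.
have B0 : (0 < #|B|)%N by rewrite -(ltr0n R).
have [a0 a0B cpop] := popular_part B0 K0 dB.
set S := popular B _ in cpop; set G2 := [set a in B | _] in cpop.
have hS n : #|nsums n S|%:R <= (2 * K ^+ 2) ^+ n * #|B|%:R := nsums_popular n B0 K0 dB.
pose A2 := [set a.1 | a in G2].
have G2P a : a \in G2 -> [/\ a.2 = phi a.1, eta / 2 <= wp a & a - a0 \in S].
  by rewrite inE => /andP[/BP[]].
have cA2 : #|A2| = #|G2|.
  by apply: card_in_imset => -[x y] [x' y'] /G2P[/= -> _ _] /G2P[/= -> _ _] ->.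
have [S12 eS12] : exists X, X = nsums 12 S by exists (nsums 12 S).
pose Y := [set y | ((0, y) : G * G) \in S12].
have cY : #|Y|%:R <= fibre_bound eta.
  have h1 : (#|G2| * #|Y| <= #|nsums 13 S|)%N.
    rewrite -cardsX; pose f (p : (G * G) * G) : G * G := (0, p.2) + (p.1 - a0).
    have fi : {in setX G2 Y &, injective f}.
      move=> [[x y] z] [[x' y'] z'] /setXP[/G2P[/= -> _ _] _] /setXP[/G2P[/= -> _ _] _] [].
      by rewrite !add0r => /addIr -> /addIr ->.
    rewrite -(card_in_imset fi); apply: subset_leq_card; apply/subsetP => ? /imsetP[[a y] /setXP[/G2P[_ _ aS] yY] ->].
    by apply: (@nsumsD _ 12 1); [move: yY; rewrite -eS12 in_set | exact: nsums1].
  have g20 : 0 < #|G2|%:R :> R by lra.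
  rewrite -(ler_pM2l g20) -natrM; apply: le_trans (_ : #|nsums 13 S|%:R <= _); first by rewrite ler_nat.
  apply: le_trans (hS 13%N) _; rewrite /fibre_bound -/K.
  have p0 : 0 <= (2 * K ^+ 2) ^+ 13 by rewrite exprn_ge0 // mulr_ge0 // sqr_ge0.
  by have := ler_wpM2l p0 cpop; set z := (2 * K ^+ 2) ^+ 13; lra.
have fb1 : 1 <= fibre_bound eta.
  rewrite /fibre_bound -/K; have : 1 <= (2 * K ^+ 2) ^+ 13.
    apply: exprn_ege1; have : 1 <= K ^+ 2 by exact: exprn_ege1.
    by lra.
  by set z := _ ^+ 13; lra.
have [m [hm1 hm2]] := kill_steps #|Y :\ 0%R|.
have [A' [sA cA hA]] := kill_fibre A2 phi hm1.
have A'P h : h \in A' -> (h, phi h) \in G2.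
  move/(subsetP sA)/imsetP => [[x y] hxy ->] /=.
  by have [/= <- _ _] := G2P _ hxy.
exists A'; split.
- have h1 : #|A2|%:R <= 128 * fibre_bound eta ^+ 14 * #|A'|%:R.
    apply: le_trans (_ : (128 ^ m * #|A'|)%:R <= _); first by rewrite ler_nat.
    rewrite natrM; apply: ler_wpM2r => //.
    apply: le_trans (_ : (128 * maxn #|Y :\ 0%R| 1 ^ 14)%:R <= _); first by rewrite ler_nat.
    rewrite natrM natrX; apply: ler_wpM2l => //; apply: lerXn2r; rewrite ?nnegrE //; first by lra.
    rewrite natr_max ge_max fb1 andbT; apply: le_trans cY.
    by rewrite ler_nat subset_leq_card // subD1set.
  have f0 : 0 < fibre_bound eta by apply: lt_le_trans fb1.
  have D0 : 0 < 64 * 128 * fibre_bound eta ^+ 14 by apply: mulr_gt0; [lra | exact: exprn_gt0].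
  rewrite /model_density mulrAC (ler_pdivrMr _ _ D0).
  move: h1; rewrite cA2 => h1; exact: (chain_bounds cB cpop h1).
- by move=> h /A'P/G2P[_ hh _]; exact: hh.
move=> s t hs ht h0.
have key : ((0, \sum_i (phi (s i) - phi (t i))) : G * G) \in S12; last first.
  have {}key : \sum_i (phi (s i) - phi (t i)) \in Y by rewrite in_set.
  exact: hA s t hs ht key.
rewrite eS12.
have -> : ((0, \sum_i (phi (s i) - phi (t i))) : G * G) =
   \sum_(i < 6) (((s i, phi (s i)) - a0) - ((t i, phi (t i)) - a0)).
  rewrite [RHS](eq_bigr (fun i => ((s i - t i, phi (s i) - phi (t i)) : G * G))).
    by rewrite pair_sum h0.
  by move=> i _; rewrite opprB addrA subrK.
apply: (@nsums_big _ _ 6 2) => i; apply: (@nsumsD _ 1 1); apply: nsums1.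
  by have [] := G2P _ (A'P _ (hs i)).
by apply: popularN; have [] := G2P _ (A'P _ (ht i)).
Qed.

End FreimanModel.

(** * Bohr sets and the symmetric bilinear form *)

Section Bogolyubov.
Variables (R : realType) (G : finComNzRingType) (chi : G -> R[i]).
Hypothesis hchi : good_char chi.
Local Notation N := (#|G|%:R : R).
Local Notation C := R[i].
Let N0 : 0 < N := card_G_gt0 R G.

Definition ahat (A : {set G}) k : C := \sum_(a in A) chi (k * a).

(** The normalised number of representations in [A - A + A - A], used as a smooth weight on that
    set. *)
Definition rep (A : {set G}) (x : G) : R :=
  (\sum_(a in A) \sum_(a' in A) \sum_(b in A) \sum_(b' in A) (a - a' + (b - b') == x)%:R) / N ^+ 3.

Definition bohr (T : {set G}) (e : R) (t : G) : Prop :=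
  forall k, k \in T -> normc (1 - chi (k * t)) <= e.

Definition lspec (A : {set G}) (k : R) := [set x | k * N ^+ 2 <= normc (ahat A x) ^+ 2].

Lemma card_set_le (A : {set G}) : #|A|%:R <= N.
Proof. by rewrite ler_nat max_card. Qed.

Lemma ahat_le A k : normc (ahat A k) <= #|A|%:R.
Proof.
apply: le_trans (normc_sum _ _ _) _; rewrite -[leRHS]mulr1.
by apply: sum_le_const => a _; rewrite (chi_norm hchi).
Qed.

Lemma sum_ahat2 A : \sum_k normc (ahat A k) ^+ 2 = N * #|A|%:R.
Proof.
have e k : ahat A k = \sum_x ((x \in A)%:R : C) * chi (k * x).
  rewrite /ahat big_mkcond; apply: eq_bigr => x _.
  by case: ifP; rewrite ?mul1r ?mul0r.
under eq_bigr do rewrite e.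
rewrite (parseval hchi); congr (_ * _).
rewrite -sum1_card natr_sum [RHS]big_mkcond; apply: eq_bigr => x _.
by case: ifP; rewrite ?normc1 ?normc0 ?expr1n ?expr0n.
Qed.

Lemma sum_ahat4 A : \sum_k normc (ahat A k) ^+ 4 <= N ^+ 4.
Proof.
apply: (@le_trans _ _ (\sum_k N ^+ 2 * normc (ahat A k) ^+ 2)).
  apply: ler_sum => k _; rewrite (exprD _ 2 2); apply: ler_wpM2r; first exact: sqr_ge0.
  apply: lerXn2r; rewrite ?nnegrE ?normc_ge0 ?(ltW N0) //.
  exact: le_trans (ahat_le _ _) (card_set_le _).
rewrite -mulr_sumr sum_ahat2 (exprD _ 2 2) ler_pM2l ?exprn_gt0 // expr2 ler_pM2l //.
exact: card_set_le.
Qed.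

Lemma rep_fourier A x :
  (N ^+ 4 * rep A x)%:C%C = \sum_k (normc (ahat A k) ^+ 4)%:C%C * chi (- (k * x)).
Proof.
have -> : N ^+ 4 * rep A x = N * (\sum_(a in A) \sum_(a' in A) \sum_(b in A)
    \sum_(b' in A) (a - a' + (b - b') == x)%:R).
  by rewrite /rep; field; rewrite gt_eqF.
under [RHS]eq_bigr => k _.
  rewrite normquad_sum mulr_suml.
  under eq_bigr do rewrite mulr_suml.
  under eq_bigr do under eq_bigr do rewrite mulr_suml.
  under eq_bigr do under eq_bigr do under eq_bigr do rewrite mulr_suml.
  over.
rewrite /= [RHS]exchange_big RCM RC_sum mulr_sumr; apply: eq_bigr => a _.
rewrite [RHS]exchange_big RC_sum mulr_sumr; apply: eq_bigr => a' _.
rewrite [RHS]exchange_big RC_sum mulr_sumr; apply: eq_bigr => b _.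
rewrite [RHS]exchange_big RC_sum mulr_sumr; apply: eq_bigr => b' _.
rewrite [X in _ * X]RC_nat mulrC -subr_eq0 -(chi_sumC hchi); apply: eq_bigr => k _.
by rewrite -!(chiN hchi) -!(chiD hchi); congr chi; ring.
Qed.

Lemma rep_ge0 A x : 0 <= rep A x.
Proof. by rewrite divr_ge0 ?exprn_ge0 //; do 4!apply: sumr_ge0 => ? _. Qed.

Lemma rep_le1 A x : rep A x <= 1.
Proof.
have N4 : 0 < N ^+ 4 by rewrite exprn_gt0.
rewrite -(ler_pM2l N4) mulr1; apply: le_trans (ler_norm _) _.
rewrite -normc_real rep_fourier; apply: le_trans (normc_sum _ _ _) _.
apply: le_trans (sum_ahat4 A); apply: ler_sum => k _.
by rewrite normcM (chi_norm hchi) mulr1 normc_real ger0_norm // exprn_ge0 ?normc_ge0.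
Qed.

Lemma rep0_ge (A : {set G}) : (#|A|%:R / N) ^+ 4 <= rep A 0.
Proof.
have N4 : 0 < N ^+ 4 by rewrite exprn_gt0.
have e : N ^+ 4 * rep A 0 = \sum_k normc (ahat A k) ^+ 4.
  apply: complexI; rewrite rep_fourier RC_sum; apply: eq_bigr => k _.
  by rewrite mulr0 oppr0 (chi0 hchi) mulr1.
rewrite -(ler_pM2l N4) e expr_div_n mulrC divfK ?gt_eqF // (bigD1 0) //=.
have -> : ahat A 0 = #|A|%:R.
  by rewrite /ahat (eq_bigr (fun=> 1)) ?sumr_const // => a _; rewrite mul0r (chi0 hchi).
rewrite -(RC_nat R) normc_real ger0_norm // lerDl; apply: sumr_ge0 => k _.
by rewrite exprn_ge0 ?normc_ge0.
Qed.

Lemma card_lspec A (k : R) : 0 < k -> k * #|lspec A k|%:R <= 1.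
Proof.
move=> k0; have N2 : 0 < N ^+ 2 by rewrite exprn_gt0.
rewrite -(ler_pM2l N2) mulr1.
apply: (@le_trans _ _ (\sum_(x in lspec A k) normc (ahat A x) ^+ 2)).
  rewrite mulrA -sum1_card natr_sum mulr_sumr; apply: ler_sum => x.
  by rewrite inE mulr1 mulrC.
apply: (@le_trans _ _ (\sum_x normc (ahat A x) ^+ 2)).
  by rewrite [leRHS](bigID (mem (lspec A k))) /= lerDl; apply: sumr_ge0 => x _; exact: sqr_ge0.
by rewrite sum_ahat2 expr2 ler_pM2l // card_set_le.
Qed.

(** The Fourier coefficients of [rep A] are fourth powers. On the large spectrum the character moves
    by at most [e]; off it one factor [normc (ahat A y) ^+ 2] is at most [k * N ^+ 2], and Parseval
    sums the rest. *)
Lemma rep_lip A (k e : R) t x : 0 <= k -> 0 <= e -> bohr (lspec A k) e t ->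
  `|rep A (x + t) - rep A x| <= e + 2 * k.
Proof.
move=> k0 e0 ht; have N4 : 0 < N ^+ 4 by rewrite exprn_gt0.
rewrite -(ler_pM2l N4) -{1}(ger0_norm (ltW N4)) -normrM mulrBr -normc_real RCB.
rewrite !rep_fourier -sumrB; apply: le_trans (normc_sum _ _ _) _.
apply: (@le_trans _ _ (\sum_y (e * normc (ahat A y) ^+ 4 + 2 * k * N ^+ 2 * normc (ahat A y) ^+ 2))).
  apply: ler_sum => y _; rewrite -mulrBr normcM normc_real ger0_norm ?exprn_ge0 ?normc_ge0 //.
  have -> : normc (chi (- (y * (x + t))) - chi (- (y * x))) = normc (1 - chi (y * t)).
    rewrite -(normc_conj (1 - _)) conjcB conjc1 -(chiN hchi) normcB.
    rewrite -[RHS]mul1r -(chi_norm hchi (- (y * x))) -normcM mulrBr mulr1.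
    by rewrite -(chiD hchi) mulrDr opprD.
  have a0 := normc_ge0 (ahat A y).
  have p2 : 0 <= normc (ahat A y) ^+ 2 by exact: sqr_ge0.
  have p4 : 0 <= normc (ahat A y) ^+ 4 by rewrite exprn_ge0.
  case: (boolP (y \in lspec A k)) => hy.
    have := ht _ hy => h; have h2 := ler_wpM2l p4 h.
    have : 0 <= 2 * k * N ^+ 2 * normc (ahat A y) ^+ 2 by rewrite !mulr_ge0 ?sqr_ge0.
    by lra.
  have h2 : normc (1 - chi (y * t)) <= 2.
    by apply: le_trans (normcD _ _) _; rewrite normc1 normc_opp (chi_norm hchi); lra.
  move: hy; rewrite inE -ltNge => /ltW hy.
  apply: (@le_trans _ _ (normc (ahat A y) ^+ 4 * 2)); first exact: ler_wpM2l.
  have h3 : normc (ahat A y) ^+ 4 <= k * N ^+ 2 * normc (ahat A y) ^+ 2.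
    by rewrite (exprD _ 2 2); apply: ler_wpM2r.
  have : 0 <= e * normc (ahat A y) ^+ 4 by rewrite mulr_ge0.
  by lra.
rewrite big_split /= -!mulr_sumr sum_ahat2 mulrDr [_ * e]mulrC.
apply: lerD; first by apply: ler_wpM2l => //; exact: sum_ahat4.
rewrite (_ : N ^+ 4 * (2 * k) = 2 * k * N ^+ 2 * (N * N)); last by ring.
by apply: ler_wpM2l; [rewrite !mulr_ge0 ?sqr_ge0 | rewrite ler_pM2l // card_set_le].
Qed.

Lemma repP A x : 0 < rep A x -> exists a a' b b',
  [/\ a \in A, a' \in A, b \in A & b' \in A] /\ a - a' + (b - b') = x.
Proof.
move=> h; apply: contrapT => hn; move: h; rewrite /rep.
rewrite big1 ?mul0r ?ltxx // => a aA; rewrite big1 // => a' a'A; rewrite big1 // => b bA.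
rewrite big1 // => b' b'A; case: eqP => // e; exfalso; apply: hn.
by exists a, a', b, b'.
Qed.

Section Freiman.
Variables (A : {set G}) (phi : G -> G).
Hypothesis Fr : forall s t : 'I_6 -> G, (forall i, s i \in A) -> (forall i, t i \in A) ->
  \sum_i (s i - t i) = 0 -> \sum_i (phi (s i) - phi (t i)) = 0.

(** Additivity of [Phi] compares three elements of [A - A + A - A], that is twelve elements of [A],
    six on each side; hence the order of the Freiman condition. *)
Lemma Fr6 a1 a2 a3 a4 a5 a6 b1 b2 b3 b4 b5 b6 :
  all (mem A) [:: a1; a2; a3; a4; a5; a6] -> all (mem A) [:: b1; b2; b3; b4; b5; b6] ->
  a1 + a2 + a3 + a4 + a5 + a6 = b1 + b2 + b3 + b4 + b5 + b6 ->
  phi a1 + phi a2 + phi a3 + phi a4 + phi a5 + phi a6 =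
  phi b1 + phi b2 + phi b3 + phi b4 + phi b5 + phi b6.
Proof.
move=> /allP hs /allP ht e; apply/eqP; rewrite -subr_eq0; apply/eqP.
have := Fr (s := fun i => nth 0 [:: a1; a2; a3; a4; a5; a6] i)
  (t := fun i => nth 0 [:: b1; b2; b3; b4; b5; b6] i).
rewrite !big_ord_recr !big_ord0 /= => h; rewrite -h.
- by ring.
- by move=> i; apply: hs; rewrite mem_nth //= ltn_ord.
- by move=> i; apply: ht; rewrite mem_nth //= ltn_ord.
transitivity (a1 + a2 + a3 + a4 + a5 + a6 - (b1 + b2 + b3 + b4 + b5 + b6)); first by ring.
by rewrite e subrr.
Qed.

(** Extends [phi] additively to [A - A + A - A]. By [PhiE] the representation picked does not
    matter; elsewhere the value is the default 0, and later statements are guarded by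
    [0 < rep A x]. *)
Definition Phi (x : G) : G :=
  if [pick q : (G * G) * (G * G) | [&& q.1.1 \in A, q.1.2 \in A, q.2.1 \in A, q.2.2 \in A &
        q.1.1 - q.1.2 + (q.2.1 - q.2.2) == x]] is Some q
  then phi q.1.1 - phi q.1.2 + (phi q.2.1 - phi q.2.2) else 0.

Lemma PhiE a a' b b' : a \in A -> a' \in A -> b \in A -> b' \in A ->
  Phi (a - a' + (b - b')) = phi a - phi a' + (phi b - phi b').
Proof.
move=> aA a'A bA b'A; rewrite /Phi; case: pickP => [[[c c'] [d d']] /=|/(_ ((a, a'), (b, b')))].
  case/and5P => cA c'A dA d'A /eqP e.
  have := @Fr6 c d a' b' a a a b c' d' a a; rewrite /= cA dA a'A b'A aA bA c'A d'A.
  move/(_ isT isT) => h; have {}h := h _.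
  have /h {}h : c + d + a' + b' + a + a = a + b + c' + d' + a + a.
    apply/eqP; rewrite -subr_eq0; apply/eqP.
    transitivity ((c - c' + (d - d')) - (a - a' + (b - b'))); first by ring.
    by rewrite e subrr.
  apply/eqP; rewrite -subr_eq0; apply/eqP; move/eqP: h; rewrite -subr_eq0 => /eqP <-; ring.
by rewrite /= aA a'A bA b'A eqxx.
Qed.

Lemma PhiD x y : 0 < rep A x -> 0 < rep A y -> 0 < rep A (x + y) ->
  Phi (x + y) = Phi x + Phi y.
Proof.
move=> /repP[a [a' [b [b' [[aA a'A bA b'A] <-]]]]].
move=> /repP[c [c' [d [d' [[cA c'A dA d'A] <-]]]]].
move=> /repP[u [u' [v [v' [[uA u'A vA v'A] e]]]]].
rewrite -e !PhiE //.
have := @Fr6 u v a' b' c' d' a b c d u' v'.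
rewrite /= aA bA cA dA uA vA a'A b'A c'A d'A u'A v'A; move/(_ isT isT) => h.
have /h {}h : u + v + a' + b' + c' + d' = a + b + c + d + u' + v'.
  apply/eqP; rewrite -subr_eq0; apply/eqP.
  transitivity ((u - u' + (v - v')) - (a - a' + (b - b') + (c - c' + (d - d')))); first by ring.
  by rewrite e subrr.
apply/eqP; rewrite -subr_eq0; apply/eqP; move/eqP: h; rewrite -subr_eq0 => /eqP <-; ring.
Qed.

Lemma sum_rep (F : G -> C) : \sum_x (rep A x)%:C%C * F x =
  (\sum_(a in A) \sum_(a' in A) \sum_(b in A) \sum_(b' in A) F (a - a' + (b - b'))) / N%:C%C ^+ 3.
Proof.
have N30 : N%:C%C ^+ 3 != 0 :> C by rewrite expf_neq0 // fmorph_eq0 gt_eqF.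
rewrite /rep; apply: (mulIf N30); rewrite divfK // mulr_suml.
under eq_bigr => x _.
  rewrite (_ : _ * F x * _ = (\sum_(a in A) \sum_(a' in A) \sum_(b in A) \sum_(b' in A)
     (a - a' + (b - b') == x)%:R)%:C%C * F x); last first.
    have -> (u : R) : (u / N ^+ 3)%:C%C = u%:C%C / N%:C%C ^+ 3 :> C.
      by rewrite RCM fmorphV rmorphXn.
    by rewrite -mulrA [F x * _]mulrC mulrA divfK.
  rewrite RC_sum mulr_suml.
  under eq_bigr do rewrite RC_sum mulr_suml.
  under eq_bigr do under eq_bigr do rewrite RC_sum mulr_suml.
  under eq_bigr do under eq_bigr do under eq_bigr do rewrite RC_sum mulr_suml.
  over.
rewrite /= exchange_big; apply: eq_bigr => a _.
rewrite exchange_big; apply: eq_bigr => a' _.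
rewrite exchange_big; apply: eq_bigr => b _.
rewrite exchange_big; apply: eq_bigr => b' _.
rewrite -(sum_delta F); apply: eq_bigr => x _.
by rewrite RC_nat eq_sym.
Qed.

(** On [A - A + A - A] the phase splits over the four summands, so the sum factors into a fourth
    power. *)
Lemma rep_linear_sum d1 d2 :
  \sum_x (rep A x)%:C%C * chi (Phi x * d1 - d2 * x) =
  (normc (\sum_(a in A) chi (phi a * d1 - d2 * a)) ^+ 4 / N ^+ 3)%:C%C.
Proof.
rewrite sum_rep RCM normquad_sum; congr (_ * _); last by rewrite fmorphV rmorphXn.
apply: eq_bigr => a aA; apply: eq_bigr => a' a'A.
apply: eq_bigr => b bA; apply: eq_bigr => b' b'A.
by rewrite PhiE // -!(chiN hchi) -!(chiD hchi); congr chi; ring.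
Qed.

(* A linear phase with a large mean over [A] is almost constant along every
   direction that almost preserves [rep A]. *)
Lemma biased_phase_small d1 d2 t (c e : R) :
  0 < c -> 0 < rep A t -> (forall x, `|rep A (x + t) - rep A x| <= e) ->
  c * N <= normc (\sum_(a in A) chi (phi a * d1 - d2 * a)) ->
  c ^+ 4 * normc (1 - chi (Phi t * d1 - d2 * t)) <= e.
Proof.
move=> c0 rt he hc; pose l x := Phi x * d1 - d2 * x.
pose F x := (rep A x)%:C%C * chi (l x).
have hF x : normc (F (x + t) - F x * chi (l t)) <= e.
  apply: le_trans (he x); rewrite /F.
  have r0 := rep_ge0 A.
  case: (ltrgtP 0 (rep A x)) (r0 x) => // [rx _|rx _]; last first.
    rewrite -rx mul0r mul0r !subr0 normcM (chi_norm hchi) mulr1 normc_real.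
    by rewrite ger0_norm ?r0.
  case: (ltrgtP 0 (rep A (x + t))) (r0 (x + t)) => // [rxt _|rxt _]; last first.
    rewrite -rxt mul0r sub0r normc_opp !normcM !(chi_norm hchi) !mulr1 normc_real.
    by rewrite sub0r normrN.
  have -> : l (x + t) = l x + l t by rewrite /l PhiD //; ring.
  rewrite (chiD hchi (l x) (l t)) mulrA -mulrBl -mulrBl -RCB.
  by rewrite !normcM !(chi_norm hchi) !mulr1 normc_real.
have e1 : \sum_x (F (x + t) - F x * chi (l t)) = (\sum_x F x) * (1 - chi (l t)).
  rewrite sumrB -mulr_suml mulrBr mulr1; congr (_ - _).
  by rewrite [RHS](reindex_inj (addIr t)).
have h1 : normc ((\sum_x F x) * (1 - chi (l t))) <= N * e.
  by rewrite -e1; apply: le_trans (normc_sum _ _ _) _; apply: sum_le_const => x _; exact: hF.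
move: h1; rewrite normcM /F rep_linear_sum normc_real => h1.
rewrite -(ler_pM2l N0) mulrA; apply: le_trans h1; apply: ler_wpM2r; first exact: normc_ge0.
rewrite ger0_norm ?divr_ge0 ?exprn_ge0 ?normc_ge0 // ler_pdivlMr ?exprn_gt0 //.
rewrite (_ : N * c ^+ 4 * N ^+ 3 = (c * N) ^+ 4); last by ring.
by apply: lerXn2r => //; rewrite nnegrE ?normc_ge0 // mulr_ge0 // ltW.
Qed.

Section Symmetry.
Variable g : G -> R.
Hypothesis g1 : forall x, `|g x| <= 1.
Local Notation wt := (wt chi g).
Variable eta : R.
Hypothesis eta0 : 0 < eta.
Hypothesis hA : forall h, h \in A -> eta / 2 <= wt h (phi h).
Hypothesis A0 : (0 < #|A|)%N.

(** [wp_pairs] and [wp_quads] applied to the graph of [phi] over [A]; by [PhiE] the resulting sum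
    over quadruples only meets points [(x, Phi x)], each counted with multiplicity [rep A x]. *)
Lemma rep_energy : (eta / 2) ^+ 4 * (#|A|%:R / N) ^+ 4 * N <= \sum_x rep A x * wt x (Phi x).
Proof.
pose Ga := [set (h, phi h) | h in A].
have gi : {in A &, injective (fun h => (h, phi h))} by move=> ? ? _ _ [].
have h1 : (eta / 2 * #|A|%:R) ^+ 2 <= \sum_(a in Ga) \sum_(a' in Ga) wp chi g (a - a').
  apply: le_trans (wp_pairs hchi g1 Ga); apply: lerXn2r.
  - by rewrite nnegrE mulr_ge0 // divr_ge0 // ltW.
  - by rewrite nnegrE; apply: sumr_ge0 => a _; exact: wp_ge0.
  rewrite big_imset //= mulrC -sum1_card natr_sum mulr_suml; apply: ler_sum => h hAh.
  by rewrite mul1r; exact: hA.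
have h2 := wp_quads hchi g1 Ga.
have s0 : 0 <= (eta / 2 * #|A|%:R) ^+ 2 by exact: sqr_ge0.
have h3 : (eta / 2 * #|A|%:R) ^+ 4 <= N ^+ 3 * \sum_x rep A x * wt x (Phi x).
  apply: le_trans (_ : ((eta / 2 * #|A|%:R) ^+ 2) ^+ 2 <= _); first by rewrite -exprM.
  have h4 : ((eta / 2 * #|A|%:R) ^+ 2) ^+ 2 <= (\sum_(a in Ga) \sum_(a' in Ga) wp chi g (a - a')) ^+ 2.
    by apply: lerXn2r => //; rewrite nnegrE //; apply: le_trans h1.
  apply: le_trans h4 (le_trans h2 _); rewrite le_eqVlt; apply/orP; left; apply/eqP.
  apply: complexI; rewrite RCM RC_sum [X in _ = _ * X]RC_sum.
  under [X in _ = _ * X]eq_bigr do rewrite RCM.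
  rewrite (sum_rep (fun x => (wt x (Phi x))%:C%C)) mulrC rmorphXn /= divfK; last first.
    by rewrite expf_neq0 // fmorph_eq0 gt_eqF.
  rewrite big_imset //=; apply: eq_bigr => a aA; rewrite RC_sum.
  rewrite big_imset //=; apply: eq_bigr => a' a'A; rewrite RC_sum.
  rewrite big_imset //=; apply: eq_bigr => b bA; rewrite RC_sum.
  rewrite big_imset //=; apply: eq_bigr => b' b'A.
  by rewrite PhiE.
have -> : (eta / 2) ^+ 4 * (#|A|%:R / N) ^+ 4 * N = (eta / 2 * #|A|%:R) ^+ 4 / N ^+ 3.
  by field; rewrite gt_eqF.
by rewrite ler_pdivrMr ?exprn_gt0 // [leRHS]mulrC.
Qed.

(** After fixing [x], Cauchy-Schwarz in [k] removes [g (x + k)], and a change of variables separates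
    the rest into one factor for [h], one for [h'] and the antisymmetric phase
    [phi h * h' - phi h' * h]. A second Cauchy-Schwarz, in [h], removes the factor of [h] and leaves
    exponential sums over [A] that are large on average. *)
Lemma biased_set : exists hs (T : {set G}), [/\ hs \in A, T \subset A,
  eta ^+ 4 / 32 * #|A|%:R <= #|T|%:R & forall h1, h1 \in T -> eta ^+ 4 / 32 * #|A|%:R <=
    normc (\sum_(a in A) chi (phi a * (h1 - hs) - (phi h1 - phi hs) * a))].
Proof.
set a : R := #|A|%:R; have a0 : 0 < a by rewrite ltr0n.
have ea0 : 0 < eta / 2 * a by rewrite !mulr_gt0 // invr_gt0.
pose P x k : C := \sum_(h in A) (g (x + h) * g (x + h + k))%:C%C * chi (- (phi h * k)).
pose S x : C := \sum_k (g (x + k))%:C%C * P x k.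
have e1 : (\sum_(h in A) N ^+ 2 * wt h (phi h))%:C%C = \sum_x (g x)%:C%C * S x.
  rewrite RC_sum; under eq_bigr do rewrite (wtE hchi).
  rewrite exchange_big; apply: eq_bigr => x _ /=.
  rewrite exchange_big (reindex_inj (addrI x)) mulr_sumr; apply: eq_bigr => k _ /=.
  rewrite !mulr_sumr; apply: eq_bigr => h _.
  rewrite (_ : phi h * (x - (x + k)) = - (phi h * k)); last by ring.
  by rewrite [x + k + h]addrAC !RCM; ring.
have [x _ hx] : exists2 x : G, xpredT x & eta / 2 * a * N ^+ 2 <= N * normc (S x).
  have := @exists_ge_avg R G xpredT (fun x => normc (S x)) (eta / 2 * a * N ^+ 2).
  apply; first by rewrite mulr_gt0 ?exprn_gt0.
  apply: (@le_trans _ _ (\sum_(h in A) N ^+ 2 * wt h (phi h))).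
    rewrite mulrC mulrCA /a -sum1_card natr_sum !mulr_sumr; apply: ler_sum => h hh.
    by rewrite mulr1 [leRHS]mulrC ler_pM2r ?exprn_gt0 // hA.
  apply: le_trans (ler_norm _) _; rewrite -normc_real e1.
  apply: le_trans (normc_sum _ _ _) _; apply: ler_sum => x _.
  by rewrite normcM normc_real ler_piMl ?normc_ge0.
have hS : eta / 2 * a * N <= normc (S x).
  by rewrite -(ler_pM2l N0); apply: le_trans hx; rewrite le_eqVlt; apply/orP; left; apply/eqP; ring.
pose d z h : C := (g (x + h) * g (x + z - h))%:C%C * chi (- (phi h * (z - h))).
have d1 z h : normc (d z h) <= 1.
  by rewrite normcM (chi_norm hchi) mulr1 normc_real normrM mulr_ile1.
pose Q z : C := \sum_(h in A) d z h * (\sum_(h' in A) conjc (d z h') * chi (phi h * h' - phi h' * h)).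
have e2 : (\sum_k normc (P x k) ^+ 2)%:C%C = \sum_z Q z.
  rewrite RC_sum; under eq_bigr do rewrite normsq_sum.
  rewrite exchange_big [RHS]exchange_big; apply: eq_bigr => h _ /=.
  under [RHS]eq_bigr do rewrite mulr_sumr.
  rewrite exchange_big [RHS]exchange_big; apply: eq_bigr => h' _ /=.
  (* The substitution [k = z - h - h'] exchanges the roles of [h] and [h'] in the shifted factors:
     [x + h + k] becomes [x + z - h']. This decouples them. *)
  rewrite (reindex_inj (addrI (- h - h'))); apply: eq_bigr => z _ /=.
  rewrite /d !conjcM !conjc_real -!(chiN hchi).
  rewrite (_ : x + h + (- h - h' + z) = x + z - h'); last by ring.
  rewrite (_ : x + h' + (- h - h' + z) = x + z - h); last by ring.
  have ex : chi (- (phi h * (- h - h' + z))) * chi (- - (phi h' * (- h - h' + z))) =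
    chi (- (phi h * (z - h))) * chi (- - (phi h' * (z - h'))) * chi (phi h * h' - phi h' * h).
    by rewrite -!(chiD hchi); congr chi; ring.
  rewrite mulrACA ex !RCM; ring.
have [z _ hz] : exists2 z : G, xpredT z & (eta / 2 * a) ^+ 2 * N <= N * normc (Q z).
  apply: exists_ge_avg; first by rewrite mulr_gt0 ?exprn_gt0.
  have h1 : normc (S x) ^+ 2 <= N * \sum_k normc (P x k) ^+ 2.
    apply: le_trans (sumC_sq_le _ _) _; apply: ler_wpM2l => //.
    apply: ler_sum => k _; apply: lerXn2r; rewrite ?nnegrE ?normc_ge0 //.
    by rewrite normcM normc_real ler_piMl ?normc_ge0.
  have h2 : (eta / 2 * a * N) ^+ 2 <= normc (S x) ^+ 2.
    by apply: lerXn2r => //; rewrite nnegrE ?normc_ge0 // mulr_ge0 // ltW.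
  have h3 : \sum_k normc (P x k) ^+ 2 <= \sum_z normc (Q z).
    apply: le_trans (ler_norm _) _; rewrite -normc_real e2; exact: normc_sum.
  rewrite -(ler_pM2l N0); apply: le_trans (ler_wpM2l (ltW N0) h3).
  by apply: le_trans (le_trans h2 h1); rewrite le_eqVlt; apply/orP; left; apply/eqP; ring.
have hQ : (eta / 2 * a) ^+ 2 <= normc (Q z).
  by rewrite -(ler_pM2l N0) mulrC.
pose E h1 h2 : C := \sum_(b in A) chi (phi b * (h1 - h2) - (phi h1 - phi h2) * b).
have E1 h1 h2 : normc (E h1 h2) <= a.
  apply: le_trans (normc_sum _ _ _) _; rewrite -[leRHS]mulr1.
  by apply: sum_le_const => b _; rewrite (chi_norm hchi).
have h4 : ((eta / 2 * a) ^+ 2) ^+ 2 <= a * \sum_(h2 in A) \sum_(h1 in A) normc (E h1 h2).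
  apply: (@le_trans _ _ (normc (Q z) ^+ 2)).
    by apply: lerXn2r => //; rewrite nnegrE ?normc_ge0 // sqr_ge0.
  apply: le_trans (CauchySchwarzC _ _ _) _; apply: ler_pM.
  - by apply: sumr_ge0 => ? _; exact: sqr_ge0.
  - by apply: sumr_ge0 => ? _; exact: sqr_ge0.
  - by rewrite -[leRHS]mulr1; apply: sum_le_const => h _; apply: normc_sq_le1.
  apply: le_trans (ler_norm _) _; rewrite -normc_real RC_sum.
  under eq_bigr do rewrite normsq_sum.
  rewrite (_ : \sum_(i in A) _ =
    \sum_(h2 in A) \sum_(h1 in A) conjc (d z h1) * d z h2 * E h1 h2).
    apply: le_trans (normc_sum _ _ _) _; apply: ler_sum => h2 _.
    apply: le_trans (normc_sum _ _ _) _; apply: ler_sum => h1 _.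
    by rewrite normcM ler_piMl ?normc_ge0 // normcM normc_conj mulr_ile1 ?normc_ge0.
  rewrite exchange_big [RHS]exchange_big; apply: eq_bigr => h1 _ /=.
  rewrite exchange_big; apply: eq_bigr => h2 _ /=.
  rewrite mulr_sumr; apply: eq_bigr => b _.
  rewrite (conjcM (conjc (d z h2))) conjcK -(chiN hchi) mulrACA -(chiD hchi).
  by congr (_ * chi _); ring.
have [hs hsA hhs] : exists2 h2, h2 \in A & (eta / 2) ^+ 4 * a ^+ 3 <= a * \sum_(h1 in A) normc (E h1 h2).
  apply: exists_ge_avg; first by rewrite !mulr_gt0 ?exprn_gt0 ?mulr_gt0 ?invr_gt0.
  by rewrite -(ler_pM2l a0); apply: le_trans h4; rewrite le_eqVlt; apply/orP; left; apply/eqP; ring.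
pose T := [set h1 in A | eta ^+ 4 / 32 * a <= normc (E h1 hs)].
have TA : T \subset A by apply/subsetP => h; rewrite inE => /andP[].
exists hs, T; split => //; last by move=> h1; rewrite inE => /andP[].
have h5 : \sum_(h1 in A) normc (E h1 hs) <= #|T|%:R * a + a * (eta ^+ 4 / 32 * a).
  apply: (@le_trans _ _ (\sum_(h1 in A) (((eta ^+ 4 / 32 * a <= normc (E h1 hs))%R%:R : R) * a + eta ^+ 4 / 32 * a))).
    apply: ler_sum => h1 _; case: (leP (eta ^+ 4 / 32 * a)) => hh /=; last by rewrite mul0r add0r ltW.
    rewrite mul1r; apply: le_trans (E1 h1 hs) _; rewrite lerDl mulr_ge0 ?(ltW a0) //.
    by rewrite divr_ge0 // exprn_ge0 // ltW.
  by rewrite big_split /= -mulr_suml sum_bool sumr_const -[X in _ + X]mulr_natl.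
have h6 : (eta / 2) ^+ 4 * a ^+ 2 <= #|T|%:R * a + a * (eta ^+ 4 / 32 * a).
  apply: le_trans h5; rewrite -(ler_pM2l a0); apply: le_trans hhs.
  by rewrite le_eqVlt; apply/orP; left; apply/eqP; ring.
rewrite -(ler_pM2r a0); move: h6.
have -> : (eta / 2) ^+ 4 * a ^+ 2 = eta ^+ 4 / 16 * a * a by field.
have -> : a * (eta ^+ 4 / 32 * a) = eta ^+ 4 / 32 * a * a by ring.
have -> : eta ^+ 4 / 16 * a * a = eta ^+ 4 / 32 * a * a + eta ^+ 4 / 32 * a * a by field.
by rewrite lerD2r.
Qed.

End Symmetry.
End Freiman.

Lemma sub1D x y : normc (1 - chi (x + y)) <= normc (1 - chi x) + normc (1 - chi y).
Proof.
have -> : 1 - chi (x + y) = (1 - chi x) + chi x * (1 - chi y) by rewrite (chiD hchi); ring.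
by apply: le_trans (normcD _ _) _; rewrite normcM (chi_norm hchi) mul1r.
Qed.

Lemma sub1N x : normc (1 - chi (- x)) = normc (1 - chi x).
Proof. by rewrite -(normc_conj (1 - chi x)) conjcB conjc1 (chiN hchi). Qed.

Definition sym_density (eta : R) : R := eta ^+ 4 / 32 * model_density eta.
Definition bohr_radius (eta e : R) : R := e * sym_density eta ^+ 4 / 12.

Lemma model_density_bounds eta : 0 < eta -> eta <= 1 -> 0 < model_density eta :> R.
Proof.
move=> e0 e1; rewrite /model_density divr_gt0 ?exprn_gt0 //.
apply: mulr_gt0; first by lra.
rewrite exprn_gt0 // /fibre_bound mulr_gt0 // exprn_gt0 // mulr_gt0 // exprn_gt0 //.
by rewrite /doubling_const divr_gt0 ?exprn_gt0.
Qed.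

(* The outcome of the Freiman-Bogolyubov analysis: on a Bohr set of bounded
   rank the peaks of the ambiguity function of [g] are given by an additive map
   [F] whose associated bilinear form is almost symmetric. *)
Lemma local_bilinear (g : G -> R) (phi : G -> G) (eta e : R) (cell : G -> 'I_128) :
  (forall x, `|g x| <= 1) ->
  (forall x y, cell x = cell y -> normc (1 - chi (x - y)) <= 8^-1) ->
  0 < eta -> eta <= 1 -> 0 < e -> e <= 1 ->
  eta * N <= \sum_h wt chi g h (phi h) ->
  exists (T : {set G}) (r : G -> R) (F : G -> G),
  [/\ bohr_radius eta e * #|T|%:R <= 2,
      (forall x, 0 <= r x <= 1) /\
      (forall t, bohr T (bohr_radius eta e) t -> 0 < r t /\ forall x, `|r (x + t) - r x| <= e),
      forall x y, 0 < r x -> 0 < r y -> 0 < r (x + y) -> F (x + y) = F x + F y,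
      (eta / 2) ^+ 4 * model_density eta ^+ 4 * N <= \sum_x r x * wt chi g x (F x) &
      forall t s, bohr T (bohr_radius eta e) t -> bohr T (bohr_radius eta e) s ->
        normc (1 - chi (F t * s - F s * t)) <= e].
Proof.
move=> g1 hcell eta0 eta1 e0 e1 hw.
have [A [cA hA Fr]] := freiman_model hchi g1 hcell eta0 eta1 hw.
have m0 := model_density_bounds eta0 eta1.
have aN0 : 0 < #|A|%:R :> R by apply: lt_le_trans cA; rewrite mulr_gt0.
have A0 : (0 < #|A|)%N by rewrite -(ltr0n R).
have [hs [T [hsA TA cT hT]]] := biased_set g1 eta0 hA A0.
set k := bohr_radius eta e; set s0 := sym_density eta.
have e4 : 0 < eta ^+ 4 / 32 by rewrite divr_gt0 ?exprn_gt0.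
have s00 : 0 < s0 by rewrite mulr_gt0.
have sm : s0 <= model_density eta.
  rewrite /s0 /sym_density ler_piMl ?(ltW m0) //.
  have : eta ^+ 4 <= 1 by apply: exprn_ile1 => //; exact: ltW.
  by lra.
have k0 : 0 < k by rewrite /k /bohr_radius divr_gt0 // mulr_gt0 // exprn_gt0.
(* The variation [k + 2 * k] allowed by [rep_lip] must be below the lower bound [s0 ^+ 4] for [rep]
   at 0, so that [rep] is positive on the Bohr set, and small enough for [biased_phase_small] to
   yield [e / 4]. *)
have k3 : k + 2 * k = e * s0 ^+ 4 / 4 by rewrite /k /bohr_radius -/s0; field.
have s4 : 0 < s0 ^+ 4 by rewrite exprn_gt0.
have k3s : k + 2 * k < s0 ^+ 4.
  rewrite k3; have : e * s0 ^+ 4 <= s0 ^+ 4 by rewrite ler_piMl // ltW.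
  by lra.
have s1 : s0 ^+ 4 <= 1.
  have : 0 < rep A 0 -> True by [].
  move=> _; apply: le_trans (rep_le1 A 0); apply: le_trans (rep0_ge A).
  apply: lerXn2r; rewrite ?nnegrE ?(ltW s00) ?divr_ge0 ?(ltW N0) // ler_pdivlMr //.
  by apply: le_trans cA; rewrite ler_pM2r.
have k3e : k + 2 * k <= e.
  rewrite k3; have : e * s0 ^+ 4 <= e by rewrite ler_piMr // ltW.
  by lra.
have dA : s0 <= #|A|%:R / N.
  by rewrite ler_pdivlMr //; apply: le_trans cA; rewrite ler_pM2r.
have dT : s0 <= #|T|%:R / N.
  rewrite ler_pdivlMr //; apply: le_trans cT; rewrite /s0 /sym_density -(mulrA (eta ^+ 4 / 32)).
  by rewrite ler_pM2l.
have pos (B : {set G}) t : s0 <= #|B|%:R / N -> bohr (lspec B k) k t -> 0 < rep B t.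
  move=> dB ht; have := rep_lip 0 (ltW k0) (ltW k0) ht; rewrite add0r ler_norml => /andP[h _].
  have h2 : s0 ^+ 4 <= rep B 0.
    by apply: le_trans (rep0_ge B); apply: lerXn2r; rewrite ?nnegrE ?(ltW s00) ?divr_ge0.
  by lra.
have sub t (B : {set G}) : B = A \/ B = T -> bohr (lspec A k :|: lspec T k) k t -> bohr (lspec B k) k t.
  by move=> hB ht x hx; apply: ht; rewrite inE; case: hB => <-; rewrite hx ?orbT.
exists (lspec A k :|: lspec T k), (rep A), (Phi A phi); split.
- have h : #|lspec A k :|: lspec T k|%:R <= #|lspec A k|%:R + #|lspec T k|%:R :> R.
    by rewrite -natrD ler_nat leq_card_setU.
  have := ler_wpM2l (ltW k0) h; have := card_lspec A k0; have := card_lspec T k0.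
  by lra.
- split => [x|t ht]; first by rewrite rep_ge0 rep_le1.
  have htA := sub t A (or_introl erefl) ht; split; first exact: pos.
  by move=> x; apply: le_trans (rep_lip x (ltW k0) (ltW k0) htA) _.
- by move=> x y; apply: PhiD.
- apply: le_trans (rep_energy Fr g1 eta0 hA); apply: ler_wpM2r => //.
  apply: ler_wpM2l; first by rewrite exprn_ge0 // divr_ge0 // ltW.
  by apply: lerXn2r; rewrite ?nnegrE ?(ltW m0) ?divr_ge0 // ler_pdivlMr.
move=> t s ht hsb.
have htA := sub t A (or_introl erefl) ht; have hsT := sub s T (or_intror erefl) hsb.
(* Bogolyubov's argument for the biased set: [s] is [h1 - h3 + (h2 - h4)] with four elements of [T],
   each giving a phase within [e / 4]; the base point [hs] cancels. *)
have [h1 [h3 [h2 [h4 [[h1T h3T h2T h4T] <-]]]]] := repP (pos T s dT hsT).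
have inA h : h \in T -> h \in A by exact: (subsetP TA).
rewrite PhiE //; try exact: inA.
pose l h := Phi A phi t * (h - hs) - (phi h - phi hs) * t.
have hl h : h \in T -> normc (1 - chi (l h)) <= e / 4.
  move=> hh; rewrite -(ler_pM2l s4).
  have -> : s0 ^+ 4 * (e / 4) = k + 2 * k by rewrite k3; field.
  apply: (biased_phase_small Fr s00 (pos A t dA htA)).
    by move=> x; apply: (rep_lip x (ltW k0) (ltW k0) htA).
  apply: le_trans (hT h hh); by rewrite /s0 /sym_density -(mulrA (eta ^+ 4 / 32)) ler_pM2l.
have -> : Phi A phi t * (h1 - h3 + (h2 - h4)) - (phi h1 - phi h3 + (phi h2 - phi h4)) * t =
  (l h1 - l h3) + (l h2 - l h4) by rewrite /l; ring.
apply: le_trans (sub1D _ _) _.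
have p u v : u \in T -> v \in T -> normc (1 - chi (l u - l v)) <= e / 2.
  move=> uT vT; apply: le_trans (sub1D _ _) _; rewrite sub1N.
  by have := hl _ uT; have := hl _ vT; lra.
by have := p _ _ h1T h3T; have := p _ _ h2T h4T; lra.
Qed.

End Bogolyubov.

(** * Characters of Z/n *)

Section CyclicNorm.
Variable p : nat.
Local Notation n := (p.+2).
Local Notation G := ('Z_n).

Lemma card_ZN : #|G| = n. Proof. exact: card_ord. Qed.

Lemma val_lt (x : G) : (x < n)%N. Proof. exact: ltn_ord. Qed.

Lemma val_nat (k : nat) : (k%:R : G) = (k %% n)%N :> nat.
Proof. by rewrite val_Zp_nat. Qed.

Lemma natr_val (x : G) : (nat_of_ord x)%:R = x.
Proof. by apply: val_inj; rewrite /= val_nat modn_small // val_lt. Qed.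

Lemma natr_n : (n%:R : G) = 0.
Proof. by apply: val_inj; exact: etrans (val_nat _) (modnn _). Qed.

Lemma val_add (x y : G) : (x + y : G) = ((x + y) %% n)%N :> nat.
Proof. by []. Qed.

Lemma val_opp (x : G) : (- x : G) = ((n - x) %% n)%N :> nat.
Proof. by []. Qed.

(** The distance to the nearest multiple of [n], kept as an integer so that size conditions can be
    stated without division. *)
Definition mag (x : G) : nat := minn x (n - x).

Lemma mag0 : mag 0 = 0%N. Proof. by rewrite /mag min0n. Qed.

Lemma magN x : mag (- x) = mag x.
Proof.
rewrite /mag val_opp; have := val_lt x; case: (posnP x) => [->|x0] h.
  by rewrite subn0 modnn subn0 minnC.
by rewrite modn_small; lia.
Qed.

Lemma mag_natr k : (mag k%:R <= k)%N.
Proof. by rewrite /mag val_nat geq_min leq_mod. Qed.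

Lemma mag_rep (x : G) : x = (mag x)%:R \/ x = - (mag x)%:R.
Proof.
rewrite /mag; case: (leqP x (n - x)) => h.
  by left; rewrite natr_val.
right; rewrite natrB ?(ltnW (val_lt x)) //.
by rewrite natr_n sub0r opprK natr_val.
Qed.

Lemma magD (x y : G) : (mag (x + y)%R <= mag x + mag y)%N.
Proof.
rewrite /mag val_add; have hx := val_lt x; have hy := val_lt y.
case: (ltnP (x + y) n) => h; first by rewrite modn_small; lia.
have -> : ((x + y) %% n = x + y - n)%N.
  by rewrite -{1}(subnK h) modnDr modn_small; lia.
by lia.
Qed.

Lemma magM (k : nat) (x : G) : (mag (k%:R * x)%R <= k * mag x)%N.
Proof.
elim: k => [|k IH]; first by rewrite mul0r mag0.
rewrite -natr1 mulrDl mul1r mulSn addnC; apply: leq_trans (magD _ _) _.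
by rewrite leq_add2r.
Qed.

Lemma mag_lt (x : G) : ((mag x).*2 <= n)%N.
Proof. by rewrite /mag; have := val_lt x; lia. Qed.

Lemma mag_eq0 x : (mag x == 0%N) = (x == 0).
Proof.
apply/eqP/eqP => [h|->]; last by rewrite mag0.
by case: (mag_rep x); rewrite h ?oppr0.
Qed.

Definition arc (T : nat) (x : G) : nat := (x * T %/ n)%N.

Lemma arc_lt T x : (0 < T)%N -> (arc T x < T)%N.
Proof. by move=> T0; rewrite /arc ltn_divLR // mulnC ltn_pmul2l // val_lt. Qed.

Lemma arc_near T x y : arc T x = arc T y -> (T * mag (x - y)%R <= n)%N.
Proof.
wlog h : x y / (y <= x)%N => [hw e|].
  case: (leqP y x) => h; first exact: hw.
  by rewrite -magN opprB; apply: hw; rewrite ?(ltnW h).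
rewrite /arc => e.
have -> : x - y = (x - y)%N%:R by rewrite natrB // !natr_val.
apply: (@leq_trans (T * (x - y))); first by rewrite leq_mul2l mag_natr orbT.
have e1 := divn_eq (x * T) n; have e2 := divn_eq (y * T) n; rewrite -e in e2.
have r : ((x * T) %% n < n)%N by rewrite ltn_mod.
have : ((x - y) * T <= n)%N by rewrite mulnBl; lia.
by rewrite mulnC.
Qed.

(** [y] stays at distance at least [s / T] from both ends of its arc, multiplied out by [T]. *)
Definition inner (T s : nat) (y : G) : bool := (s <= (y * T) %% n)%N && ((y * T) %% n + s <= n)%N.

Lemma inner_arc T s (y u : G) : inner T s y -> (T * mag u < s)%N -> arc T (y + u) = arc T y.
Proof.
case/andP=> h1 h2 hu; have hy := val_lt y.
have e := divn_eq (y * T) n.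
have T0 : (0 < T)%N by case: T h1 h2 hu e => // /=; rewrite muln0 mod0n; case: s.
have q : (arc T y < T)%N := arc_lt y T0.
rewrite -/(arc T y) in e.
case: (mag_rep u) => ->; set m := mag u in hu *.
  have lt : (y + m < n)%N.
    rewrite -(@ltn_pmul2r T) //; move: e h1 h2 hu q.
    by set r := (_ %% _)%N; set a := arc _ _ => e h1 h2 hu q; nia.
  have -> : y + m%:R = (y + m)%N%:R by rewrite natrD natr_val.
  rewrite {1}/arc val_nat modn_small // mulnDl e -addnA divnMDl //.
  by rewrite divn_small ?addn0 //; nia.
have le : (m <= y)%N.
  rewrite -(@leq_pmul2r T) //; move: e h1 hu; set r := (_ %% _)%N; nia.
have -> : y - m%:R = (y - m)%N%:R by rewrite natrB // natr_val.
rewrite {1}/arc val_nat modn_small; last by apply: leq_ltn_trans hy; exact: leq_subr.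
rewrite mulnBl e -addnBA; last by move: h1 hu; set r := (_ %% _)%N; nia.
by rewrite divnMDl // divn_small ?addn0 //; move: h2 hu; set r := (_ %% _)%N; nia.
Qed.

(** Within one arc consecutive points have residues [y * T] spaced by [T], so the arc and the
    quotient of the residue by [T] determine [y]. *)
Lemma card_low T s : (0 < T)%N -> (#|[set y : G | (y * T) %% n < s]| <= s + T)%N.
Proof.
move=> T0; set A := [set _ | _].
pose f (y : G) : 'I_T * 'I_(s %/ T).+1 :=
  (Ordinal (arc_lt y T0), inord ((y * T) %% n %/ T)%N).
have fi : {in A &, injective f}.
  move=> y y'; rewrite !inE => hy hy' [e1 e2].
  move/(congr1 val): e2; rewrite /= !inordK ?ltnS ?leq_div2r ?(ltnW hy) ?(ltnW hy') // => e2.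
  apply: val_inj => /=; rewrite /arc in e1.
  have := divn_eq (y * T) n; have := divn_eq (y' * T) n; rewrite -e1.
  have := divn_eq ((y * T) %% n) T; have := divn_eq ((y' * T) %% n) T; rewrite -e2.
  have := ltn_pmod ((y * T) %% n) T0; have := ltn_pmod ((y' * T) %% n) T0.
  set a := ((y * T) %/ n * n)%N; set b := ((y * T) %% n %/ T * T)%N.
  set r1 := ((y * T) %% n %% T)%N; set r2 := ((y' * T) %% n %% T)%N.
  by move=> ? ? ? ? ? ?; nia.
rewrite -(card_in_imset fi); apply: leq_trans (max_card _) _.
by rewrite card_prod !card_ord mulnS addnC leq_add2r mulnC leq_divM.
Qed.

Lemma card_not_inner T s : (0 < T)%N -> (#|[set y : G | ~~ inner T s y]| <= 2 * (s + T))%N.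
Proof.
move=> T0; rewrite mul2n -addnn.
have sub : [set y : G | ~~ inner T s y] \subset
    [set y : G | (y * T) %% n < s]%N :|: -%R @: [set y : G | (y * T) %% n < s]%N.
  apply/subsetP => y; rewrite !inE /inner negb_and -!ltnNge => /orP[->//|h].
  apply/orP; right; apply/imsetP; exists (- y); last by rewrite opprK.
  rewrite inE val_opp; case: (posnP y) => [y0|y0].
    by move: h; rewrite y0 mul0n mod0n subn0 modnn mul0n mod0n; lia.
  have -> : ((n - y) %% n = n - y)%N by rewrite modn_small //; have := val_lt y; lia.
  rewrite mulnBl; have e := divn_eq (y * T) n.
  have r : ((y * T) %% n < n)%N by rewrite ltn_mod.
  have a := arc_lt y T0; rewrite /arc in a.
  have -> : (n * T - y * T = (T - (y * T) %/ n).-1 * n + (n - (y * T) %% n))%N.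
    move: e r a; set q := (_ %/ _)%N; set t := (_ %% _)%N => e r a; rewrite e; nia.
  rewrite modnMDl; case: (posnP ((y * T) %% n)) => [e0|t0].
    by rewrite e0 subn0 modnn; move: h; rewrite e0; lia.
  by rewrite modn_small; lia.
apply: leq_trans (subset_leq_card sub) (leq_trans (leq_card_setU _ _) _).
by apply: leq_add; rewrite ?(card_imset _ oppr_inj) card_low.
Qed.

End CyclicNorm.

Section CyclicGroup.
Variable R : realType.
Local Notation C := R[i].

Definition ex (t : R) : C := Complex (cos t) (sin t).

Lemma exD s t : ex (s + t) = ex s * ex t.
Proof.
apply/eqP; rewrite eq_complex /= cosD sinD eqxx /=; apply/eqP; ring.
Qed.

Lemma ex_norm t : normc (ex t) = 1.
Proof. by rewrite /normc /= cos2Dsin2 sqrtr1. Qed.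

Lemma ex0 : ex 0 = 1. Proof. by rewrite /ex cos0 sin0. Qed.

Lemma ex_2pi (n : nat) : ex (n%:R * (2 * pi)) = 1.
Proof.
elim: n => [|n IH]; first by rewrite mul0r ex0.
rewrite -natr1 mulrDl mul1r exD IH mul1r /ex.
by rewrite (_ : 2 * pi = pi *+ 2) ?cos2pi ?sin2pi // mulr_natl.
Qed.

Lemma ex_sub1 t : 0 <= t -> normc (1 - ex t) <= 2 * t.
Proof.
move=> t0.
have cosb : `|1 - cos t| <= t.
  have [c _ e] := @MVT_segment R cos (fun x => - sin x) 0 t t0
    (fun x _ => is_derive_cos x) (continuous_subspaceT (@continuous_cos R)).
  rewrite -cos0 distrC e subr0 normrM normrN (ger0_norm t0).
  by rewrite ler_piMl // sin_max.
have sinb : `|sin t| <= t.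
  have [c _ e] := @MVT_segment R sin cos 0 t t0
    (fun x _ => is_derive_sin x) (continuous_subspaceT (@continuous_sin R)).
  rewrite -[sin t]subr0 -{1}sin0 e subr0 normrM (ger0_norm t0).
  by rewrite ler_piMl // cos_max.
rewrite /normc /= sub0r sqrrN; apply: sqr_le; first by lra.
rewrite sqr_sqrtr ?addr_ge0 ?sqr_ge0 //.
move: cosb sinb; rewrite !ler_norml => /andP[c1 c2] /andP[s1 s2].
by nra.
Qed.

Variable p : nat.
Local Notation n := (p.+2).
Local Notation G := ('Z_n).
Local Notation N := (n%:R : R).
Let N0 : 0 < N. Proof. by rewrite ltr0n. Qed.

Definition chi (x : G) : C := ex (2 * pi * (nat_of_ord x)%:R / N).

Lemma chi_nat (k : nat) : chi k%:R = ex (2 * pi * k%:R / N).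
Proof.
rewrite /chi val_nat {2}(divn_eq k n) natrD natrM.
rewrite (_ : 2 * pi * ((k %/ n)%:R * N + (k %% n)%:R) / N =
   (k %/ n)%:R * (2 * pi) + 2 * pi * (k %% n)%:R / N); last first.
  by rewrite mulrDr mulrDl mulrA mulfK ?gt_eqF // [2 * pi * (k %/ n)%:R]mulrC.
by rewrite exD ex_2pi mul1r.
Qed.

Lemma chi_add x y : chi (x + y) = chi x * chi y.
Proof.
rewrite -(natr_val x) -(natr_val y) -natrD !chi_nat natrD -exD; congr ex.
by rewrite mulrDr mulrDl.
Qed.

Lemma chi_norm1 x : normc (chi x) = 1. Proof. exact: ex_norm. Qed.

Let chiz : chi 0 = 1.
Proof. by rewrite /chi /= mulr0 mul0r ex0. Qed.

Let chin x : chi (- x) = conjc (chi x).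
Proof.
have nz : chi x != 0 by apply/eqP => h; have := chi_norm1 x; rewrite h normc0; lra.
by apply: (mulfI nz); rewrite -chi_add subrr chiz mul_conjc chi_norm1 expr1n.
Qed.

Let sub1D' x y : normc (1 - chi (x + y)) <= normc (1 - chi x) + normc (1 - chi y).
Proof.
have -> : 1 - chi (x + y) = (1 - chi x) + chi x * (1 - chi y) by rewrite chi_add; ring.
by apply: le_trans (normcD _ _) _; rewrite normcM chi_norm1 mul1r.
Qed.

Let sub1N' x : normc (1 - chi (- x)) = normc (1 - chi x).
Proof. by rewrite -(normc_conj (1 - chi x)) conjcB conjc1 chin. Qed.

Let sub1M' (k : nat) x : normc (1 - chi (k%:R * x)) <= k%:R * normc (1 - chi x).
Proof.
elim: k => [|k IH]; first by rewrite !mul0r chiz subrr normc0.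
rewrite -!natr1 !mulrDl !mul1r; apply: le_trans (sub1D' _ _) _; by rewrite lerD2r.
Qed.

Lemma chi_sub1_le x : normc (1 - chi x) <= 16 * (mag x)%:R / N.
Proof.
have one : normc (1 - chi 1) <= 16 / N.
  have -> : chi 1 = ex (2 * pi * 1%:R / N) by exact: chi_nat 1%N.
  apply: le_trans (ex_sub1 _) _.
    by rewrite mulr1 divr_ge0 // mulr_ge0 // pi_ge0.
  rewrite mulr1 mulrA ler_pM2r ?invr_gt0 //; have := pihalf_lt2 R; lra.
have nat k : normc (1 - chi k%:R) <= 16 * k%:R / N.
  have := sub1M' k 1; rewrite mulr1 => h; apply: le_trans h _.
  by have := ler_wpM2l (ler0n R k) one; rewrite mulrA [k%:R * 16]mulrC.
by case: (mag_rep x) => e; rewrite {1}e ?sub1N'.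
Qed.

(** Dilation by [k], the quotient of [n] by [2 m], brings the angle into the range from a quarter to
    half a turn, where the cosine is nonpositive and the distance to 1 at least 1. Subadditivity
    loses only the factor [k]. *)
Lemma chi_sub1_ge x : 2 * (mag x)%:R / N <= normc (1 - chi x).
Proof.
case: (posnP (mag x)) => [->|m0]; first by rewrite mulr0 mul0r normc_ge0.
have hm := mag_lt x; set m := mag x in m0 hm *.
have -> : normc (1 - chi x) = normc (1 - chi m%:R).
  by case: (mag_rep x) => ->; rewrite ?sub1N'.
pose k := (n %/ m.*2)%N.
have k0 : (0 < k)%N by rewrite divn_gt0 ?double_gt0.
have k1 : (k * m.*2 <= n)%N by exact: leq_divM.
have k2 : (n <= 4 * (k * m))%N.
  have := divn_eq n m.*2; rewrite -/k => e.
  have : (n %% m.*2 < m.*2)%N by rewrite ltn_mod double_gt0.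
  by move: e; set r := (n %% m.*2)%N => e h; nia.
have big : 1 <= normc (1 - chi (k%:R * m%:R)).
  rewrite -natrM chi_nat; set t := 2 * pi * (k * m)%:R / N.
  have ct : cos t <= 0.
    rewrite -(cos_pihalf R); have pi0 := pi_gt0 R.
    have t1 : pi / 2 <= t.
      rewrite /t ler_pdivlMr //; have : (N : R) <= 4 * (k * m)%:R by rewrite -natrM ler_nat.
      by move=> h; nra.
    have t2 : t <= pi.
      rewrite /t ler_pdivrMr //; have : 2 * (k * m)%:R <= (N : R) by rewrite -natrM ler_nat; lia.
      by move=> h; nra.
    rewrite leNgt ltr_cos ?in_itv /=; first by rewrite -leNgt.
      by apply/andP; split; lra.
    by apply/andP; split; lra.
  apply: sqr_le; first exact: normc_ge0.
  by rewrite normsq_sub1 ?ex_norm // expr1n /=; lra.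
have h := le_trans big (sub1M' k m%:R).
have kr : 0 < k%:R :> R by rewrite ltr0n.
apply: (@le_trans _ _ k%:R^-1); last first.
  by rewrite -(ler_pM2l kr) divff ?gt_eqF.
rewrite ler_pdivrMr // ler_pdivlMl //.
by rewrite -!natrM ler_nat; lia.
Qed.

Lemma chi_good : good_char chi.
Proof.
split; [exact: chi_add | exact: chi_norm1|] => x x0.
set S := \sum_y _.
have e : S * chi x = S.
  rewrite /S mulr_suml [RHS](reindex_inj (addIr 1)); apply: eq_bigr => y _ /=.
  by rewrite mulrDl mul1r chi_add.
have c1 : 1 - chi x != 0.
  apply/eqP => h; have := chi_sub1_ge x; rewrite h normc0 leNgt => /negP; apply.
  by rewrite divr_gt0 // mulr_gt0 // ltr0n lt0n mag_eq0.
by apply: (mulIf c1); rewrite mul0r mulrBr mulr1 e subrr.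
Qed.

Lemma arcs128 : exists cell : G -> 'I_128,
  forall x y, cell x = cell y -> normc (1 - chi (x - y)) <= 8^-1.
Proof.
(* Points of one arc have [mag (x - y) <= n / 128], and [16 / 128] is the required [8^-1]. *)
exists (fun x => inord (arc 128 x)) => x y e.
have {}e : arc 128 x = arc 128 y.
  by move/(congr1 val): e; rewrite /= !inordK // arc_lt.
have := arc_near e; rewrite -(ler_nat R) natrM => h.
by apply: le_trans (chi_sub1_le _) _; rewrite ler_pdivrMr //; lra.
Qed.

End CyclicGroup.

(** * From progressions to peaks *)

Section Counting.
Variables (R : realType) (G : finComNzRingType) (chi : G -> R[i]).
Hypothesis hchi : good_char chi.
Local Notation C := R[i].
Local Notation N := (#|G|%:R : R).
Let N0 : 0 < N := card_G_gt0 R G.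

Lemma sq_expand (f : G -> R) : (\sum_d f d) ^+ 2 = \sum_h \sum_d f d * f (d + h).
Proof.
rewrite expr2 mulr_suml exchange_big /=; apply: eq_bigr => d _.
rewrite -mulr_sumr; congr (_ * _); exact: reindex_inj (addrI d).
Qed.

Section Slots.
Variables (g u s v : G -> R) (eta : R).
Hypothesis u1 : forall x, `|u x| <= 1.
Hypothesis s1 : forall x, `|s x| <= 1.
Hypothesis v1 : forall x, `|v x| <= 1.
Hypothesis eta0 : 0 <= eta.
Local Notation pk h := (normc (amb chi g h (peak chi g h))).

Lemma peak_from_squares (X : G -> R) :
  eta * N ^+ 2 <= `|\sum_x v x * X x| -> \sum_x X x ^+ 2 <= N * \sum_h pk h ->
  eta ^+ 4 * N <= \sum_h wt chi g h (peak chi g h).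
Proof.
move=> h1 h2; apply: peak_energy => //.
have h3 : (eta * N ^+ 2) ^+ 2 <= N * (N * \sum_h pk h).
  apply: (@le_trans _ _ (`|\sum_x v x * X x| ^+ 2)).
    by apply: lerXn2r => //; rewrite nnegrE // mulr_ge0 // sqr_ge0.
  rewrite -normrX ger0_norm ?sqr_ge0 //.
  apply: le_trans (sum_sq_le _ _) _; apply: ler_wpM2l => //; apply: le_trans h2.
  apply: ler_sum => x _; rewrite exprMn ler_piMl ?sqr_ge0 //.
  by rewrite -real_normK ?num_real // exprn_ile1.
rewrite -(@ler_pM2l _ (N ^+ 2)) ?exprn_gt0 //.
have -> : N ^+ 2 * \sum_h pk h = N * (N * \sum_h pk h) by ring.
by apply: le_trans h3; rewrite le_eqVlt; apply/orP; left; apply/eqP; ring.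
Qed.

Lemma prod_le1 (a b : R) : `|a| <= 1 -> `|b| <= 1 -> `|a * b| <= 1.
Proof. by move=> ha hb; rewrite normrM mulr_ile1. Qed.

Lemma slot_middle :
  eta * N ^+ 2 <= `|\sum_x \sum_d v x * g (x + d) * u (x + d + d) * s d| ->
  eta ^+ 4 * N <= \sum_h wt chi g h (peak chi g h).
Proof.
move=> h; apply: (peak_from_squares (X := fun x => \sum_d g (x + d) * u (x + d + d) * s d)).
  apply: le_trans h _; rewrite le_eqVlt; apply/orP; left; apply/eqP; congr `|_|.
  by apply: eq_bigr => x _; rewrite mulr_sumr; apply: eq_bigr => d _; rewrite !mulrA.
under eq_bigr do rewrite sq_expand.
rewrite exchange_big mulr_sumr; apply: ler_sum => h' _ /=.
rewrite exchange_big /=.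
apply: le_trans (trilinear_amb hchi (h := h') (Q := fun x => u x * u (x + h' + h'))
  (S := fun d => s d * s (d + h')) (peakP chi g h') _ _); last first.
- by move=> x; apply: prod_le1.
- by move=> x; apply: prod_le1.
rewrite [leRHS]exchange_big /=; apply: ler_sum => d _.
rewrite (reindex_inj (addIr (- d))) /=; rewrite le_eqVlt; apply/orP; left; apply/eqP.
apply: eq_bigr => x _; rewrite subrK.
rewrite (_ : x - d + (d + h') = x + h'); last by ring.
rewrite (_ : x + h' + (d + h') = x + d + h' + h'); last by ring.
by ring.
Qed.

(** In the third slot a change of [d] by [h'] shifts the argument of [g] by [h' + h']; reindexing
    the peaks by doubling needs 2 invertible. *)
Lemma slot_last (half : G) : half * (1 + 1) = 1 ->
  eta * N ^+ 2 <= `|\sum_x \sum_d v x * u (x + d) * g (x + d + d) * s d| ->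
  eta ^+ 4 * N <= \sum_h wt chi g h (peak chi g h).
Proof.
move=> hh h; apply: (peak_from_squares (X := fun x => \sum_d u (x + d) * g (x + d + d) * s d)).
  apply: le_trans h _; rewrite le_eqVlt; apply/orP; left; apply/eqP; congr `|_|.
  by apply: eq_bigr => x _; rewrite mulr_sumr; apply: eq_bigr => d _; rewrite !mulrA.
under eq_bigr do rewrite sq_expand.
have di : injective (fun h : G => h + h).
  move=> a b e; have : half * (a + a) = half * (b + b) by rewrite e.
  have dbl (z : G) : half * (z + z) = z by rewrite -[RHS]mul1r -hh; ring.
  by rewrite !dbl.
rewrite exchange_big mulr_sumr [leRHS](reindex_inj di) /=; apply: ler_sum => h' _ /=.
rewrite exchange_big /=.
apply: le_trans (trilinear_amb hchi (h := h' + h') (Q := fun x => u x * u (x + h'))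
  (S := fun d => s (- d) * s (- d + h')) (peakP chi g (h' + h')) _ _); last first.
- by move=> x; apply: prod_le1.
- by move=> x; apply: prod_le1.
rewrite [leRHS]exchange_big [leRHS](reindex_inj oppr_inj) /=; apply: ler_sum => d _.
rewrite (reindex_inj (addIr (- (d + d)))) /=; rewrite le_eqVlt; apply/orP; left; apply/eqP.
apply: eq_bigr => x _.
rewrite (_ : x - (d + d) + d + d = x); last by ring.
rewrite (_ : x - (d + d) + d = x - d); last by ring.
rewrite (_ : x - (d + d) + (d + h') = x - d + h'); last by ring.
rewrite (_ : x - d + h' + (d + h') = x + (h' + h')); last by ring.
by rewrite opprK; ring.
Qed.

End Slots.

(** Read backwards, a progression has its first point last; the weight [s] is reflected
    accordingly. *)
Lemma slot_first (g u s v : G -> R) (eta : R) (half : G) :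
  (forall x, `|u x| <= 1) -> (forall x, `|s x| <= 1) ->
  (forall x, `|v x| <= 1) -> 0 <= eta -> half * (1 + 1) = 1 ->
  eta * N ^+ 2 <= `|\sum_x \sum_d g x * u (x + d) * v (x + d + d) * s d| ->
  eta ^+ 4 * N <= \sum_h wt chi g h (peak chi g h).
Proof.
move=> u1 s1 v1 e0 hh h.
apply: (slot_last u1 (fun x => s1 (- x)) v1 e0 hh).
apply: le_trans h _; rewrite le_eqVlt; apply/orP; left; apply/eqP; congr `|_|.
rewrite exchange_big [RHS]exchange_big [RHS](reindex_inj oppr_inj) /=; apply: eq_bigr => d _.
rewrite [RHS](reindex_inj (addIr (d + d))) /=; apply: eq_bigr => x _; rewrite opprK.
rewrite (_ : x + (d + d) - d = x + d); last by ring.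
rewrite (_ : x + d - d = x); last by ring.
by rewrite addrA; ring.
Qed.

(* Replacing differences [k - k'] by a positive definite weight loses nothing
   in the passage from correlation to a single frequency. *)
Lemma gram_bound (A B : G -> C) (K : {set G}) : exists z,
  \sum_(k in K) \sum_(k' in K) normc (\sum_y A y * B (y + (k - k'))) ^+ 2 <=
  (\sum_y normc (A y) ^+ 2) * \sum_y normc (\sum_(k in K) B (y + k) * chi (- (z * k))) ^+ 2.
Proof.
pose a z := \sum_y A y * chi (z * y); pose b z := \sum_y B y * chi (z * - y).
pose kp z := \sum_(k in K) chi (z * k).
pose V z : R := \sum_y normc (\sum_(k in K) B (y + k) * chi (- (z * k))) ^+ 2.
pose z := [arg max_(i > 0 : G) V i]%O.
have hz i : V i <= V z by rewrite /z; case: arg_maxP => // j _; apply.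
exists z; rewrite -/(V z).
have N0C : N%:C%C != 0 :> C by rewrite fmorph_eq0 gt_eqF.
have eT t : \sum_y A y * B (y + t) = (\sum_x a x * b x * chi (x * t)) / N%:C%C.
  apply: (mulIf N0C); rewrite divfK //.
  transitivity (\sum_y \sum_w \sum_x A y * B w * chi (x * (y + t - w))).
    rewrite mulr_suml; apply: eq_bigr => y _.
    rewrite (eq_bigr (fun w => ((w == y + t)%:R : C) * (A y * B w * N%:C%C))); last first.
      move=> w _; rewrite -mulr_sumr (chi_sumC hchi) subr_eq0 eq_sym; ring.
    by rewrite sum_delta.
  under [RHS]eq_bigr do rewrite mulr_suml mulr_suml.
  rewrite [RHS]exchange_big /=; apply: eq_bigr => y _.
  under [RHS]eq_bigr do rewrite mulr_sumr mulr_suml.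
  rewrite [RHS]exchange_big /=; apply: eq_bigr => w _; apply: eq_bigr => x _.
  by rewrite !mulrDr !(chiD hchi); ring.
have eV x : \sum_w normc (b w) ^+ 2 * normc (kp (w - x)) ^+ 2 = N * V x.
  rewrite -(parseval hchi) (reindex_inj oppr_inj) /=; apply: eq_bigr => w _.
  rewrite -exprMn -normcM; congr (normc _ ^+ 2).
  rewrite /b /kp mulr_suml; under [RHS]eq_bigr do rewrite mulr_suml.
  rewrite [RHS]exchange_big /=; under eq_bigr do rewrite mulr_sumr.
  rewrite exchange_big /=; apply: eq_bigr => k _.
  rewrite [LHS](reindex_inj (addIr k)); apply: eq_bigr => y _ /=.
  rewrite -!mulrA -!(chiD hchi); congr (_ * chi _); ring.
have ea : \sum_x normc (a x) ^+ 2 = N * \sum_y normc (A y) ^+ 2 by exact: (parseval hchi).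
clearbody a b.
have kpN x : normc (kp (- x)) = normc (kp x).
  rewrite -(normc_conj (kp x)) /kp conjc_sum; congr normc; apply: eq_bigr => k _.
  by rewrite mulNr (chiN hchi).
pose Z : R := \sum_(k in K) \sum_(k' in K) normc (\sum_y A y * B (y + (k - k'))) ^+ 2.
have e1 : (N ^+ 2 * Z)%:C%C = \sum_x \sum_y (a x * b x) * conjc (a y * b y) *
    (normc (kp (x - y)) ^+ 2)%:C%C.
  rewrite RCM /Z RC_sum mulr_sumr.
  transitivity (\sum_(k in K) \sum_(k' in K) \sum_x \sum_y
     (a x * b x * chi (x * (k - k'))) * conjc (a y * b y * chi (y * (k - k')))).
    apply: eq_bigr => k _; rewrite RC_sum mulr_sumr; apply: eq_bigr => k' _.
    rewrite eT -normsq_sum -RCM; congr (_%:C%C); rewrite normcM normcV normc_real.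
    by rewrite (ger0_norm (ltW N0)) expr_div_n mulrC divfK // expf_neq0 // gt_eqF.
  under eq_bigr do rewrite exchange_big /=.
  rewrite exchange_big /=; apply: eq_bigr => x _.
  under eq_bigr do rewrite exchange_big /=.
  rewrite exchange_big /=; apply: eq_bigr => y _.
  rewrite normsq_sum mulr_sumr; apply: eq_bigr => k _.
  rewrite mulr_sumr; apply: eq_bigr => k' _.
  rewrite (conjcM (a y * b y)) -!(chiN hchi) mulrACA -!(chiD hchi).
  by congr (_ * chi _); ring.
have h1 : N ^+ 2 * Z <= \sum_x \sum_y normc (a x) ^+ 2 * (normc (b y) ^+ 2 * normc (kp (y - x)) ^+ 2).
  apply: le_trans (ler_norm _) _; rewrite -normc_real e1.
  apply: le_trans (normc_sum _ _ _) _.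
  (* The arithmetic-geometric mean inequality pairs the transform of [A] at [x] with that of [B] at
     [y]. For fixed [x] the sum over [y] is then [N * V x], and only the largest [V] matters. *)
  apply: (@le_trans _ _ (\sum_x \sum_y 2^-1 * ((normc (a x) ^+ 2 * normc (b y) ^+ 2 +
     normc (a y) ^+ 2 * normc (b x) ^+ 2) * normc (kp (y - x)) ^+ 2))).
    apply: ler_sum => x _; apply: le_trans (normc_sum _ _ _) _; apply: ler_sum => y _.
    rewrite normcM normc_real normrX (ger0_norm (normc_ge0 _)).
    rewrite -(kpN (x - y)) opprB [leRHS]mulrA; apply: ler_wpM2r; first exact: sqr_ge0.
    rewrite normcM normc_conj !normcM.
    have := sqr_ge0 (normc (a x) * normc (b y) - normc (a y) * normc (b x)).
    set p := normc (a x); set q := normc (b y); set p' := normc (a y); set q' := normc (b x).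
    by nra.
  rewrite le_eqVlt; apply/orP; left; apply/eqP.
  pose W x y := normc (a x) ^+ 2 * (normc (b y) ^+ 2 * normc (kp (y - x)) ^+ 2).
  transitivity (2^-1 * (\sum_x \sum_y W x y) + 2^-1 * (\sum_x \sum_y W y x)).
    rewrite !mulr_sumr -big_split /=; apply: eq_bigr => x _.
    rewrite !mulr_sumr -big_split /=; apply: eq_bigr => y _.
    by rewrite /W -(kpN (x - y)) opprB; ring.
  by rewrite [X in _ + 2^-1 * X]exchange_big /=; field.
rewrite -/Z -(@ler_pM2l _ (N ^+ 2)) ?exprn_gt0 //; apply: le_trans h1 _.
apply: (@le_trans _ _ (\sum_x normc (a x) ^+ 2 * (N * V z))).
  apply: ler_sum => x _; rewrite -mulr_sumr eV; apply: ler_wpM2l; first exact: sqr_ge0.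
  by rewrite ler_pM2l.
rewrite -mulr_suml ea le_eqVlt; apply/orP; left; apply/eqP; ring.
Qed.

End Counting.

(** * Cells cut out by finitely many frequencies, and regular Bohr sets *)

Section Tiles.
Variables (R : realType) (p : nat).
Local Notation n := (p.+2).
Local Notation G := ('Z_n).
Local Notation mag := (@mag p).

(** Each frequency cuts the group into [T] arcs. Since [th] may be a zero divisor, [th * x] need not
    be equidistributed; a shift [tau th] found by averaging still keeps points near the cuts
    rare. *)
Lemma tiles (Th : {set G}) (T s : nat) : (0 < T)%N ->
  exists (cl : G -> {ffun G -> 'I_T.+1}) (E : {set G}),
  [/\ (#|E| <= #|Th| * (2 * (s + T)))%N,
      forall x y, cl x = cl y -> forall th, th \in Th -> (T * mag (th * (x - y))%R <= n)%N &
      forall x t, x \notin E -> (forall th, th \in Th -> (T * mag (th * t)%R < s)%N) ->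
        cl (x + t) = cl x].
Proof.
move=> T0.
have hshift (th : G) : exists tau : G, (#|[set x : G | ~~ inner T s (th * x + tau)%R]| <= 2 * (s + T))%N.
  apply: contrapT => hn.
  have h1 : (\sum_(tau : G) #|[set x : G | ~~ inner T s (th * x + tau)%R]| <= n * (2 * (s + T)))%N.
    under eq_bigr => tau _ do rewrite -sum1dep_card big_mkcond.
    rewrite exchange_big /=.
    apply: (@leq_trans (\sum_(x : G) 2 * (s + T))); last by rewrite sum_nat_const card_ord.
    apply: leq_sum => x _; rewrite -big_mkcond sum1dep_card.
    apply: leq_trans (card_not_inner p s T0).
    rewrite -(card_imset _ (addrI (th * x))); apply: subset_leq_card.
    by apply/subsetP => y /imsetP[tau]; rewrite !inE => h ->.
  have h2 : (n * (2 * (s + T)) < \sum_(tau : G) #|[set x : G | ~~ inner T s (th * x + tau)%R]|)%N.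
    have <- : (\sum_(tau : G) (2 * (s + T)) = n * (2 * (s + T)))%N by rewrite sum_nat_const card_ord.
    apply: (@leq_trans (\sum_(tau : G) (2 * (s + T)).+1)).
      by rewrite !sum_nat_const card_ord ltn_mul2l ltnS leqnn.
    by apply: leq_sum => tau _; rewrite ltnNge; apply/negP => h; apply: hn; exists tau.
  by move: (leq_trans h2 h1); rewrite ltnn.
have [tau htau] := choice hshift.
pose cl (x : G) : {ffun G -> 'I_T.+1} := [ffun th => if th \in Th then inord (arc T (th * x + tau th)) else ord0].
pose E := \bigcup_(th in Th) [set x : G | ~~ inner T s (th * x + tau th)%R].
exists cl, E; split.
- apply: leq_trans (_ : \sum_(th in Th) 2 * (s + T) <= _)%N; last by rewrite sum_nat_const.
  rewrite /E; elim/big_rec2: _ => [|th m B _ h]; first by rewrite cards0.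
  apply: leq_trans (leq_card_setU _ _) _; exact: leq_add.
- move=> x y e th hth; have := congr1 (fun f : {ffun G -> 'I_T.+1} => val (f th)) e.
  rewrite /= !ffunE hth /= !inordK; try by rewrite ltnS ltnW // arc_lt.
  move/arc_near; rewrite (_ : th * x + tau th - (th * y + tau th) = th * (x - y)) //; ring.
move=> x t; rewrite /E => hx ht; apply/ffunP => th; rewrite !ffunE; case: ifP => // hth.
congr inord; rewrite (_ : th * (x + t) + tau th = th * x + tau th + th * t); last by ring.
apply: inner_arc (ht _ hth).
have := hx; apply: contraR => hb; apply/bigcupP; exists th => //; by rewrite inE.
Qed.

Definition mball (Th : {set G}) (rho : nat) : {set G} :=
  [set k : G | [forall th in Th, (mag (th * k)%R <= rho)%N]].

Lemma mballP (Th : {set G}) rho k :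
  reflect (forall th, th \in Th -> (mag (th * k)%R <= rho)%N) (k \in mball Th rho).
Proof. by rewrite inE; exact: forall_inP. Qed.

Lemma mballD (Th : {set G}) a b x y :
  x \in mball Th a -> y \in mball Th b -> x + y \in mball Th (a + b).
Proof.
move=> /mballP hx /mballP hy; apply/mballP => th h; rewrite mulrDr.
exact: leq_trans (magD _ _) (leq_add (hx _ h) (hy _ h)).
Qed.

Lemma mballN (Th : {set G}) a x : x \in mball Th a -> - x \in mball Th a.
Proof. by move=> /mballP hx; apply/mballP => th h; rewrite mulrN magN hx. Qed.

Lemma mball_mono (Th : {set G}) a b : (a <= b)%N -> mball Th a \subset mball Th b.
Proof.
by move=> ab; apply/subsetP => x /mballP h; apply/mballP => th /h /leq_trans; apply.
Qed.

(** Otherwise the balls would grow by a factor [1 + e] at each of [m] steps, beyond the size of the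
    group. *)
Lemma regular_radius (Th : {set G}) (r3 m : nat) (e : R) : 0 < e ->
  n%:R < (1 + e) ^+ m ->
  exists2 j, (j < m)%N & #|mball Th (j.+1 * r3)|%:R <= (1 + e) * #|mball Th (j * r3)|%:R.
Proof.
move=> e0 hm; apply: contrapT => hn.
have h j : (j <= m)%N -> (1 + e) ^+ j <= #|mball Th (j * r3)|%:R.
  elim: j => [_|j IH hj].
    rewrite expr0 ler1n; apply/card_gt0P; exists 0.
    by apply/mballP => th _; rewrite mulr0 mag0.
  apply: (@le_trans _ _ ((1 + e) * #|mball Th (j * r3)|%:R)).
    rewrite exprS; apply: ler_wpM2l; first by lra.
    exact: IH (ltnW hj).
  rewrite leNgt; apply/negP => lt; apply: hn; exists j => //; exact: ltW.
have hc : #|mball Th (m * r3)|%:R <= n%:R :> R.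
  by rewrite ler_nat; apply: leq_trans (max_card _) _; rewrite card_ord.
by have := h m (leqnn m); lra.
Qed.

Lemma regular_shift (Th : {set G}) (r3 j : nat) (e : R) t :
  #|mball Th (j.+1 * r3)|%:R <= (1 + e) * #|mball Th (j * r3)|%:R ->
  t \in mball Th r3 ->
  \sum_k `|(k \in mball Th (j * r3))%:R - (k + t \in mball Th (j * r3))%:R| <=
    2 * e * #|mball Th (j * r3)|%:R.
Proof.
set B := mball Th (j * r3) => hr ht.
have sub t' : t' \in mball Th r3 -> #|[set k in B | k + t' \notin B]|%:R <= e * #|B|%:R.
  move=> ht'.
  have : (#|B| + #|[set k in B | (k + t')%R \notin B]| <= #|mball Th (j.+1 * r3)|)%N.
    rewrite -(card_imset [set k in B | k + t' \notin B] (addIr t')).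
    rewrite -cardsUI (_ : B :&: _ = set0) ?cards0 ?addn0.
      apply: subset_leq_card; apply/subsetP => x; rewrite in_setU => /orP[h|/imsetP[k]].
        by apply: (subsetP (mball_mono _ _)) h; rewrite leq_mul2r leqnSn orbT.
      by rewrite inE => /andP[kB _] ->; rewrite mulSn addnC; exact: mballD.
    apply/setP => x; rewrite !inE; apply/negP => /andP[xB /imsetP[k]].
    by rewrite inE => /andP[_ h] e1; move: h; rewrite -e1 inE xB.
  rewrite -(ler_nat R) natrD => h; lra.
rewrite (eq_bigr (fun k => ((k \in B) && (k + t \notin B))%:R + ((k \notin B) && (k + t \in B))%:R)); last first.
  by move=> k _; case: (k \in B); case: (k + t \in B);
    rewrite /= ?subrr ?subr0 ?sub0r ?normrN ?normr1 ?normr0 ?addr0 ?add0r.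
rewrite big_split /=.
have e1 : \sum_k ((k \in B) && (k + t \notin B))%:R = #|[set k in B | k + t \notin B]|%:R :> R.
  rewrite -(sum_bool _ _ (fun k => k + t \notin B)) [RHS]big_mkcond; apply: eq_bigr => k _.
  by case: (k \in B).
have e2 : \sum_k ((k \notin B) && (k + t \in B))%:R = #|[set k in B | k + - t \notin B]|%:R :> R.
  rewrite -(sum_bool _ _ (fun k => k + - t \notin B)) [RHS]big_mkcond (reindex_inj (addIr (- t))) /=.
  by apply: eq_bigr => k _; rewrite subrK andbC; case: (k \in B).
rewrite e1 e2; have := sub t ht; have := sub (- t) (mballN ht); lra.
Qed.

End Tiles.

(** * Quadratic phases *)

Lemma mag_sum_lt (T s a b c : nat) :
  (2 * (T * a) < s -> 2 * (T * b) < s -> c <= a + b -> T * c < s)%N.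
Proof. by move=> h1 h2 h3; have := leq_mul (leqnn T) h3; rewrite mulnDr; lia. Qed.

Lemma mag_scale_le (T m r a : nat) : (0 < m -> a <= r -> T * a <= 2 * (T * (m * r)))%N.
Proof.
move=> m0 ar; apply: (leq_trans (leq_mul (leqnn T) ar)).
apply: (@leq_trans (T * (m * r))); last by rewrite leq_pmull.
by rewrite leq_mul2l leq_pmull ?orbT.
Qed.

Lemma mag_dbl_le (T s n a c : nat) : (T * a < s -> s <= n -> c <= a + a -> T * c <= 4 * n)%N.
Proof. by move=> h1 h2 h3; have := leq_mul (leqnn T) h3; rewrite mulnDr; lia. Qed.

Lemma mag_add_le (T s n a b c : nat) :
  (T * a < s -> T * b <= n -> s <= n -> c <= b + a -> T * c <= 4 * n)%N.
Proof. by move=> h1 h2 h4 h3; have := leq_mul (leqnn T) h3; rewrite mulnDr; lia. Qed.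

Section WeightBounds.
Variable R : realType.

Lemma weighted_le (a b w e : R) : a - b <= e -> 0 <= e -> 0 <= w -> w <= 1 -> a * w <= b * w + e.
Proof. by move=> h e0 w0 w1; have := ler_wpM2r w0 h; rewrite mulrBl; nra. Qed.

Lemma sq_add_le (a N d x : R) : 0 <= x -> 0 <= d -> d <= 1 -> 0 <= a -> a <= N ->
  x <= a + d * N -> x ^+ 2 <= a ^+ 2 + 3 * d * N ^+ 2.
Proof.
move=> x0 d0 d1 a0 aN h; have N0 := le_trans a0 aN.
have h1 : x ^+ 2 <= (a + d * N) ^+ 2 by apply: lerXn2r; rewrite ?nnegrE ?addr_ge0 ?mulr_ge0.
have h2 : a * (d * N) <= N * (d * N) by apply: ler_wpM2r => //; exact: mulr_ge0.
have h3 : d * d * N ^+ 2 <= d * N ^+ 2 by apply: ler_wpM2r; rewrite ?sqr_ge0 // ler_piMl.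
apply: le_trans h1 _; rewrite (_ : (a + d * N) ^+ 2 = a ^+ 2 + 2 * (a * (d * N)) + d * d * N ^+ 2); last by ring.
move: h2 h3; rewrite (_ : N * (d * N) = d * N ^+ 2); last by ring.
rewrite -(mulrA 3 d); move: (a * (d * N)) (d * d * N ^+ 2) (d * N ^+ 2) (a ^+ 2) => u1 u2 u3 u4 h2 h3.
by move: h2 h3; clear; lra.
Qed.

Lemma dbl_ge0 (e : R) : 0 < e -> 0 <= 2 * e. Proof. by lra. Qed.
Lemma dbl_le (a e : R) : a <= e -> a + a <= 2 * e. Proof. by lra. Qed.
Lemma add2_ge0 (e f : R) : 0 < e -> 0 < f -> 0 <= 2 * e + 2 * f. Proof. by lra. Qed.
Lemma margin_le1 (eta e f : R) : 0 < eta - 7 * e - 6 * f -> eta <= 1 -> 0 < e -> 0 < f ->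
  2 * e + 2 * f <= 1.
Proof. by lra. Qed.
Lemma margin_gt0 (eta e f : R) : 0 < eta - 7 * e - 6 * f -> 0 < e -> 0 < f -> 0 < eta - e.
Proof. by lra. Qed.
Lemma error_count (N e f c : R) : c <= f * N -> N * (2 * e) + 2 * c <= (2 * e + 2 * f) * N.
Proof. by lra. Qed.

Lemma Re_abs_le (z : R[i]) : `|Re z| <= normc z.
Proof.
rewrite ler_norml; apply/andP; split; last exact: Re_le_normc.
by rewrite lerNl -[X in _ <= X]normc_opp; apply: le_trans (Re_le_normc (- z)); case: z.
Qed.

Lemma Re_sub (z w : R[i]) : Re (z - w) = Re z - Re w.
Proof. by case: z; case: w. Qed.

Lemma sum_mem (I : finType) (A : {set I}) : \sum_i (i \in A)%:R = #|A|%:R :> R.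
Proof. by rewrite -natr_sum -sum1_card [in RHS]big_mkcond; congr (_%:R); apply: eq_bigr => i _; case: (i \in A). Qed.

Lemma pairs_exchange (I J : finType) (B : {set J}) (c : R) (r : I -> R) (f : I -> J -> J -> R) :
  (forall t t', t \in B -> t' \in B -> c <= \sum_x r x * f x t t') ->
  c * (#|B|%:R * #|B|%:R) <= \sum_x r x * \sum_(t in B) \sum_(t' in B) f x t t'.
Proof.
move=> h; under eq_bigr do rewrite mulr_sumr.
rewrite exchange_big /= mulrA -[leLHS]mulrC mulr_natl -sumr_const; apply: ler_sum => t tB.
under eq_bigr do rewrite mulr_sumr.
rewrite exchange_big /= -[leLHS]mulrC mulr_natl -sumr_const; apply: ler_sum => t' t'B; exact: h.
Qed.

Lemma weighted_CS (I : finType) (c j : I -> R) :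
  (forall i, 0 <= j i <= c i) ->
  (\sum_i j i) ^+ 2 <= (\sum_i c i) * \sum_i j i ^+ 2 / c i.
Proof.
move=> h; have c0 i : 0 <= c i by have /andP[a b] := h i; exact: le_trans b.
have := CauchySchwarz xpredT (fun i => Num.sqrt (c i)) (fun i => j i / Num.sqrt (c i)).
have -> : \sum_i Num.sqrt (c i) * (j i / Num.sqrt (c i)) = \sum_i j i.
  apply: eq_bigr => i _; have /andP[a b] := h i.
  (* An empty cell: [j i] is squeezed to 0 and the quotient by [c i = 0] is 0 by convention, so both
     sides agree. *)
  case: (eqVneq (c i) 0) => [ci|ci].
    by rewrite ci sqrtr0 mul0r; apply/eqP; rewrite eq_sym eq_le a -ci b.
  by rewrite mulrCA divff ?mulr1 // gt_eqF // sqrtr_gt0 lt_def ci c0.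
move/le_trans; apply; rewrite le_eqVlt; apply/orP; left; apply/eqP; congr (_ * _).
  by apply: eq_bigr => i _; rewrite sqr_sqrtr.
by apply: eq_bigr => i _; rewrite expr_div_n sqr_sqrtr.
Qed.

End WeightBounds.

Section QuadraticPhase.
Variables (R : realType) (p : nat).
Local Notation n := (p.+2).
Local Notation G := ('Z_n).
Local Notation C := R[i].
Local Notation N := (n%:R : R).
Local Notation chi := (@chi R p).
Local Notation mag := (@mag p).
Let hchi : good_char chi := chi_good R p.
Let cardG : #|G| = n := card_ZN p.
Let N0 : 0 < N. Proof. by rewrite ltr0n. Qed.

(* [S] is, off the exceptional set [E], a quadratic phase along every
   progression whose step lies in a small Bohr set with frequencies [Th]. *)
Definition structured (rk rho : nat) (e : R) (S : G -> R) : Prop :=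
  (forall x, `|S x| <= 1) /\
  exists Th E : {set G}, [/\ (#|Th| <= rk)%N, #|E|%:R <= e * N &
    forall x q l, x \notin E -> (forall th, th \in Th -> (l * mag (th * q)%R <= rho)%N) ->
    exists (z : C) (a1 a2 : G), normc z <= 1 /\ forall j : nat, (j < l)%N ->
      `|S (x + j%:R * q) - Re (z * chi (a1 * j%:R + a2 * j%:R ^+ 2))| <= e].

Variables (g : G -> R) (Th : {set G}) (r : G -> R) (F : G -> G) (half : G).
Variables (k e ee eta : R) (T s r3 m : nat).
Hypothesis g1 : forall x, `|g x| <= 1.
Hypothesis half2 : half * (1 + 1) = 1.
Hypothesis r01 : forall x, 0 <= r x <= 1.
Hypothesis rb : forall t, bohr chi Th k t -> 0 < r t /\ forall x, `|r (x + t) - r x| <= e.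
Hypothesis Fadd : forall x y, 0 < r x -> 0 < r y -> 0 < r (x + y) -> F (x + y) = F x + F y.
Hypothesis energy : eta * N <= \sum_x r x * wt chi g x (F x).
Hypothesis Fsym : forall t s, bohr chi Th k t -> bohr chi Th k s ->
  normc (1 - chi (F t * s - F s * t)) <= e.
Hypothesis e0 : 0 < e.
Hypothesis ee0 : 0 < ee.
Hypothesis T0 : (0 < T)%N.
Hypothesis kT : 64 <= k * T%:R.
Hypothesis hE : (#|Th| * (2 * (s + T)))%:R <= ee * N.
Hypothesis hs : (2 * (T * (m * r3)) < s)%N.
Hypothesis sn : (s <= n)%N.
Hypothesis hm : N < (1 + ee) ^+ m.
Hypothesis pos : 0 < eta - 7 * e - 6 * ee.

Lemma half_dbl (x : G) : half * (x + x) = x.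
Proof. by rewrite -[RHS]mul1r -half2; ring. Qed.

Lemma dbl_half (x : G) : half * x + half * x = x.
Proof. by rewrite -[RHS]mul1r -half2; ring. Qed.

Lemma bohr_of_mag t : (forall th, th \in Th -> (T * mag (th * t)%R <= 4 * n)%N) -> bohr chi Th k t.
Proof.
move=> h th hth; apply: le_trans (chi_sub1_le _ _) _; rewrite ler_pdivrMr //.
have := h th hth; rewrite -(ler_nat R) !natrM => h1.
have T0r : 0 < T%:R :> R by rewrite ltr0n.
by rewrite -(ler_pM2l T0r); have := ler_wpM2r (ltW N0) kT; lra.
Qed.

Lemma mball_small j t : (j <= m)%N -> t \in mball Th (j * r3) ->
  forall th, th \in Th -> (2 * (T * mag (th * t)%R) < s)%N.
Proof.
move=> jm /mballP h th hth; apply: leq_ltn_trans hs.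
rewrite leq_mul2l /= leq_mul2l; apply/orP; right.
by apply: leq_trans (h _ hth) _; rewrite leq_mul2r jm orbT.
Qed.

Lemma shifted_energy t : bohr chi Th k t ->
  (eta - e) * N <= \sum_x r x * wt chi g (x + t) (F x + F t).
Proof.
move=> ht; have [rt rl] := rb ht.
suff : \sum_x r x * wt chi g x (F x) <= \sum_x (r x * wt chi g (x + t) (F x + F t) + e).
  rewrite big_split /= sumr_const cardG -[X in _ + X]mulr_natl; move: energy; lra.
rewrite (reindex_inj (addIr t)) /=; apply: ler_sum => x _.
have w0 a b := wt_ge0 chi g a b; have w1 a b := wt_le1 hchi g1 a b.
have /andP[rx0 rx1] := r01 x; have /andP[rxt0 rxt1] := r01 (x + t).
have := rl x; rewrite ler_norml => /andP[_ hr].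
case: (ltrgtP 0 (r (x + t))) rxt0 => // [rxt _|<- _]; last first.
  by rewrite mul0r; apply: addr_ge0; [apply: mulr_ge0 => //; exact: w0 | exact: ltW].
case: (ltrgtP 0 (r x)) rx0 => // [rx _|rx _]; last first.
  rewrite -rx mul0r add0r; have := w1 (x + t) (F (x + t)); have := w0 (x + t) (F (x + t)).
  by rewrite -rx in hr => h1 h2; move: (weighted_le hr (ltW e0) h1 h2); rewrite mul0r add0r.
rewrite Fadd //; have := w1 (x + t) (F x + F t); have := w0 (x + t) (F x + F t).
by move=> h1 h2; exact: (weighted_le hr (ltW e0)).
Qed.

(** The diagonal of the almost symmetric form [F u * v]; its double is the local quadratic phase. *)
Definition M (u : G) : G := F u * u.

(** On each cell the derivative phases of [g] are integrated to a quadratic phase, and [gram_bound]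
    supplies the missing linear term separately for each cell. The bounds avoid the number of cells,
    which is exponential in the rank. *)
Lemma quadratic_phase : exists S : G -> R,
  structured #|Th| r3 (2 * ee) S /\ (eta - 7 * e - 6 * ee) * N <= \sum_x g x * S x.
Proof.
have [j jm hreg] := regular_radius Th r3 ee0 hm.
set B := mball Th (j * r3) in hreg.
(* The cells must control [U x], which is half of a displacement, so the frequencies are halved. *)
pose Th2 := [set half * th | th in Th].
have [cl [E [cE clnear clin]]] := tiles Th2 s T0.
have cTh2 : (#|Th2| <= #|Th|)%N by exact: leq_imset_card.
have Er : #|E|%:R <= ee * N.
  apply: le_trans hE; rewrite ler_nat; apply: leq_trans cE _.
  by rewrite leq_mul2r cTh2 orbT.
pose cen (v : {ffun G -> 'I_T.+1}) : G := odflt 0 [pick y | cl y == v].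
have cenP x : cl (cen (cl x)) = cl x.
  by rewrite /cen; case: pickP => [y /eqP //|/(_ x)]; rewrite eqxx.
(* A shift of [x] by [d + d] inside its cell moves [U x] by [d]; the halving sits in the coordinate
   and the quadratic form needs no division by 2. *)
pose U x := half * (x - cen (cl x)).
have xU x : x = cen (cl x) + (U x + U x) by rewrite /U dbl_half; ring.
have Umag x th : th \in Th -> (T * mag (th * U x)%R <= n)%N.
  move=> hth; have := clnear x (cen (cl x)) (esym (cenP x)) (half * th) (imset_f _ hth).
  by rewrite /U mulrCA mulrA.
have Ub x : bohr chi Th k (U x).
  by apply: bohr_of_mag => th /(Umag x) h; apply: leq_trans h _; rewrite leq_pmull.
pose bb := #|B|%:R : R.
have B0 : 0 < bb.
  by rewrite ltr0n; apply/card_gt0P; exists 0; apply/mballP => th _; rewrite mulr0 mag0.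
have jm' : (j <= m)%N by exact: ltnW.
have Bdiff t t' : t \in B -> t' \in B -> forall th, th \in Th -> (T * mag (th * (t - t'))%R < s)%N.
  move=> tB t'B th hth; apply: mag_sum_lt (mball_small jm' tB hth) (mball_small jm' t'B hth) _.
  by rewrite mulrBr -(magN (th * t')); exact: magD.
have diffb t : (forall th, th \in Th -> (T * mag (th * t)%R < s)%N) -> bohr chi Th k t.
  by move=> h; apply: bohr_of_mag => th /h h'; apply: mag_dbl_le h' sn _; rewrite leq_addr.
have diffb2 t : (forall th, th \in Th -> (T * mag (th * t)%R < s)%N) -> bohr chi Th k (t + t).
  by move=> h; apply: bohr_of_mag => th /h h'; apply: mag_dbl_le h' sn _; rewrite mulrDr; exact: magD.
have diffUb t x : (forall th, th \in Th -> (T * mag (th * t)%R < s)%N) -> bohr chi Th k (U x + t).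
  move=> h; apply: bohr_of_mag => th hth.
  by apply: mag_add_le (h _ hth) (Umag x _ hth) sn _; rewrite mulrDr; exact: magD.
have clin2 x t : x \notin E -> (forall th, th \in Th -> (T * mag (th * t)%R < s)%N) ->
    cl (x + (t + t)) = cl x.
  move=> xE h; apply: clin => // ? /imsetP[th hth ->].
  by rewrite -mulrA mulrCA half_dbl; exact: h.
have U2 x t : cl (x + (t + t)) = cl x -> U (x + (t + t)) = U x + t.
  by move=> h; rewrite /U h -[X in _ = _ + X]half_dbl; ring.
have Fdbl t : (forall th, th \in Th -> (T * mag (th * t)%R < s)%N) -> F (t + t) = F t + F t.
  by move=> h; apply: Fadd; [have [] := rb (diffb _ h) | have [] := rb (diffb _ h) | have [] := rb (diffb2 _ h)].
have FU x t : (forall th, th \in Th -> (T * mag (th * t)%R < s)%N) -> F (U x + t) = F (U x) + F t.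
  by move=> h; apply: Fadd; [have [] := rb (Ub x) | have [] := rb (diffb _ h) | have [] := rb (diffUb t x h)].
(* One base point is fixed for all pairs [t, t'] at once; only doubled differences of elements of
   [B] remain as shifts. *)
have [b0 _ hb0] : exists2 b0 : G, xpredT b0 & (eta - e) * N * (bb * bb) <=
    #|G|%:R * (r b0 * \sum_(t in B) \sum_(t' in B)
      wt chi g (b0 + ((t - t') + (t - t'))) (F b0 + F ((t - t') + (t - t')))).
  apply: exists_ge_avg.
    have etae : 0 < eta - e by exact: margin_gt0 pos e0 ee0.
    by apply: mulr_gt0; [exact: mulr_gt0 | exact: mulr_gt0].
  apply: pairs_exchange => t t' tB t'B.
  by apply: shifted_energy; apply: diffb2; exact: Bdiff.
have Wsum : (eta - e) * (bb * bb) <= \sum_(t in B) \sum_(t' in B)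
      wt chi g (b0 + ((t - t') + (t - t'))) (F b0 + F ((t - t') + (t - t'))).
  have /andP[rb0 rb1] := r01 b0; rewrite cardG in hb0.
  rewrite -(ler_pM2l N0) mulrCA mulrA; apply: le_trans hb0 _.
  rewrite ler_pM2l // ler_piMl //; apply: sumr_ge0 => t _; apply: sumr_ge0 => t' _; exact: wt_ge0.
pose W := {ffun G -> 'I_T.+1}.
(* Integration: [F (d + d) * x] is twice [M (U x + d) - M (U x)], plus a term depending only on the
   cell and [d], which becomes [w], plus twice the antisymmetric defect [F d * U x - F (U x) * d],
   which [Fsym] makes small. *)
have [A AE] : exists A : W -> G -> C, forall v x, A v x =
    if cl x == v then (g x)%:C%C * chi (F b0 * x - (M (U x) + M (U x))) else 0 by eexists.
have [Bf BE] : exists Bf : W -> G -> C, forall v y, Bf v y =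
    if cl y == v then (g (y + b0))%:C%C * chi (M (U y) + M (U y)) else 0 by eexists.
have A1 v x : normc (A v x) <= (cl x == v)%:R.
  by rewrite AE; case: ifP => _; rewrite ?normc0 // normcM normc_real chi_norm1 mulr1.
have B1 v x : normc (Bf v x) <= (cl x == v)%:R.
  by rewrite BE; case: ifP => _; rewrite ?normc0 // normcM normc_real chi_norm1 mulr1.
have B1' v x : normc (Bf v x) <= 1 by apply: le_trans (B1 v x) _; case: (cl x == v).
have [J JE] : exists J : W -> G -> C, forall v d, J v d = \sum_x A v x * Bf v (x + d) by eexists.
pose cs (v : W) : R := \sum_x (cl x == v)%:R.
have cs0 v : 0 <= cs v by apply: sumr_ge0.
have css : \sum_v cs v = N.
  rewrite /cs exchange_big /= (eq_bigr (fun=> 1)) ?sumr_const ?cardG // => x _.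
  by rewrite (bigD1 (cl x)) //= eqxx big1 ?addr0 // => v /negbTE; rewrite eq_sym => ->.
have J1 v d : normc (J v d) <= cs v.
  rewrite JE; apply: le_trans (normc_sum _ _ _) _; apply: ler_sum => x _.
  by rewrite normcM; apply: le_trans (A1 v x); rewrite ler_piMr ?normc_ge0.
have ambJ d : (forall th, th \in Th -> (T * mag (th * d)%R < s)%N) ->
    normc (amb chi g (b0 + (d + d)) (F b0 + F (d + d))) <=
    \sum_v normc (J v (d + d)) + (2 * e + 2 * ee) * N.
  move=> hd.
  have [w wE] : exists w : W -> C, forall v, w v = chi (F d * cen v + F d * cen v - (M d + M d)) by eexists.
  have [D DE] : exists D : G -> C, forall x, D x = (g x * g (x + (b0 + (d + d))))%:C%C *
     chi ((F b0 + F (d + d)) * x) - w (cl x) * (A (cl x) x * Bf (cl x) (x + (d + d))) by eexists.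
  have gg x y : `|g x * g y| <= 1 by exact: prod_le1.
  have hD x : normc (D x) <= 2 * e + 2 * (x \in E)%:R.
    case: (boolP (x \in E)) => xE.
      have e20 : 0 <= 2 * e by exact: dbl_ge0.
      rewrite DE -[leLHS]add0r mulr1; apply: lerD => //.
      apply: le_trans (normcD _ _) _; rewrite normc_opp.
      apply: (@le_trans _ _ (1 + 1)); last by [].
      apply: lerD; first by rewrite normcM normc_real chi_norm1 mulr1.
      rewrite normcM normcM wE chi_norm1 mul1r mulr_ile1 ?normc_ge0 //.
      by apply: le_trans (A1 _ _) _; case: (_ == _).
    rewrite mulr0 addr0 DE AE eqxx BE clin2 // eqxx U2 ?clin2 // wE.
    set ph := F d * U x - F (U x) * d.
    have -> : (F b0 + F (d + d)) * x =
      (F d * cen (cl x) + F d * cen (cl x) - (M d + M d)) + ((F b0 * x - (M (U x) + M (U x)))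
       + (M (U x + d) + M (U x + d))) + (ph + ph).
      have hx : F d * x = F d * (cen (cl x) + (U x + U x)) by rewrite -xU.
      by rewrite Fdbl // /M FU // mulrDl mulrDl hx /ph; ring.
    rewrite (_ : x + (b0 + (d + d)) = x + (d + d) + b0); last by ring.
    move: (F d * cen (cl x) + _ - _) (F b0 * x - _) (M (U x + d) + _) => z1 z2 z3.
    rewrite RCM; set g1' := (g x)%:C%C; set g2' := (g _)%:C%C.
    rewrite (_ : _ - _ = - (g1' * g2' * chi (z1 + (z2 + z3)) * (1 - chi (ph + ph)))); last first.
      by rewrite !(chiD hchi); ring.
    rewrite normc_opp normcM normcM chi_norm1 mulr1 -RCM normc_real.
    apply: (@le_trans _ _ (normc (1 - chi (ph + ph)))); first by rewrite ler_piMl ?normc_ge0.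
    apply: le_trans (sub1D hchi _ _) _.
    by apply: dbl_le; exact: Fsym (diffb _ hd) (Ub x).
  have -> : amb chi g (b0 + (d + d)) (F b0 + F (d + d)) = \sum_v w v * J v (d + d) + \sum_x D x.
    have -> : \sum_v w v * J v (d + d) = \sum_x w (cl x) * (A (cl x) x * Bf (cl x) (x + (d + d))).
      transitivity (\sum_v \sum_x w v * (A v x * Bf v (x + (d + d)))).
        by apply: eq_bigr => v _; rewrite JE mulr_sumr.
      rewrite exchange_big; apply: eq_bigr => x _ /=.
      rewrite (bigD1 (cl x)) //= [X in _ + X]big1 ?addr0 // => v; rewrite AE eq_sym => /negbTE ->.
      by rewrite mul0r mulr0.
    rewrite -big_split /=; apply: eq_bigr => x _; rewrite DE; ring.
  apply: le_trans (normcD _ _) _; apply: lerD.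
    apply: le_trans (normc_sum _ _ _) _; apply: ler_sum => v _.
    by rewrite normcM wE chi_norm1 mul1r.
  apply: le_trans (normc_sum _ _ _) _.
  apply: (@le_trans _ _ (\sum_x (2 * e + 2 * (x \in E)%:R))); first exact: ler_sum.
  rewrite big_split /= sumr_const cardG -mulr_sumr -[X in X + _]mulr_natl.
  have -> : \sum_x (x \in E)%:R = #|E|%:R :> R by rewrite sum_mem .
  exact: error_count.
have eta1 : eta <= 1.
  rewrite -(ler_pM2r N0) mul1r; apply: le_trans energy _.
  rewrite -[leRHS]mulr1 -[in leRHS]cardG mulr_natl -sumr_const; apply: ler_sum => x _.
  have /andP[? ?] := r01 x; rewrite mulr_ile1 ?wt_ge0 //; exact: wt_le1.
(* Cauchy-Schwarz is weighted by the cell sizes [cs v], whose sum is [N]; this keeps the number of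
   cells out of the estimate. *)
have wtJ d : (forall th, th \in Th -> (T * mag (th * d)%R < s)%N) ->
    N ^+ 2 * wt chi g (b0 + (d + d)) (F b0 + F (d + d)) <=
    N * (\sum_v normc (J v (d + d)) ^+ 2 / cs v) + 3 * (2 * e + 2 * ee) * N ^+ 2.
  move=> hd; rewrite /wt cardG mulrC divfK ?expf_neq0 ?gt_eqF //.
  have J0 v : 0 <= normc (J v (d + d)) <= cs v by rewrite normc_ge0 J1.
  apply: le_trans (sq_add_le (normc_ge0 _) _ _ _ _ (ambJ d hd)) _.
  - exact: add2_ge0.
  - exact: margin_le1 pos eta1 e0 ee0.
  - by apply: sumr_ge0 => v _; exact: normc_ge0.
  - by rewrite -css; apply: ler_sum => v _; exact: J1.
  by rewrite lerD2r -css; exact: weighted_CS.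
have dinj : injective (fun t : G => t + t).
  by move=> a b h; rewrite -(half_dbl a) -(half_dbl b) h.
pose K := [set t + t | t in B].
(* On each cell [gram_bound] trades the pairs of shifts for one linear frequency [xi v]. *)
have [xi xiP] : exists xi : W -> G, forall v,
    \sum_(k in K) \sum_(k' in K) normc (\sum_y A v y * Bf v (y + (k - k'))) ^+ 2 <=
    (\sum_y normc (A v y) ^+ 2) * \sum_y normc (\sum_(k in K) Bf v (y + k) * chi (- (xi v * k))) ^+ 2.
  have [xi xiP] := @choice _ _ (fun (v : W) z => 
    \sum_(k in K) \sum_(k' in K) normc (\sum_y A v y * Bf v (y + (k - k'))) ^+ 2 <=
    (\sum_y normc (A v y) ^+ 2) * \sum_y normc (\sum_(k in K) Bf v (y + k) * chi (- (z * k))) ^+ 2)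
    (fun v => gram_bound hchi (A v) (Bf v) K).
  by exists xi.
have [Q QE] : exists Q : W -> G -> C, forall v y, Q v y = \sum_(k in K) Bf v (y + k) * chi (- (xi v * k)) by eexists.
have V0 v : 0 <= \sum_y normc (Q v y) ^+ 2 by apply: sumr_ge0 => y _; exact: sqr_ge0.
have VP v : \sum_(t in B) \sum_(t' in B) normc (J v ((t - t') + (t - t'))) ^+ 2 / cs v <=
    \sum_y normc (Q v y) ^+ 2.
  rewrite (eq_bigr (fun t => (\sum_(t' in B) normc (J v ((t - t') + (t - t'))) ^+ 2) / cs v)); last first.
    by move=> t _; rewrite mulr_suml.
  rewrite -mulr_suml; case: (eqVneq (cs v) 0) => [->|cv0]; first by rewrite invr0 mulr0.
  have cv : 0 < cs v by rewrite lt_def cv0 cs0.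
  rewrite ler_pdivrMr // mulrC.
  apply: (@le_trans _ _ ((\sum_y normc (A v y) ^+ 2) * \sum_y normc (Q v y) ^+ 2)); last first.
    apply: ler_wpM2r => //; apply: ler_sum => y _; rewrite -[leRHS]mulr1.
    apply: (@le_trans _ _ (normc (A v y) * 1)); last by rewrite !mulr1.
    rewrite expr2 ler_wpM2l ?normc_ge0 //; apply: le_trans (A1 v y) _; by case: (_ == _).
  have := xiP v; rewrite /K big_imset /=; last by move=> ? ? _ _; exact: dinj.
  under eq_bigr => t _.
    rewrite big_imset /=; last by move=> ? ? _ _; exact: dinj.
    over.
  under [X in _ * X]eq_bigr do rewrite -QE.
  move=> h; apply: le_trans h; apply: ler_sum => t _; apply: ler_sum => t' _.
  by rewrite JE (_ : t - t' + (t - t') = t + t - (t' + t')) //; ring.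
have Vsum : (eta - 7 * e - 6 * ee) * N * (bb * bb) <= \sum_v \sum_y normc (Q v y) ^+ 2.
  have h1 : N ^+ 2 * ((eta - e) * (bb * bb)) <= \sum_(t in B) \sum_(t' in B)
     (N * (\sum_v normc (J v ((t - t') + (t - t'))) ^+ 2 / cs v) + 3 * (2 * e + 2 * ee) * N ^+ 2).
    apply: (@le_trans _ _ (N ^+ 2 * \sum_(t in B) \sum_(t' in B)
      wt chi g (b0 + ((t - t') + (t - t'))) (F b0 + F ((t - t') + (t - t'))))).
      by rewrite ler_pM2l // exprn_gt0.
    rewrite mulr_sumr; apply: ler_sum => t tB; rewrite mulr_sumr; apply: ler_sum => t' t'B.
    by apply: wtJ; exact: Bdiff.
  have h2 : \sum_(t in B) \sum_(t' in B)
     (N * (\sum_v normc (J v ((t - t') + (t - t'))) ^+ 2 / cs v) + 3 * (2 * e + 2 * ee) * N ^+ 2)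
     <= N * (\sum_v \sum_y normc (Q v y) ^+ 2) + 3 * (2 * e + 2 * ee) * N ^+ 2 * (bb * bb).
    under eq_bigr do rewrite big_split /= sumr_const.
    rewrite big_split /= sumr_const -!mulrnA -[X in _ + X]mulr_natr natrM; apply: lerD => //.
    under eq_bigr do rewrite -mulr_sumr exchange_big /=.
    rewrite -mulr_sumr exchange_big /= ler_pM2l //; apply: ler_sum => v _; exact: VP.
  have h3 := le_trans h1 h2; rewrite -(ler_pM2l N0).
  rewrite -(lerD2r (3 * (2 * e + 2 * ee) * N ^+ 2 * (bb * bb))); apply: le_trans h3.
  by rewrite le_eqVlt; apply/orP; left; apply/eqP; ring.
(* The amplitude left after factoring out the phase: an average of [Q v] over doubled elements of
   [B]. Regularity of [B] makes it vary slowly, so [S] is a phase with almost constant amplitude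
   along short progressions. *)
have [L LE] : exists L : W -> G -> C, forall v u, L v u =
    (\sum_y ((half * (u - y) \in B)%:R)%:C%C * (chi (xi v * y) * conjc (Q v y))) / (bb * bb)%:C%C.
  by eexists.
have Q1 v y : normc (Q v y) <= bb.
  rewrite QE; apply: le_trans (normc_sum _ _ _) _.
  apply: (@le_trans _ _ (\sum_(k in K) 1)).
    by apply: ler_sum => k' _; rewrite normcM chi_norm1 mulr1.
  by rewrite sumr_const /K card_imset.
have bb2 : normc ((bb * bb)%:C%C)^-1 = (bb * bb)^-1.
  by rewrite -fmorphV normc_real ger0_norm // invr_ge0; apply: mulr_ge0; exact: ltW.
have Lbd v (c : G -> R) : normc ((\sum_y (c y)%:C%C * (chi (xi v * y) * conjc (Q v y))) / (bb * bb)%:C%C)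
    <= (\sum_y `|c y|) / bb.
  rewrite normcM bb2 ler_pdivrMr ?mulr_gt0 // mulrA divfK ?gt_eqF //.
  apply: le_trans (normc_sum _ _ _) _; rewrite mulr_suml; apply: ler_sum => y _.
  by rewrite normcM normc_real normcM chi_norm1 mul1r normc_conj ler_wpM2l.
have re (u : G) (f : G -> R) : \sum_y f (half * (u - y)) = \sum_t f t.
  rewrite (reindex_inj (h := fun t : G => u - (t + t))) /=; last first.
    by move=> a b /addrI /oppr_inj; exact: dinj.
  apply: eq_bigr => t _; congr f.
  by rewrite (_ : u - (u - (t + t)) = t + t) ?half_dbl //; ring.
have L1 v u : normc (L v u) <= 1.
  rewrite LE; apply: le_trans (Lbd _ _) _; rewrite (re u (fun t => `|(t \in B)%:R|)).
  rewrite ler_pdivrMr // mul1r (eq_bigr (fun t => (t \in B)%:R)) ?sum_mem //.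
  by move=> t _; rewrite normr_nat.
have Lsm v u d : d \in mball Th r3 -> normc (L v (u + (d + d)) - L v u) <= 2 * ee.
  move=> hd; rewrite !LE -mulrBl -sumrB.
  under eq_bigr do rewrite -mulrBl -RCB.
  apply: le_trans (Lbd _ _) _; rewrite ler_pdivrMr //.
  have := regular_shift hreg hd; rewrite -/B -/bb; apply: le_trans.
  rewrite -(re u (fun t => `|(t \in B)%:R - (t + d \in B)%:R|)); apply: ler_sum => y _.
  rewrite distrC (_ : half * (u + (d + d) - y) = half * (u - y) + d) //.
  by rewrite -[X in _ = _ + X]half_dbl; ring.
have [S SE] : exists S : G -> R, forall x, S x =
    Re (chi (M (U (x - b0)) + M (U (x - b0)) - xi (cl (x - b0)) * (x - b0)) * L (cl (x - b0)) (x - b0)) by eexists.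
exists S; split; last first.
  suff -> : \sum_x g x * S x = (\sum_v \sum_y normc (Q v y) ^+ 2) / (bb * bb).
    by rewrite ler_pdivlMr ?mulr_gt0.
  have VE v : (\sum_y normc (Q v y) ^+ 2)%:C%C / (bb * bb)%:C%C =
      \sum_u Bf v u * (chi (- (xi v * u)) * L v u).
    have bbC : (bb * bb)%:C%C != 0 :> C by rewrite fmorph_eq0 gt_eqF ?mulr_gt0.
    apply: (mulIf bbC); rewrite divfK // RC_sum mulr_suml.
    transitivity (\sum_y \sum_u Bf v u * chi (- (xi v * u)) * (((half * (u - y) \in B)%:R)%:C%C * (chi (xi v * y) * conjc (Q v y)))); last first.
      rewrite exchange_big; apply: eq_bigr => u _ /=; rewrite LE -mulr_sumr -!mulrA; congr (_ * (_ * _)).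
      by rewrite mulVf // mulr1.
    apply: eq_bigr => y _; rewrite -mul_conjc {1}QE mulr_suml /K big_imset /=; last by move=> ? ? _ _; exact: dinj.
    rewrite [RHS](reindex_inj (h := fun t : G => y + (t + t))) /=; last first.
      by move=> a b /addrI; exact: dinj.
    rewrite big_mkcond; apply: eq_bigr => t _ /=.
    rewrite (_ : y + (t + t) - y = t + t) ?half_dbl; last by ring.
    case: (t \in B); rewrite ?mul0r ?mulr0 //.
    rewrite mul1r -!mulrA; congr (_ * _); rewrite mulrA; congr (_ * _).
    by rewrite -(chiD hchi); congr (chi _); ring.
  have tot : ((\sum_v \sum_y normc (Q v y) ^+ 2) / (bb * bb))%:C%C =
      \sum_u (g (u + b0))%:C%C * (chi (M (U u) + M (U u) - xi (cl u) * u) * L (cl u) u).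
    rewrite RCM fmorphV RC_sum mulr_suml.
    under eq_bigr do rewrite VE.
    rewrite exchange_big /=; apply: eq_bigr => u _; rewrite (bigD1 (cl u)) //= [X in _ + X]big1 ?addr0; last first.
      by move=> v; rewrite BE eq_sym => /negbTE ->; rewrite mul0r.
    by rewrite BE eqxx (chiD hchi (M (U u) + M (U u)) (- _)) -!mulrA.
  have -> : (\sum_v \sum_y normc (Q v y) ^+ 2) / (bb * bb) =
      Re ((\sum_v \sum_y normc (Q v y) ^+ 2) / (bb * bb))%:C%C by [].
  rewrite tot Re_sum (reindex_inj (addIr b0)) /=; apply: eq_bigr => u _.
  by rewrite ReM_real SE addrK.
split=> [x|].
  rewrite SE; apply: le_trans (Re_abs_le _) _; by rewrite normcM chi_norm1 mul1r.
exists Th2, [set x + b0 | x in E]; split=> //.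
  rewrite card_imset; last exact: addIr.
  by apply: le_trans Er _; apply: ler_wpM2r; [exact: ltW | apply: ler_peMl; [exact: ltW | rewrite ler1n]].
move=> x q l xE hq.
have uE : x - b0 \notin E.
  by apply: contra xE => h; apply/imsetP; exists (x - b0) => //; rewrite subrK.
set u := x - b0 in uE; set q' := half * q.
have qs j' : (j' < l)%N -> j'%:R * q' \in mball Th r3.
  move=> hj; apply/mballP => th hth; apply: leq_trans (hq (half * th) (imset_f _ hth)).
  have -> : th * (j'%:R * q') = j'%:R * (half * th * q) by rewrite /q'; ring.
  by apply: leq_trans (magM _ _) _; rewrite leq_mul2r (ltnW hj) orbT.
have small d : d \in mball Th r3 -> forall th, th \in Th -> (T * mag (th * d)%R < s)%N.
  move=> /mballP hd th /hd h; apply: leq_ltn_trans hs.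
  exact: mag_scale_le (leq_ltn_trans (leq0n _) jm) h.
have F0 : F 0 = 0.
  have b00 : bohr chi Th k 0 by apply: bohr_of_mag => th _; rewrite mulr0 mag0 muln0.
  have [r0 _] := rb b00.
  by have := Fadd r0 r0; rewrite addr0 => /(_ r0) /eqP; rewrite eq_sym -subr_eq0 addrK => /eqP.
have Fj j' : (j' < l)%N -> F (j'%:R * q') = j'%:R * F q'.
  elim: j' => [_|j' IH hj]; first by rewrite !mul0r.
  have p1 := small _ (qs _ (ltnW hj)); have p3 := small _ (qs _ hj).
  have p2 : forall th, th \in Th -> (T * mag (th * q')%R < s)%N.
    by have := small _ (qs 1%N (leq_ltn_trans (ltn0Sn j') hj)); rewrite mul1r.
  rewrite -natr1 mulrDl mul1r in p3 *; rewrite mulrDl mul1r -IH ?(ltnW hj) //.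
  by apply: Fadd; [have [] := rb (diffb _ p1) | have [] := rb (diffb _ p2) | have [] := rb (diffb _ p3)].
have xj j' : x + j'%:R * q - b0 = u + (j'%:R * q' + j'%:R * q').
  by rewrite /u -mulrDr dbl_half; ring.
exists (chi (M (U u) + M (U u) - xi (cl u) * u) * L (cl u) u),
  ((F q' * U u + F (U u) * q') + (F q' * U u + F (U u) * q') - xi (cl u) * (q' + q')),
  (F q' * q' + F q' * q').
split=> [|j' hj]; first by rewrite normcM chi_norm1 mul1r.
have sm := small _ (qs _ hj).
rewrite SE xj clin2 // U2 ?clin2 //.
set d := j'%:R * q' in sm *.
rewrite -mulrA [L (cl u) u * _]mulrC mulrA -(chiD hchi).
have -> : M (U u) + M (U u) - xi (cl u) * u + ((F q' * U u + F (U u) * q' +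
   (F q' * U u + F (U u) * q') - xi (cl u) * (q' + q')) * j'%:R + (F q' * q' + F q' * q') * j'%:R ^+ 2)
   = M (U u + d) + M (U u + d) - xi (cl u) * (u + (d + d)).
  by rewrite /M FU // /d Fj //; ring.
rewrite -Re_sub -mulrBr; apply: le_trans (Re_abs_le _) _.
by rewrite normcM chi_norm1 mul1r; apply: Lsm; exact: qs.
Qed.

End QuadraticPhase.

(** * The inverse theorem with explicit parameters *)

Section Inverse.
Variables (R : realType) (p : nat).
Local Notation n := (p.+2).
Local Notation G := ('Z_n).
Local Notation C := R[i].
Local Notation N := (n%:R : R).
Local Notation chi := (@chi R p).

Lemma model_density_le1 (eta : R) : 0 < eta -> eta <= 1 -> model_density eta <= 1.
Proof.
move=> e0 e1.
have pw (x : R) m : 1 <= x -> 1 <= x ^+ m by move=> h; rewrite -(expr1n R m) lerXn2r ?nnegrE //; lra.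
have dc : 1 <= doubling_const eta.
  rewrite /doubling_const ler_pdivlMr ?exprn_gt0 // mul1r.
  apply: (@le_trans _ _ 1); first by rewrite exprn_ile1 // ltW.
  by apply: pw; lra.
have fb : 1 <= fibre_bound eta.
  rewrite /fibre_bound; have h1 := pw _ 2 dc.
  have h2 : 1 <= 2 * doubling_const eta ^+ 2 by lra.
  by have h3 := pw _ 13 h2; lra.
have h4 := pw _ 14 fb.
rewrite /model_density ler_pdivrMr ?mul1r; last by lra.
by apply: (@le_trans _ _ 1); [rewrite exprn_ile1 // ltW | lra].
Qed.

Definition peak_mass (eta : R) : R := (eta / 2) ^+ 4 * model_density eta ^+ 4.
Definition freq_radius (eta : R) : R := bohr_radius eta (peak_mass eta / 16).

Lemma peak_mass_bounds (eta : R) : 0 < eta -> eta <= 1 -> 0 < peak_mass eta <= 1.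
Proof.
move=> e0 e1; have m0 := model_density_bounds e0 e1; have m1 := model_density_le1 e0 e1.
have e20 : 0 < eta / 2 by lra.
have e21 : eta / 2 <= 1 by lra.
have em0 : 0 < eta / 2 * model_density eta by exact: mulr_gt0.
rewrite /peak_mass -exprMn exprn_gt0 //=.
have h1 : eta / 2 * model_density eta <= 1 by apply: mulr_ile1 => //; exact: ltW.
by apply: exprn_ile1 => //; apply: mulr_ge0; exact: ltW.
Qed.

Lemma freq_radius_bounds (eta : R) : 0 < eta -> eta <= 1 -> 0 < freq_radius eta <= 1.
Proof.
move=> e0 e1; have /andP[E0 E1] := peak_mass_bounds e0 e1.
have m0 := model_density_bounds e0 e1; have m1 := model_density_le1 e0 e1.
have e4 : 0 < eta ^+ 4 by rewrite exprn_gt0.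
have e41 : eta ^+ 4 <= 1 by rewrite exprn_ile1 // ltW.
have s0 : 0 < sym_density eta by rewrite /sym_density mulr_gt0 //; lra.
have s1 : sym_density eta <= 1 by rewrite /sym_density mulr_ile1 //; lra.
have s40 : 0 < sym_density eta ^+ 4 by rewrite exprn_gt0.
have s41 : sym_density eta ^+ 4 <= 1 by rewrite exprn_ile1 // ltW.
rewrite /freq_radius /bohr_radius; apply/andP; split.
  by rewrite mulr_gt0 ?invr_gt0 // mulr_gt0 // mulr_gt0 ?invr_gt0.
have : peak_mass eta / 16 * sym_density eta ^+ 4 <= 1 by rewrite mulr_ile1 //; lra.
lra.
Qed.

Lemma structured_rank rk rk' rho e (S : G -> R) : (rk <= rk')%N ->
  structured rk rho e S -> structured rk' rho e S.
Proof.
move=> h [S1 [Th [E [h1 h2 h3]]]]; split=> //; exists Th, E; split=> //; exact: leq_trans h1 h.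
Qed.

Lemma inverse (g : G -> R) (half : G) (eta ee : R) (m rho rk : nat) :
  (forall x, `|g x| <= 1) -> half * (1 + 1) = 1 -> 0 < eta -> eta <= 1 ->
  eta * N <= \sum_h wt chi g h (peak chi g h) ->
  0 < ee -> 96 * ee <= peak_mass eta -> N < (1 + ee) ^+ m ->
  4 * (130 * (m%:R * rho%:R) + 66) <= ee * freq_radius eta ^+ 2 * N ->
  2 <= freq_radius eta * rk%:R ->
  exists S : G -> R, structured rk rho (2 * ee) S /\
    peak_mass eta / 2 * N <= \sum_x g x * S x.
Proof.
move=> g1 hh eta0 eta1 hw ee0 hee hm hrho hrk.
have /andP[E0 E1] := peak_mass_bounds eta0 eta1.
have /andP[k0 k1] := freq_radius_bounds eta0 eta1.
have N0 : 0 < N by rewrite ltr0n.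
have [cell hcell] := arcs128 R p.
have e1 : 0 < peak_mass eta / 16 by lra.
have e2 : peak_mass eta / 16 <= 1 by lra.
have [|Th [r [F [cT [r01 rb] Fadd en Fs]]]] :=
  local_bilinear (chi_good R p) g1 hcell eta0 eta1 e1 e2 (phi := peak chi g).
  by rewrite card_ZN.
rewrite -/(freq_radius eta) in cT rb Fs; set k := freq_radius eta in k0 k1 cT rb Fs hrho hrk *.
(* By [chi_sub1_le], a magnitude of at most [4 * n / T] gives a distance of at most [64 / T] to 1,
   which has to lie within the Bohr radius [k]. *)
pose T := (Num.truncn (64 / k)).+1.
have x0 : 0 <= 64 / k by rewrite divr_ge0 // ltW.
have /andP[t1 t2] := truncn_itv x0.
have kT : 64 <= k * T%:R by rewrite mulrC -ler_pdivrMr // ltW.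
have kT2 : k * T%:R <= 65.
  have : k * (Num.truncn (64 / k))%:R <= 64 by rewrite mulrC -ler_pdivlMr.
  have TE : T%:R = (Num.truncn (64 / k))%:R + 1 :> R by rewrite natr1.
  by rewrite TE mulrDr mulr1; lra.
pose s := (2 * (T * (m * rho))).+1.
have sE : s%:R = 2 * (T%:R * (m%:R * rho%:R)) + 1 :> R by rewrite /s -natr1 !natrM.
have mr0 : 0 <= m%:R * rho%:R :> R by rewrite mulr_ge0.
have ks : k * s%:R <= 130 * (m%:R * rho%:R) + 1.
  rewrite sE; have := ler_wpM2r mr0 kT2; lra.
have hE : (#|Th| * (2 * (s + T)))%:R <= ee * N.
  have k2 : 0 < k ^+ 2 by rewrite exprn_gt0.
  rewrite -(ler_pM2l k2); apply: (@le_trans _ _ (4 * (130 * (m%:R * rho%:R) + 66))); last first.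
    by apply: le_trans hrho _; rewrite le_eqVlt; apply/orP; left; apply/eqP; ring.
  rewrite !natrM natrD; apply: (@le_trans _ _ (2 * (2 * (130 * (m%:R * rho%:R) + 66)))); last by lra.
  rewrite (_ : k ^+ 2 * _ = (k * #|Th|%:R) * (2 * (k * s%:R + k * T%:R))); last by ring.
  apply: ler_pM => //.
  - by rewrite mulr_ge0 // ltW.
  - by rewrite mulr_ge0 // addr_ge0 // mulr_ge0 // ltW.
  - by lra.
have hs : (2 * (T * (m * rho)) < s)%N by rewrite ltnSn.
have ee1 : ee <= 1 by lra.
have sn : (s <= n)%N.
  rewrite -(ler_nat R) -(ler_pM2l k0); apply: le_trans ks _.
  have : ee * k ^+ 2 * N <= k * N.
    by rewrite ler_pM2r // expr2 mulrA ler_piMl ?(ltW k0) // mulr_ile1 // ltW.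
  by lra.
have en' : peak_mass eta * N <= \sum_x r x * wt chi g x (F x).
  by apply: le_trans en; rewrite /peak_mass card_ZN.
(* The losses [7 * e] with [e = peak_mass eta / 16] and [6 * ee] with [96 * ee <= peak_mass eta]
   together use at most half of the peak mass. *)
have pos : 0 < peak_mass eta - 7 * (peak_mass eta / 16) - 6 * ee by lra.
have [S [sS hS]] := quadratic_phase (T := T) (m := m) (r3 := rho)
  g1 hh r01 rb Fadd en' Fs e1 ee0 (ltn0Sn _) kT hE hs sn hm pos.
exists S; split.
  apply: structured_rank sS; rewrite -(ler_nat R) -(ler_pM2l k0).
  exact: le_trans cT hrk.
apply: le_trans hS; rewrite ler_pM2r //; lra.
Qed.

End Inverse.

(** * Weyl sums *)

Section SameClass.

Lemma same_class_diff h h' q : (h %% q = h' %% q -> h <= h' -> h' = h + (h' %/ q - h %/ q) * q)%N.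
Proof.
move=> e le; have l2 := leq_div2r q le.
by rewrite mulnBl addnBA ?leq_mul2r ?l2 ?orbT // {1}(divn_eq h' q) {1}(divn_eq h q) e; lia.
Qed.

Lemma same_block_lt a b m : (0 < m -> a %/ m = b %/ m -> b - a < m)%N.
Proof.
move=> m0 e; have r : (b %% m < m)%N by rewrite ltn_mod.
by rewrite {1}(divn_eq b m) {1}(divn_eq a m) e; move: (b %/ m * m)%N; lia.
Qed.

Lemma same_class_small a b g : (a %% g.+1 = b %% g.+1 -> a <= b -> b - a <= g -> b = a)%N.
Proof.
move=> e le h; have e2 := same_class_diff e le.
case: (posnP (b %/ g.+1 - a %/ g.+1)%N) e2 => [->|p0] e2; first by rewrite e2 mul0n addn0.
have := leq_mul p0 (leqnn g.+1); rewrite mul1n; lia.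
Qed.

Lemma half_quotient n th : (0 < th -> th.*2 <= n -> n <= 4 * (n %/ th.*2 * th))%N.
Proof.
move=> t0 tn; have m0 : (0 < n %/ th.*2)%N by rewrite divn_gt0 // double_gt0.
have r : (n %% th.*2 < th.*2)%N by rewrite ltn_mod double_gt0.
rewrite {1}(divn_eq n th.*2); have := leq_mul m0 (leqnn th); move: r.
by rewrite -!mul2n mul1n; lia.
Qed.

End SameClass.

Section Counting.
Variable p : nat.
Local Notation n := (p.+2).
Local Notation G := ('Z_n).
Local Notation mag := (@mag p).

Lemma mag_natr_small k : (k.*2 <= n)%N -> mag k%:R = k.
Proof. by move=> h; rewrite /mag val_nat modn_small; lia. Qed.

Lemma mag_mul_small i (x : G) : ((i * mag x).*2 <= n)%N -> mag (i%:R * x) = (i * mag x)%N.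
Proof.
move=> h; case: (mag_rep x) => {1}->; rewrite ?mulrN ?magN -natrM; exact: mag_natr_small.
Qed.

Lemma close_pair (X u : nat) (H : {set 'I_X}) : (0 < u)%N -> (2 * u < X)%N -> (X <= #|H| * u)%N ->
  exists h h' : 'I_X, [/\ h \in H, h' \in H & (h < h' <= h + 2 * u)%N].
Proof.
move=> u0 uX hH; apply: contrapT => hn.
have u20 : (0 < 2 * u)%N by rewrite muln_gt0.
pose f (h : 'I_X) : 'I_(X %/ (2 * u)).+1 := inord (h %/ (2 * u)).
have fi : {in H &, injective f}.
  move=> h h' hh hh' e; apply: contrapT => ne.
  have {}e : (h %/ (2 * u) = h' %/ (2 * u))%N.
    have l (x : 'I_X) : (x %/ (2 * u) < (X %/ (2 * u)).+1)%N by rewrite ltnS leq_div2r // ltnW.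
    by move/(congr1 val): e; rewrite /= !inordK ?l.
  have e1 := divn_eq h (2 * u); have e2 := divn_eq h' (2 * u); rewrite -e in e2.
  have r1 : (h %% (2 * u) < 2 * u)%N by rewrite ltn_mod.
  have r2 : (h' %% (2 * u) < 2 * u)%N by rewrite ltn_mod.
  have ne' : (h != h' :> nat) by apply/eqP => /val_inj.
  apply: hn; case: (ltngtP h h') ne' => // c _; [exists h, h' | exists h', h]; split => //.
    by lia.
  by lia.
have c : (#|H| <= (X %/ (2 * u)).+1)%N.
  by rewrite -(card_in_imset fi); apply: leq_trans (max_card _) _; rewrite card_ord.
have := leq_trans hH (leq_mul c (leqnn u)); rewrite mulSn => c2.
have := leq_trunc_div X (2 * u); rewrite mulnCA => c3; nia.
Qed.

(* A class modulo [q] inside a window of length [q m] meets [H] in at most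
   [g + 1] points, since there the multiples of [q x] do not wrap around. *)
Lemma class_count (X q m g : nat) (H : {set 'I_X}) : (0 < q)%N -> (0 < m)%N ->
  (forall (h h' : 'I_X) i, h \in H -> h' \in H -> (h' = h + i * q :> nat)%N -> (i < m -> i <= g)%N) ->
  (#|H| <= (X %/ (q * m)).+1 * (q * g.+1))%N.
Proof.
move=> q0 m0 hH.
pose f (h : 'I_X) : 'I_(X %/ (q * m)).+1 * ('I_q * 'I_g.+1) :=
  (inord (h %/ (q * m)), (Ordinal (ltn_pmod h q0), Ordinal (ltn_pmod (h %/ q) (ltn0Sn g)))).
have fi : {in H &, injective f}.
  have key h h' : h \in H -> h' \in H -> f h = f h' -> (h <= h')%N -> h = h'.
    move=> hh hh' [e1 e2 e3] le.
    have l (x : 'I_X) : (x %/ (q * m) < (X %/ (q * m)).+1)%N by rewrite ltnS leq_div2r // ltnW.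
    have {}e1 : (h %/ (q * m) = h' %/ (q * m))%N by move/(congr1 val): e1; rewrite /= !inordK ?l.
    have hi := same_class_diff e2 le.
    have im : (h' %/ q - h %/ q < m)%N by apply: same_block_lt; rewrite // -!divnMA.
    have ig := hH _ _ _ hh hh' hi im.
    have e4 := same_class_small e3 (leq_div2r q le) ig.
    by apply: val_inj; rewrite /= hi e4 subnn mul0n addn0.
  move=> h h' hh hh' e; case: (leqP h h') => c; first exact: key.
  by apply/esym/key => //; exact: ltnW.
rewrite -(card_in_imset fi); apply: leq_trans (max_card _) _.
by rewrite !card_prod !card_ord.
Qed.

Lemma window_arith (X q m g u E th : nat) : (0 < th)%N -> (0 < u)%N ->
  (X <= (X %/ (q * m)).+1 * (q * g.+1) * u)%N -> (0 < q)%N -> (0 < m)%N ->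
  (g * th <= E)%N -> (th <= E)%N -> (n <= 4 * (m * th))%N -> (q <= 2 * u)%N ->
  (32 * (u * E) <= n)%N -> (8 * (u * u) <= X)%N ->
  (th * X <= 4 * (u * u) * E)%N.
Proof.
move=> th0 u0 h q0 m0 gE tE nm q2 hn hX.
have a : (X %/ (q * m) * (q * m) <= X)%N by exact: leq_trunc_div.
set D := (X %/ (q * m))%N in h a.
have gE2 : (g.+1 * th <= 2 * E)%N by rewrite mulSn; lia.
have b1 : (n * (D * q) <= 4 * (th * X))%N.
  have := leq_mul nm (leqnn (D * q)); have := leq_mul (leqnn (4 * th)) a.
  by rewrite !mulnA; nia.
have b2 : (32 * (u * E) * (D * q * g.+1) <= 8 * (X * E))%N.
  apply: (@leq_trans (n * (D * q) * g.+1)).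
    by rewrite mulnA leq_mul2r; apply/orP; right; rewrite leq_mul2r hn orbT.
  apply: (@leq_trans (4 * (th * X) * g.+1)); first by rewrite leq_mul2r b1 orbT.
  by have := leq_mul gE2 (leqnn X); nia.
have h' : (X <= (D * q * g.+1) * u + q * g.+1 * u)%N by move: h; rewrite mulSn; nia.
case: (posnP E) => [E0|E0]; first by move: tE; rewrite E0; lia.
have b3 : (4 * (u * (D * q * g.+1)) <= X)%N.
  rewrite -(@leq_pmul2r (8 * E)) ?muln_gt0 ?E0 //; move: b2.
  by move: (D * q * g.+1)%N => y; nia.
have b4 : (3 * X <= 4 * (q * g.+1 * u))%N by move: h' b3; move: (D * q * g.+1)%N => y; nia.
have b5 : (4 * (q * u) <= X)%N by apply: leq_trans hX; nia.
have b6 : (2 * X <= 4 * (q * g * u))%N by move: b4; rewrite mulnS; nia.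
have := leq_mul b6 (leqnn th); have := leq_mul gE (leqnn (4 * (q * u))).
have : (4 * (q * u) * E <= 8 * (u * u) * E)%N by rewrite leq_mul2r; apply/orP; right; nia.
move: (g * th)%N => y; nia.
Qed.

(* Vinogradov's lemma. *)
Lemma small_multiple (X u E : nat) (x : G) (H : {set 'I_X}) :
  (0 < u)%N -> (X <= #|H| * u)%N -> (8 * (u * u) <= X)%N -> (32 * (u * E) <= n)%N ->
  (forall h h' : 'I_X, h \in H -> h' \in H -> (h <= h' -> mag ((h' - h)%N%:R * x)%R <= E)%N) ->
  exists2 q, (0 < q <= 2 * u)%N & (mag (q%:R * x)%R * X <= 4 * (u * u) * E)%N.
Proof.
move=> u0 hH hX hE hsm.
have uX : (2 * u < X)%N by nia.
have [h [h' [hh hh' /andP[lt le]]]] := close_pair u0 uX hH.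
(* Any close pair of [H] gives the multiplier. If [q x] were not much smaller than [E], its
   multiples would soon leave the range below [E], and each class modulo [q] would meet [H] too
   rarely. *)
set q := (h' - h)%N.
have q0 : (0 < q)%N by rewrite subn_gt0.
have q2 : (q <= 2 * u)%N by rewrite leq_subLR.
exists q; first by rewrite q0.
set th := mag (q%:R * x).
case: (posnP th) => [->|th0]; first by rewrite mul0n.
have tE : (th <= E)%N by apply: hsm hh hh' (ltnW lt).
have tn : (th.*2 <= n)%N by exact: mag_lt.
set m := (n %/ th.*2)%N.
have m0 : (0 < m)%N by rewrite divn_gt0 // double_gt0.
have mE : (m * th.*2 <= n)%N by exact: leq_trunc_div.
have mn : (n <= 4 * (m * th))%N by exact: half_quotient.
set g := (E %/ th)%N.
have cnt : (#|H| <= (X %/ (q * m)).+1 * (q * g.+1))%N.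
  apply: class_count => // y y' i yH y'H e im.
  rewrite leq_divRL // -mag_mul_small.
    apply: leq_trans (hsm _ _ yH y'H _); last by rewrite e leq_addr.
    by rewrite e addKn natrM mulrA.
  by apply: leq_trans mE; rewrite -/th -doubleMr leq_double leq_mul2r ltnW ?orbT.
apply: (@window_arith X q m g u E th) => //.
  by apply: leq_trans hH _; rewrite leq_mul2r cnt orbT.
exact: leq_trunc_div.
Qed.

End Counting.

Lemma weyl_arith (m Y w E n : nat) : (m * (2 * Y) <= 4 * (4 * w * (4 * w)) * E)%N ->
  (E * Y <= 8 * w * n)%N -> (m * Y ^ 2 <= 256 * (w * w * w) * n)%N.
Proof.
move=> hq hE; have := leq_mul (leqnn (w * w)) hE; have := leq_mul hq (leqnn Y).
by rewrite -mulnn; nia.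
Qed.

Section Weyl.
Variables (R : realType) (p : nat).
Local Notation n := (p.+2).
Local Notation G := ('Z_n).
Local Notation C := R[i].
Local Notation N := (n%:R : R).
Local Notation chi := (@chi R p).
Local Notation mag := (@mag p).
Let hchi : good_char chi := chi_good R p.
Let N0 : 0 < N. Proof. by rewrite ltr0n. Qed.

Lemma geometric_sum (g : G) a b : (a <= b)%N ->
  (1 - chi g) * \sum_(a <= j < b) chi (g * j%:R) = chi (g * a%:R) - chi (g * b%:R).
Proof.
elim: b => [|b IH]; first by rewrite leqn0 => /eqP ->; rewrite big_nil mulr0 subrr.
rewrite leq_eqVlt => /orP[/eqP <-|]; first by rewrite big_geq // mulr0 subrr.
rewrite ltnS => ab; rewrite big_nat_recr //= mulrDr IH // -natr1 mulrDr mulr1 (chiD hchi (g * b%:R) g); ring.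
Qed.

Lemma geometric_le (g : G) a b : normc (\sum_(a <= j < b) chi (g * j%:R)) * (mag g)%:R <= N.
Proof.
case: (leqP a b) => [ab|/ltnW ba]; last by rewrite big_geq // normc0 mul0r ltW.
have h := congr1 (@normc R) (geometric_sum g ab); rewrite normcM in h.
have h2 : normc (1 - chi g) * normc (\sum_(a <= j < b) chi (g * j%:R)) <= 2.
  rewrite h; apply: le_trans (normcD _ _) _; rewrite normc_opp !chi_norm1; lra.
have := chi_sub1_ge R g; set w := normc (1 - _) in h2 *; set s := normc (\sum_(_ <= _ < _) _) in h2 *.
have s0 : 0 <= s by exact: normc_ge0.
rewrite ler_pdivrMr // => h3; have := ler_wpM2r s0 h3; have := ler_wpM2r (ltW N0) h2.
by move: s w s0 h2 h3 => s' w' s0 h2 h3; lra.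
Qed.

(** The difference [i - j] is recorded as [h - Y], which keeps the index [h] a natural number below
    [2 * Y]. *)
Lemma diagonal_sum (F : nat -> nat -> C) Y :
  \sum_(j < Y) \sum_(i < Y) F i j =
  \sum_(h < 2 * Y) \sum_(Y - h <= j < minn Y (2 * Y - h)) F (j + h - Y)%N j.
Proof.
transitivity (\sum_(j < Y) \sum_(h < 2 * Y | (Y - j <= h)%N && (h < 2 * Y - j)%N) F (j + h - Y)%N j).
  apply: eq_bigr => j _.
  rewrite -(big_mkord (fun h => (Y - j <= h)%N && (h < 2 * Y - j)%N) (fun h => F (j + h - Y)%N j)).
  rewrite -big_nat_widen ?leq_subr // -(big_nat_widenl (Y - j) 0 (2 * Y - j) xpredT) //.
  rewrite -(big_mkord xpredT (fun i => F i j)).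
  rewrite (_ : (2 * Y - j = Y + (Y - j))%N); last by have := ltn_ord j; lia.
  rewrite -[X in _ = \big[_/_]_(X <= _ < _ | _) _]add0n big_addn addnK; apply: eq_big_nat => i _.
  by congr (F _ _); have := ltn_ord j; lia.
rewrite (exchange_big_dep xpredT) //=; apply: eq_bigr => h _.
rewrite -(big_mkord (fun j => (Y - j <= h)%N && (h < 2 * Y - j)%N) (fun j => F (j + h - Y)%N j)).
rewrite (big_nat_widenl (Y - h) 0) // (big_nat_widen 0 (minn Y (2 * Y - h)) Y) ?geq_minl //.
rewrite [LHS]big_nat_cond [RHS]big_nat_cond; apply: eq_bigl => j /=.
case: (ltnP j Y) => jY //; have := ltn_ord h; rewrite leq_min; lia.
Qed.

Lemma weyl_square (b : G) Y :
  normc (\sum_(j < Y) chi (b * (j%:R) ^+ 2)) ^+ 2 <=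
  \sum_(h < 2 * Y) normc (\sum_(Y - h <= j < minn Y (2 * Y - h)) chi ((1 + 1) * ((h%:R - Y%:R) * b) * j%:R)).
Proof.
rewrite -[leLHS]/(Re (_ ^+ 2)%:C%C) normsq_sum exchange_big /=.
rewrite (diagonal_sum (fun i j => chi (b * i%:R ^+ 2) * conjc (chi (b * j%:R ^+ 2)))).
rewrite Re_sum; apply: ler_sum => h _; apply: le_trans (Re_le_normc _) _.
rewrite (_ : \sum_(_ <= _ < _) _ = chi (b * (h%:R - Y%:R) ^+ 2) *
  \sum_(Y - h <= j < minn Y (2 * Y - h)) chi ((1 + 1) * ((h%:R - Y%:R) * b) * j%:R)).
  by rewrite normcM chi_norm1 mul1r.
rewrite mulr_sumr; apply: eq_big_nat => j /andP[h1 h2].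
rewrite -(chiB hchi) -(chiD hchi); congr (chi _).
by rewrite natrB ?natrD; [ring | lia].
Qed.

(** Weyl differencing leaves geometric sums with ratios [2 (h - Y) b]; many of them are large, so
    many multiples of [2 b] are near 0, and Vinogradov's lemma extracts one multiplier. *)
Lemma weyl (b : G) (Y U : nat) : (0 < U)%N -> (1024 * U ^ 4 <= Y)%N ->
  Y%:R <= U%:R * normc (\sum_(j < Y) chi (b * (j%:R) ^+ 2)) ->
  exists2 q, (0 < q <= 16 * U ^ 2)%N & (mag (q%:R * b)%R * Y ^ 2 <= 256 * U ^ 6 * n)%N.
Proof.
move=> U0 hY hS.
have Y0 : (0 < Y)%N by apply: leq_trans hY; rewrite muln_gt0 expn_gt0 U0.
have Yr : 0 < Y%:R :> R by rewrite ltr0n.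
have Ur : 0 < U%:R :> R by rewrite ltr0n.
pose c (h : 'I_(2 * Y)) : R :=
  normc (\sum_(Y - h <= j < minn Y (2 * Y - h)) chi ((1 + 1) * ((h%:R - Y%:R) * b) * j%:R)).
pose H := [set h | Y%:R <= 4 * U%:R ^+ 2 * c h].
have cY h : c h <= Y%:R.
  rewrite /c; apply: le_trans (normc_sum _ _ _) _.
  apply: (@le_trans _ _ (\sum_(Y - h <= j < minn Y (2 * Y - h)) 1)).
    by apply: ler_sum => j _; rewrite chi_norm1.
  by rewrite sumr_const_nat ler_nat; apply: leq_trans (leq_subr _ _) _; rewrite geq_minl.
have h1 : Y%:R ^+ 2 <= U%:R ^+ 2 * \sum_h c h.
  apply: (@le_trans _ _ ((U%:R * normc (\sum_(j < Y) chi (b * (j%:R) ^+ 2))) ^+ 2)).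
    by apply: lerXn2r; rewrite ?nnegrE ?mulr_ge0 ?normc_ge0 // ltW.
  by rewrite exprMn ler_pM2l ?exprn_gt0 //; exact: weyl_square.
have h2 : \sum_h (4 * U%:R ^+ 2 * c h) <= \sum_h (4 * U%:R ^+ 2 * Y%:R * (h \in H)%:R + Y%:R).
  apply: ler_sum => h _; rewrite inE.
  have U2 : 0 < U%:R ^+ 2 :> R by rewrite exprn_gt0.
  case: (leP Y%:R (4 * U%:R ^+ 2 * c h)) => hc; last by rewrite mulr0 add0r ltW.
  apply: (@le_trans _ _ (4 * U%:R ^+ 2 * Y%:R)); first by rewrite ler_pM2l ?mulr_gt0.
  by rewrite -[true%:R]/1 mulr1 lerDl.
have hHc : (2 * Y <= #|H| * (4 * U ^ 2))%N.
  rewrite -(ler_nat R) !natrM -expr2.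
  rewrite -mulr_sumr big_split /= -mulr_sumr sum_mem sumr_const card_ord -[X in _ + X]mulr_natl natrM in h2.
  have h3 : 4 * Y%:R ^+ 2 <= 4 * U%:R ^+ 2 * Y%:R * #|H|%:R + 2 * Y%:R * Y%:R :> R.
    by apply: le_trans h2; rewrite -mulrA ler_pM2l.
  rewrite -(ler_pM2l Yr); move: h3; rewrite expr2; move: (U%:R ^+ 2 : R) (#|H|%:R : R) (Y%:R : R) => a b' y; lra.
have hm h : h \in H -> (mag ((1 + 1) * ((h%:R - Y%:R) * b))%R * Y <= 4 * U ^ 2 * n)%N.
  rewrite inE => hc; rewrite -(ler_nat R) !natrM -expr2.
  have hg := geometric_le ((1 + 1) * ((h%:R - Y%:R) * b)) (Y - h) (minn Y (2 * Y - h)).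
  rewrite -/(c h) in hg.
  have U2 : 0 <= 4 * U%:R ^+ 2 :> R by rewrite mulr_ge0 ?sqr_ge0.
  have m0 : 0 <= (mag ((1 + 1) * ((h%:R - Y%:R) * b)))%:R :> R by [].
  have a1 := ler_wpM2l U2 hg; have a2 := ler_wpM2l m0 hc; apply: le_trans a2 _.
  by apply: le_trans a1; rewrite le_eqVlt; apply/orP; left; apply/eqP; ring.
pose E := (8 * U ^ 2 * n %/ Y)%N.
have hE : (E * Y <= 8 * U ^ 2 * n)%N by exact: leq_trunc_div.
have cond1 : (8 * (4 * U ^ 2 * (4 * U ^ 2)) <= 2 * Y)%N.
  by move: hY; rewrite (expnM U 2 2); move: (U ^ 2)%N => w; lia.
have cond2 : (32 * (4 * U ^ 2 * E) <= n)%N.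
  rewrite -(leq_pmul2r Y0); apply: (@leq_trans (n * (1024 * U ^ 4))); last by rewrite leq_mul2l hY orbT.
  by move: hE; rewrite (expnM U 2 2); move: (U ^ 2)%N => w hE; have := leq_mul (leqnn (128 * w)) hE; nia.
have pair (h h' : 'I_(2 * Y)) : h \in H -> h' \in H -> (h <= h')%N ->
    (mag ((h' - h)%N%:R * ((1 + 1) * b))%R <= E)%N.
  move=> hh hh' le; rewrite leq_divRL //.
  have -> : (h' - h)%N%:R * ((1 + 1) * b) = (1 + 1) * ((h'%:R - Y%:R) * b) - (1 + 1) * ((h%:R - Y%:R) * b).
    by rewrite natrB //; ring.
  have := hm _ hh; have := hm _ hh'; set x1 := _ * (_ * b); set x2 := _ * (_ * b).
  have := magD x1 (- x2); rewrite magN.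
  by move: (mag _) (mag x1) (mag x2) (U ^ 2 * n)%N => m m1 m2; nia.
have U4 : (0 < 4 * U ^ 2)%N by rewrite muln_gt0 expn_gt0 U0.
have [q /andP[q0 q1] hq] := small_multiple U4 hHc cond1 cond2 pair.
(* The factor 2 produced by differencing is absorbed into the multiplier. *)
exists (2 * q)%N; first by apply/andP; split; lia.
have -> : (2 * q)%N%:R * b = q%:R * ((1 + 1) * b) by rewrite natrM; ring.
move: hq hE; set m := mag _; rewrite (_ : (U ^ 6 = U ^ 2 * U ^ 2 * U ^ 2)%N); last by rewrite -!expnD.
exact: weyl_arith.
Qed.

End Weyl.

(** * Simultaneous quadratic recurrence *)

Section BaseArith.
Variables (k d u : nat).
Hypotheses (k0 : (0 < k)%N) (d0 : (0 < d)%N) (u0 : (0 < u)%N).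
Let base := (4096 * 64 * k * (d * d) * u)%N.

Lemma base_ge_u : (4096 * 64 * u <= base)%N.
Proof.
rewrite /base leq_mul2r -!mulnA leq_mul2l; apply/orP; right; apply/orP; right.
by rewrite -{1}[64%N]muln1 leq_mul2l !muln_gt0 k0 d0.
Qed.

Lemma base_ge_d2 : (4096 * u * (d * d) <= base)%N.
Proof.
have -> : base = (4096 * u * (d * d) * (64 * k))%N by rewrite /base; lia.
by rewrite leq_pmulr // muln_gt0.
Qed.

Lemma base_ge_du : (16 * u * d <= base)%N.
Proof.
apply: leq_trans base_ge_d2; apply: (@leq_trans (16 * u * (d * d))).
  by rewrite leq_mul2l leq_pmulr ?orbT.
by rewrite leq_mul2r; apply/orP; right; rewrite leq_mul2r; apply/orP; right; lia.
Qed.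

End BaseArith.

Lemma base_split (k d a b : nat) : (64 * k * d * (16 * a * d) * (256 * b) = 4096 * 64 * k * (d * d) * (a * b))%N.
Proof. by lia. Qed.

Lemma scale_old (X a m Y B n : nat) : (X * m * (B * Y) ^ 2 <= n -> a <= B -> 0 < B ->
  X * (a * m) * Y ^ 2 <= n)%N.
Proof.
move=> h aB B0; apply: leq_trans h; rewrite expnMn.
have : (a <= B ^ 2)%N by apply: leq_trans aB _; rewrite -mulnn leq_pmull.
move=> /(leq_mul (leqnn (X * m * Y ^ 2))) h2.
rewrite (_ : (X * (a * m) * Y ^ 2 = X * m * Y ^ 2 * a)%N); last by ring.
by apply: leq_trans h2 _; rewrite leq_eqVlt; apply/orP; left; apply/eqP; ring.
Qed.

Lemma scale_new (X a w m Y B n : nat) : (m * (B * Y) ^ 2 <= w * n -> X * a * w <= B -> 0 < B ->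
  X * (a * m) * Y ^ 2 <= n)%N.
Proof.
move=> h hB B0; rewrite -(@leq_pmul2l (B ^ 2)) ?expn_gt0 ?B0 //.
have h2 := leq_mul (leqnn (X * a)) h.
have h3 : (X * a * w * n <= B ^ 2 * n)%N.
  by rewrite leq_mul2r (leq_trans hB) ?orbT // -mulnn leq_pmull.
apply: leq_trans h3; rewrite -(mulnA (X * a)%N w); apply: leq_trans h2; rewrite expnMn.
by rewrite leq_eqVlt; apply/orP; left; apply/eqP; ring.
Qed.

(** * Integer linear algebra with bounded coefficients *)

Section Cramer.
Variable J : nat.
Hypothesis J0 : (0 < J)%N.

Definition mx_bounded s k (A : 'M[int]_(s, k)) := forall i j, (absz (A i j)%R <= J)%N.

Lemma absz_sum (I : finType) (F : I -> int) : (absz (\sum_i F i)%R <= \sum_i absz (F i))%N.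
Proof.
elim/big_rec2: _ => [|i y x _ h]; first by [].
by apply: leq_trans (_ : (absz (F i) + absz x <= _)%N); [lia | rewrite leq_add2l].
Qed.

Lemma absz_prod (I : finType) (F : I -> int) : absz (\prod_i F i) = (\prod_i absz (F i))%N.
Proof. by elim/big_rec2: _ => // i y x _ h; rewrite abszM h. Qed.

Lemma det_bound s (A : 'M[int]_s) : mx_bounded A -> (absz (\det A)%R <= s`! * J ^ s)%N.
Proof.
move=> hA; rewrite /determinant; apply: leq_trans (absz_sum _) _.
rewrite -perm.card_Sn -sum_nat_const; apply: leq_sum => sg _.
rewrite abszM abszX exp1n mul1n absz_prod.
apply: (@leq_trans (\prod_(i < s) J)%N); last by rewrite prod_nat_const card_ord.
by apply: leq_prod => i _; exact: hA.
Qed.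

Lemma fact_pow_mono a b : (a <= b)%N -> (a`! * J ^ a <= b`! * J ^ b)%N.
Proof. by move=> h; apply: leq_mul; [exact: leq_fact | by rewrite leq_pexp2l]. Qed.

Lemma adj_bound s (A : 'M[int]_s) : mx_bounded A -> forall i j, (absz ((\adj A) i j)%R <= s`! * J ^ s)%N.
Proof.
move=> hA i j; rewrite mxE /cofactor abszM abszX exp1n mul1n.
apply: leq_trans (fact_pow_mono (leq_pred s)); apply: det_bound => a b.
by rewrite !mxE; exact: hA.
Qed.

Definition cramer_bound k := (k * (J * (k`! * J ^ k)))%N.

(* Cramer's rule on a nonsingular maximal minor. *)
Lemma cramer s k (A : 'M[int]_(s, k)) : (0 < k)%N -> mx_bounded A ->
  row_free (map_mx (intr : int -> rat) A) ->
  exists2 D : nat, (0 < D <= cramer_bound k)%N &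
  forall m : 'rV[int]_k, mx_bounded m ->
    (map_mx (intr : int -> rat) m <= map_mx intr A)%MS ->
    exists2 c : 'rV[int]_s, (forall j, (absz (c 0 j)%R <= cramer_bound k)%N) & D%:Z *: m = c *m A.
Proof.
move=> k0 hA fA; set Aq := map_mx _ A in fA *.
have sk : (s <= k)%N by rewrite -(eqP fA) rank_leq_col.
have fT : row_full Aq^T by rewrite /row_full mxrank_tr.
pose f := fullrankfun fT.
pose B := \matrix_(i < s, j < s) A i (f j).
have BE : map_mx (intr : int -> rat) B = (rowsub f Aq^T)^T by apply/matrixP => i j; rewrite !mxE.
have Bu : map_mx (intr : int -> rat) B \in unitmx.
  by rewrite BE unitmx_tr fullrowsub_unit.
have hB : mx_bounded B by move=> i j; rewrite mxE.
have dB : \det B != 0.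
  by move: Bu; rewrite unitmxE det_map_mx unitfE intr_eq0.
have cb a : (a <= s`! * J ^ s -> a <= cramer_bound k)%N.
  move=> h; apply: leq_trans h (leq_trans (fact_pow_mono sk) _).
  by rewrite /cramer_bound; apply: leq_trans (leq_pmull _ k0); exact: leq_pmull.
exists (absz (\det B)); first by rewrite absz_gt0 dB cb // det_bound.
move=> m hm /submxP[c0 hc0].
pose mf := \row_j m 0 (f j).
pose c := mf *m \adj B.
have key : \det B *: m = c *m A.
  have inj : injective (map_mx (intr : int -> rat) : 'rV_k -> 'rV_k).
    by move=> X Y e; apply/matrixP => i j; have := congr1 (fun Z : 'rV_k => Z i j) e; rewrite !mxE => /intr_inj.
  apply: inj.
  rewrite map_mxZ map_mxM /= -/Aq hc0.
  have -> : map_mx intr c = (\det B)%:~R *: c0.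
    rewrite /c map_mxM map_mx_adj.
    have -> : map_mx intr mf = c0 *m map_mx intr B.
      apply/rowP => j; rewrite !mxE.
      have := congr1 (fun x : 'rV[rat]_k => x 0 (f j)) hc0; rewrite !mxE => ->.
      by apply: eq_bigr => i _; rewrite !mxE.
    by rewrite -mulmxA mul_mx_adj det_map_mx mul_mx_scalar.
  by rewrite scalemxAl.
have cbd j : (absz (c 0 j)%R <= cramer_bound k)%N.
  rewrite mxE; apply: leq_trans (absz_sum _) _.
  apply: (@leq_trans (\sum_(i < s) J * (k`! * J ^ k))).
    apply: leq_sum => i _; rewrite abszM; apply: leq_mul; first by rewrite mxE.
    exact: leq_trans (adj_bound hB _ _) (fact_pow_mono sk).
  by rewrite sum_nat_const card_ord leq_mul2r sk orbT.
(* The common denominator must be a positive natural number, so the coefficients take the sign of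
   the determinant. *)
case: (leP 0 (\det B)) => sg; [exists c | exists (- c)] => //.
- by rewrite gez0_abs.
- by move=> j; rewrite mxE abszN.
by rewrite ltz0_abs // scaleNr key mulNmx.
Qed.

Lemma row_free_extend s k (A : 'M[int]_(s, k)) (m : 'rV[int]_k) :
  row_free (map_mx (intr : int -> rat) A) ->
  ~~ (map_mx (intr : int -> rat) m <= map_mx intr A)%MS ->
  row_free (map_mx (intr : int -> rat) (col_mx A m)).
Proof.
move=> fA hm; rewrite map_col_mx /row_free; set a := map_mx _ A in fA hm *; set b := map_mx _ m in hm *.
have lt : (a < col_mx a b)%MS.
  rewrite ltmxE -addsmxE addsmxSl /=; apply: contra hm => h; apply: submx_trans h; rewrite -addsmxE; exact: addsmxSr.
have := rank_ltmx lt; rewrite (eqP fA) => h1.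
by rewrite eqn_leq rank_leq_row /=; apply: leq_trans h1; rewrite addn1.
Qed.

End Cramer.

Lemma bernoulli_two (R : realType) (a : nat) : (0 < a)%N -> 2 <= (1 + a%:R^-1) ^+ a :> R.
Proof.
move=> a0; have ar : 0 < a%:R :> R by rewrite ltr0n.
have i0 : 0 < a%:R^-1 :> R by rewrite invr_gt0.
have B m : 1 + m%:R * a%:R^-1 <= (1 + a%:R^-1) ^+ m :> R.
  elim: m => [|m IH]; first by rewrite mul0r addr0 expr0.
  rewrite exprS -natr1; apply: le_trans (ler_wpM2l _ IH); last by lra.
  have m0 : 0 <= m%:R :> R by []; nra.
by have := B a; rewrite divff ?gt_eqF.
Qed.

Section Recurrence.
Variables (R : realType) (p : nat).
Local Notation n := (p.+2).
Local Notation G := ('Z_n).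
Local Notation C := R[i].
Local Notation N := (n%:R : R).
Local Notation chi := (@chi R p).
Local Notation mag := (@mag p).
Let hchi : good_char chi := chi_good R p.
Let N0 : 0 < N. Proof. by rewrite ltr0n. Qed.

Lemma magZ (c : int) (x : G) : (mag (c%:~R * x)%R <= absz c * mag x)%N.
Proof.
case: c => c; first exact: magM.
by rewrite NegzE mulrNz mulNr magN; exact: magM.
Qed.

Variables (k T : nat) (al : 'I_k -> G).
Hypothesis k0 : (0 < k)%N.
Hypothesis T0 : (0 < T)%N.
Local Notation J := (T ^ 3)%N.
Local Notation V := (J.+1 ^ k)%N.
Hypothesis TV : (4 * V <= 2 ^ T)%N.

Definition form (m : 'rV[int]_k) : G := \sum_i (m 0 i)%:~R * al i.

Let Om := {ffun 'I_k * 'I_J -> bool}.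

Lemma sum_le_ord (w : Om) i : (\sum_(j < J) w (i, j) < J.+1)%N.
Proof.
rewrite ltnS; apply: leq_trans (_ : (\sum_(j < J) 1 <= _)%N).
  by apply: leq_sum => j _; case: (w (i, j)).
by rewrite sum_nat_const card_ord muln1.
Qed.

(** When [riesz] is multiplied out, the character of a choice [w] depends only on how many of the
    [J] copies of each factor are chosen; there are [V] such count vectors. *)
Definition weight (w : Om) : {ffun 'I_k -> 'I_J.+1} := [ffun i => Ordinal (sum_le_ord w i)].

Definition wform (w : Om) : G := \sum_i (weight w i)%:R * al i.

(* The Riesz-type product [prod_i ((1 + chi (al i x)) / 2) ^ J]; its modulus
   squared is a positive combination of characters, concentrated where all
   the [al i x] are small. *)
Definition riesz (x : G) : C :=
  \prod_(ij : 'I_k * 'I_J) ((1 + chi (al ij.1 * x)) / 2%:R).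

Lemma riesz_expand x : riesz x = \sum_(w : Om) chi (wform w * x) / 2%:R ^+ (k * J).
Proof.
have h (y : G) : (1 + chi y) / 2%:R = \sum_(b : bool) chi (b%:R * y) / 2%:R :> C.
  by rewrite big_bool /= mul1r mul0r (chi0 hchi) -mulrDl addrC.
rewrite /riesz; under eq_bigr do rewrite h.
rewrite bigA_distr_bigA /=; apply: eq_bigr => w _.
rewrite big_split /= prodr_const card_prod !card_ord -exprVn; congr (_ * _).
have -> : \prod_(ij : 'I_k * 'I_J) chi ((w ij)%:R * (al ij.1 * x)) =
    chi (\sum_(ij : 'I_k * 'I_J) (w ij)%:R * (al ij.1 * x)).
  by apply/esym/(big_morph chi (chiD hchi) (chi0 hchi)).
congr (chi _); rewrite (eq_bigr (fun ij => (w (ij.1, ij.2))%:R * (al ij.1 * x))); last by case.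
rewrite -(pair_bigA _ (fun i j => (w (i, j))%:R * (al i * x))) /=.
rewrite /wform mulr_suml; apply: eq_bigr => i _; rewrite -mulr_suml -natr_sum ffunE /=.
by rewrite mulrA.
Qed.

Lemma half_norm x : normc ((1 + chi x) / 2%:R) ^+ 2 = 1 - normc (1 - chi x) ^+ 2 / 4.
Proof.
rewrite normcM exprMn; have h := normsq_sub1 (chi_norm1 R x).
have h2 : normc (1 + chi x) ^+ 2 = 2 + 2 * Re (chi x).
  have := @normsq_sub1 R (- chi x); rewrite normc_opp chi_norm1 => /(_ erefl).
  by rewrite opprK => ->; case: (chi x) => a b /=; lra.
have -> : normc (2%:R^-1 : C) = 2^-1 :> R.
  by rewrite -(RC_nat R 2) -fmorphV normc_real ger0_norm // invr_ge0.
by rewrite h h2; lra.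
Qed.

Lemma half_norm_le x : normc ((1 + chi x) / 2%:R) ^+ 2 <= 1.
Proof. by rewrite half_norm gerBl divr_ge0 // sqr_ge0. Qed.

Lemma bernoulli_half (a : nat) : (0 < a)%N -> (1 - a%:R^-1) ^+ a <= 2^-1 :> R.
Proof.
move=> a0; have ar : 0 < a%:R :> R by rewrite ltr0n.
have i1 : a%:R^-1 <= 1 :> R by rewrite invf_le1 // ler1n.
have i0 : 0 < a%:R^-1 :> R by rewrite invr_gt0.
have h1 := bernoulli_two R a0.
have h2 : (1 - a%:R^-1) ^+ a * (1 + a%:R^-1) ^+ a <= 1 :> R.
  rewrite -exprMn exprn_ile1 //; nra.
have h3 : 0 <= (1 - a%:R^-1) ^+ a :> R by rewrite exprn_ge0 // subr_ge0.
by move: h1 h2 h3; move: ((1 - a%:R^-1) ^+ a) ((1 + a%:R^-1) ^+ a) => u v; nra.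
Qed.

Lemma riesz_norm_le x : normc (riesz x) ^+ 2 <= 1.
Proof.
have -> : normc (riesz x) ^+ 2 = \prod_(ij : 'I_k * 'I_J) normc ((1 + chi (al ij.1 * x)) / 2%:R) ^+ 2.
  rewrite /riesz; elim/big_rec2: _ => [|ij y z _ <-]; first by rewrite normc1 expr1n.
  by rewrite normcM exprMn.
by apply: prodr_ile1 => ij _; apply/andP; split; [exact: sqr_ge0 | exact: half_norm_le].
Qed.

(** Each of the [J] factors of a coordinate of magnitude above [n / T] is at most [1 - T ^ -2], and
    [T ^ 2] of them halve the product; hence the choice [J = T ^ 3]. *)
Lemma riesz_small x i : (n < T * mag (al i * x)%R)%N -> normc (riesz x) ^+ 2 <= 2^-1 ^+ T.
Proof.
move=> hi; pose f (ij : 'I_k * 'I_J) : R := normc ((1 + chi (al ij.1 * x)) / 2%:R) ^+ 2.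
have -> : normc (riesz x) ^+ 2 = \prod_ij f ij.
  rewrite /riesz; elim/big_rec2: _ => [|ij y z _ <-]; first by rewrite normc1 expr1n.
  by rewrite normcM exprMn.
have f0 ij : 0 <= f ij by exact: sqr_ge0.
have f1 ij : f ij <= 1 by exact: half_norm_le.
have Tr : 0 < T%:R :> R by rewrite ltr0n.
have fi j : f (i, j) <= 1 - (T ^ 2)%:R^-1.
  rewrite /f -[(i, j).1]/i half_norm lerD2l lerN2.
  have h1 := chi_sub1_ge R (al i * x).
  have h2 : T%:R^-1 <= (mag (al i * x))%:R / N.
    rewrite ler_pdivlMr // mulrC ler_pdivrMr // mulrC -natrM ler_nat; exact: ltnW.
  have h3 : 2 * T%:R^-1 <= normc (1 - chi (al i * x)) by apply: le_trans h1; rewrite -mulrA ler_pM2l.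
  rewrite natrX -exprVn; have T1 : 0 <= T%:R^-1 :> R by rewrite invr_ge0.
  by move: T1 h3; move: (T%:R^-1 : R) (normc _) => u v; nra.
rewrite -(pair_bigA _ (fun i j => f (i, j))) /= (bigD1 i) //=.
apply: (@le_trans _ _ (\prod_(j < J) f (i, j))).
  rewrite ler_piMr ?prodr_ge0 // ; apply: prodr_ile1 => i' _.
  by rewrite prodr_ge0 //= prodr_ile1 // => j _; rewrite f0 f1.
apply: (@le_trans _ _ (\prod_(j < J) (1 - (T ^ 2)%:R^-1))).
  by apply: ler_prod => j _; rewrite f0 fi.
rewrite prodr_const card_ord; have -> : J = (T ^ 2 * T)%N by rewrite -expnSr.
rewrite exprM.
have T2 : (0 < T ^ 2)%N by rewrite expn_gt0 T0.
apply: lerXn2r; rewrite ?nnegrE ?invr_ge0 //; last exact: bernoulli_half.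
by rewrite exprn_ge0 // subr_ge0 invf_le1 ?ler1n ?ltr0n.
Qed.

Lemma collisions (I W : finType) (f : I -> W) :
  #|I|%:R ^+ 2 <= #|W|%:R * \sum_i \sum_j (f i == f j)%:R :> R.
Proof.
pose c (v : W) : R := \sum_i (f i == v)%:R.
have e1 : \sum_v c v = #|I|%:R.
  rewrite /c exchange_big /= -sum1_card natr_sum; apply: eq_bigr => i _.
  by rewrite (bigD1 (f i)) //= eqxx big1 ?addr0 // => v /negbTE; rewrite eq_sym => ->.
rewrite -e1; apply: le_trans (sum_sq_le _ _) _; apply: ler_wpM2l => //.
rewrite le_eqVlt; apply/orP; left; apply/eqP.
under eq_bigr do rewrite expr2 {1}/c mulr_suml.
rewrite exchange_big /=; apply: eq_bigr => i _.
rewrite (bigD1 (f i)) //= eqxx mul1r big1 ?addr0 => [|v /negbTE]; last by rewrite eq_sym => ->; rewrite mul0r.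
by apply: eq_bigr => j _; rewrite eq_sym.
Qed.

Definition diff_row (w w' : Om) : 'rV[int]_k := \row_i ((weight w i)%:Z - (weight w' i)%:Z).

Lemma energy_arith (v y P c s t : R) : 2 * v * y * P - y * c <= 2 * v * s ->
  y * c <= y * (v * P) -> v * s <= v * (c * t) -> y * c <= c * (2 * v * t).
Proof. by lra. Qed.

Lemma form_diff w w' : form (diff_row w w') = wform w - wform w'.
Proof.
rewrite /form /wform -sumrB; apply: eq_bigr => i _.
by rewrite mxE rmorphB /= mulrBl.
Qed.

(** On the bad range the squared modulus of [riesz] is tiny except at [e = 0], whereas by
    [collisions] the pairs of equal weight alone contribute a proportion at least [1 / V]. Some
    other pair must compensate with a negative sum, and [m] is the difference of its weights. *)
Lemma negative_sum (q Y : nat) : (4 * V < Y)%N ->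
  (forall e, (0 < e < Y)%N -> exists i, (n < T * mag (al i * (q * e)%N%:R ^+ 2)%R)%N) ->
  exists2 m : 'rV[int]_k, mx_bounded J m &
    2 * V%:R * Re (\sum_(e < Y) chi (form m * q%:R ^+ 2 * e%:R ^+ 2)) <= - Y%:R.
Proof.
move=> hY hbad.
pose S w w' : C := \sum_(e < Y) chi ((wform w - wform w') * q%:R ^+ 2 * e%:R ^+ 2).
have Y0 : (0 < Y)%N by lia.
apply: contrapT => hn.
have hS w w' : - Y%:R < 2 * V%:R * Re (S w w').
  rewrite ltNge; apply/negP => h; apply: hn; exists (diff_row w w'); last by rewrite form_diff.
  by move=> i j; rewrite mxE; have := ltn_ord (weight w j); have := ltn_ord (weight w' j); lia.
have hS0 w w' : weight w = weight w' -> Re (S w w') = Y%:R.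
  move=> h; rewrite /S /wform h subrr.
  under eq_bigr do rewrite !mul0r (chi0 hchi).
  by rewrite sumr_const card_ord -(RC_nat R).
pose c : R := 2 ^+ (k * J).
have c0 : 0 < c by rewrite exprn_gt0.
have cC : c%:C%C = 2%:R ^+ (k * J) :> C by rewrite /c rmorphXn /= RC_nat.
have cO : c = #|Om|%:R by rewrite card_ffun card_bool card_prod !card_ord natrX.
have bE x : c ^+ 2 * normc (riesz x) ^+ 2 = Re (\sum_w \sum_w' chi ((wform w - wform w') * x)).
  have -> : c ^+ 2 * normc (riesz x) ^+ 2 = normc (\sum_w chi (wform w * x)) ^+ 2.
    rewrite -exprMn -[X in X * normc _](ger0_norm (ltW c0)) -normc_real -normcM; congr (normc _ ^+ 2).
    rewrite riesz_expand -mulr_suml mulrC -cC divfK //.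
    by rewrite fmorph_eq0 gt_eqF.
  rewrite -[LHS]/(Re (_ ^+ 2)%:C%C) normsq_sum; congr (Re _).
  by apply: eq_bigr => w _; apply: eq_bigr => w' _; rewrite -(chiB hchi) -mulrBl.
pose X e : G := q%:R ^+ 2 * e%:R ^+ 2.
have AE : c ^+ 2 * \sum_(e < Y) normc (riesz (X e)) ^+ 2 = \sum_w \sum_w' Re (S w w').
  rewrite mulr_sumr; under eq_bigr do rewrite bE Re_sum.
  rewrite exchange_big; apply: eq_bigr => w _.
  under eq_bigr do rewrite Re_sum.
  rewrite exchange_big; apply: eq_bigr => w' _; rewrite /S Re_sum; apply: eq_bigr => e _.
  by congr (Re (chi _)); rewrite /X mulrA.
have up : \sum_(e < Y) normc (riesz (X e)) ^+ 2 <= 1 + Y%:R * 2^-1 ^+ T.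
  apply: (@le_trans _ _ (\sum_(e < Y) ((e == 0 :> nat)%:R + 2^-1 ^+ T))).
    apply: ler_sum => e _; case: (posnP e) => e0.
      by apply: le_trans (riesz_norm_le _) _; rewrite lerDl exprn_ge0 // invr_ge0.
    have [|i hi] := hbad e; first by rewrite e0 ltn_ord.
    rewrite add0r; apply: (riesz_small (i := i)).
    by rewrite /X -exprMn -natrM.
  rewrite big_split /= sumr_const card_ord -[X in _ + X]mulr_natl lerD2r.
  rewrite (bigD1 (Ordinal Y0)) //= big1 ?addr0 // => e /eqP he.
  by case: eqP => // h; case: he; apply: val_inj.
pose P : R := \sum_w \sum_w' (weight w == weight w')%:R.
have hP : c ^+ 2 <= V%:R * P.
  have cW : #|{ffun 'I_k -> 'I_J.+1}| = V by rewrite card_ffun !card_ord.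
  by have := collisions weight; rewrite cW -/P -cO.
have Vr : 0 < V%:R :> R by rewrite ltr0n expn_gt0.
have low : 2 * V%:R * Y%:R * P - Y%:R * c ^+ 2 <= 2 * V%:R * (\sum_w \sum_w' Re (S w w')).
  have -> : Y%:R * c ^+ 2 = \sum_(w : Om) \sum_(w' : Om) Y%:R.
    by under eq_bigr do rewrite sumr_const; rewrite sumr_const -!(mulr_natr (_ *+ _)) -mulr_natr -!cO expr2 mulrA.
  rewrite /P !mulr_sumr -sumrB; apply: ler_sum => w _.
  rewrite !mulr_sumr -sumrB; apply: ler_sum => w' _.
  case: eqP => h; last by rewrite mulr0 sub0r ltW.
  by rewrite mulr1 (hS0 _ _ h) gerBl.
have T2 : 4 * V%:R <= 2 ^+ T :> R by rewrite -natrX -natrM ler_nat.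
have hT : 4 * V%:R * 2^-1 ^+ T <= 1 :> R.
  by rewrite exprVn ler_pdivrMr ?mul1r ?exprn_gt0.
have hY' : 4 * V%:R < Y%:R :> R by rewrite -natrM ltr_nat.
rewrite -AE in low.
have c2 : 0 < c ^+ 2 by rewrite exprn_gt0.
have l1 : Y%:R * c ^+ 2 <= c ^+ 2 * (2 * V%:R * (1 + Y%:R * 2^-1 ^+ T)).
  have a1 := ler_wpM2l (ler0n R Y) hP.
  have a2 : c ^+ 2 * \sum_(e < Y) normc (riesz (X e)) ^+ 2 <= c ^+ 2 * (1 + Y%:R * 2^-1 ^+ T) by rewrite ler_pM2l.
  have a3 := ler_wpM2l (ltW Vr) a2.
  exact: energy_arith low a1 a3.
rewrite mulrC ler_pM2l // in l1.
have Yr : 0 <= Y%:R :> R by [].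
have := ler_wpM2l Yr hT; move: l1 hY'; move: (2^-1 ^+ T) (Y%:R : R) (V%:R : R) => x3 x4 x5; lra.
Qed.

Local Notation U := (2 * V)%N.
Local Notation Dl := (cramer_bound J k).
(** A single factor covering all losses of one stage: the Weyl multiplier, the Cramer denominators
    and the constant of [dependent_small]. *)
Definition rec_base : nat := (4096 * 64 * k * (Dl * Dl) * U ^ 8)%N.
Local Notation B := rec_base.
Hypothesis nogood : forall d, (0 < d <= B ^ (k + 3))%N ->
  exists i, (n < T * mag (al i * d%:R ^+ 2)%R)%N.

Lemma formD s (A : 'M[int]_(s, k)) (c : 'rV[int]_s) :
  form (c *m A) = \sum_j (c 0 j)%:~R * form (row j A).
Proof.
rewrite /form; under [RHS]eq_bigr do rewrite mulr_sumr.
rewrite exchange_big /=; apply: eq_bigr => i _; rewrite mxE rmorph_sum /= mulr_suml.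
by apply: eq_bigr => j _; rewrite mxE rmorphM /= mulrA.
Qed.

Lemma formZ (D : nat) m : form (D%:Z *: m) = D%:R * form m.
Proof. by rewrite /form mulr_sumr; apply: eq_bigr => i _; rewrite mxE rmorphM /= mulrA. Qed.

(** [P] is [q * q / D]: if [D] times [m] is the combination [c] of the rows, then [form m * q ^ 2]
    is the same combination of the values [form (row j A) * P], so no division in the group is
    required. The range still available shrinks by a factor [B] per stage. *)
Definition stage s := exists (A : 'M[int]_(s, k)) (q D P : nat),
  [/\ mx_bounded J A, row_free (map_mx (intr : int -> rat) A), (0 < q <= B ^ s.+1)%N,
      (q * q = D * P)%N /\ (0 < D <= Dl)%N &
      (forall m : 'rV[int]_k, mx_bounded J m -> (map_mx (intr : int -> rat) m <= map_mx intr A)%MS ->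
        exists2 c : 'rV[int]_s, (forall j, (absz (c 0 j)%R <= Dl)%N) & D%:Z *: m = c *m A) /\
      forall j, (64 * k * Dl * mag (form (row j A) * P%:R)%R * (B ^ (k + 2 - s)) ^ 2 <= n)%N].

Lemma cramer_bound_gt0 : (0 < Dl)%N.
Proof. by rewrite !muln_gt0 k0 !expn_gt0 T0 fact_gt0. Qed.

Lemma stage0 : stage 0.
Proof.
have A0 : mx_bounded J (0 : 'M[int]_(0, k)) by case.
have J0 : (0 < J)%N by rewrite expn_gt0 T0.
have fr : row_free (map_mx (intr : int -> rat) (0 : 'M[int]_(0, k))).
  by rewrite /row_free eqn_leq rank_leq_row.
have [D hD hc] := cramer J0 k0 A0 fr.
exists 0, D, D, D; split=> //.
  have /andP[D0 DB] := hD; rewrite D0 expn1 /rec_base; apply: leq_trans DB _.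
  have := cramer_bound_gt0; have : (0 < U ^ 8)%N by rewrite expn_gt0 muln_gt0 expn_gt0.
  move=> u0 d0; apply: leq_trans (base_ge_du k0 d0 u0).
  by rewrite leq_pmull // muln_gt0.
by split=> //; case.
Qed.

Lemma dependent_small s (A : 'M[int]_(s, k)) (q D P Y e : nat) (m : 'rV[int]_k) (c : 'rV[int]_s) :
  (s <= k)%N -> (q * q = D * P)%N -> D%:Z *: m = c *m A ->
  (forall j, (absz (c 0 j)%R <= Dl)%N) ->
  (forall j, (64 * k * Dl * mag (form (row j A) * P%:R)%R * Y ^ 2 <= n)%N) -> (e <= Y)%N ->
  (64 * mag (form m * q%:R ^+ 2 * e%:R ^+ 2)%R <= n)%N.
Proof.
move=> sk qD hm hc hA eY.
have -> : form m * q%:R ^+ 2 * e%:R ^+ 2 =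
    \sum_j (c 0 j)%:~R * ((e ^ 2)%N%:R * (form (row j A) * P%:R)).
  rewrite -[q%:R ^+ 2]natrM qD natrM mulrA [form m * _]mulrC -formZ hm formD !mulr_suml.
  by apply: eq_bigr => j _; rewrite natrX; ring.
rewrite -(leq_pmul2l k0); apply: (@leq_trans (\sum_(j < s) n)); last first.
  by rewrite sum_nat_const card_ord leq_mul2r sk orbT.
have ms (F : 'I_s -> G) : (mag (\sum_j F j)%R <= \sum_j mag (F j))%N.
  elim/big_rec2: _ => [|j y x _ h]; first by rewrite mag0.
  by apply: leq_trans (magD _ _) _; rewrite leq_add2l.
apply: (@leq_trans (\sum_j k * (64 * (Dl * (e ^ 2 * mag (form (row j A) * P%:R)%R))))).
  rewrite -big_distrr /= leq_mul2l; apply/orP; right; rewrite -big_distrr /= leq_mul2l /=.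
  apply: leq_trans (ms _) _; apply: leq_sum => j _; apply: leq_trans (magZ _ _) _.
  by apply: leq_mul => //; exact: magM.
apply: leq_sum => j _; apply: leq_trans (hA j).
have e2 : (e ^ 2 <= Y ^ 2)%N by rewrite leq_exp2r.
move: (mag _) (e ^ 2)%N (Y ^ 2)%N e2 => a b' y e2.
by have := leq_mul (leqnn (64 * k * Dl * a)) e2; nia.
Qed.

Lemma Re_pos_of_small x : (64 * mag x <= n)%N -> 0 <= Re (chi x).
Proof.
move=> h; have h1 := chi_sub1_le R x.
have h2 : normc (1 - chi x) <= 1.
  apply: le_trans h1 _; rewrite ler_pdivrMr // mul1r -natrM ler_nat.
  by apply: leq_trans h; rewrite leq_mul2r orbT.
have := le_trans (Re_le_normc _) h2.
by case: (chi x) => a b /=; lra.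
Qed.

(** The relation [m] given by [negative_sum] is independent of the previous rows: otherwise all
    phases in its character sum would be small and the real part nonnegative. So the rank grows, and
    [weyl] makes the new form small as well. *)
Lemma stage_succ s : (s <= k)%N -> stage s -> stage s.+1.
Proof.
move=> sk [A [q [D [P [bA fA /andP[q0 qB] [qD /andP[D0 DD]] [hc hA]]]]]].
set Y := (B ^ (k + 2 - s))%N in hA.
have J0 : (0 < J)%N by rewrite expn_gt0 T0.
have Dl0 := cramer_bound_gt0.
have V0 : (0 < V)%N by rewrite expn_gt0.
have U8 : (0 < U ^ 8)%N by rewrite expn_gt0 muln_gt0 V0.
have BU : (4096 * 64 * U ^ 8 <= B)%N by exact: base_ge_u.
have B0 : (0 < B)%N by apply: leq_trans BU; rewrite muln_gt0 U8.
have YB : Y = (B * B ^ (k + 1 - s))%N by rewrite /Y -expnS; congr (B ^ _)%N; lia.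
have BY : (B <= Y)%N by rewrite YB leq_pmulr // expn_gt0 B0.
have U48 : (U ^ 4 <= U ^ 8)%N by rewrite leq_pexp2l // muln_gt0 V0.
have Y1 : (1024 * U ^ 4 <= Y)%N.
  apply: leq_trans BY; apply: leq_trans BU; apply: leq_mul => //.
have Y2 : (4 * V < Y)%N.
  have U1 : (U <= U ^ 4)%N by rewrite -{1}(expn1 U) leq_pexp2l // muln_gt0 V0.
  by apply: leq_trans Y1; move: U1 V0; move: (U ^ 4)%N V => u v; lia.
have bad e : (0 < e < Y)%N -> exists i, (n < T * mag (al i * (q * e)%N%:R ^+ 2)%R)%N.
  move=> /andP[e0 eY]; apply: nogood; rewrite muln_gt0 q0 e0 /=.
  apply: (@leq_trans (B ^ s.+1 * Y)); first by rewrite leq_mul // ltnW.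
  by rewrite /Y -expnD leq_pexp2l //; lia.
have [m bm hm] := negative_sum Y2 bad.
have Yr : 0 < Y%:R :> R by rewrite ltr0n; lia.
have Vr : 0 < V%:R :> R by rewrite ltr0n.
have notin : ~~ (map_mx (intr : int -> rat) m <= map_mx intr A)%MS.
  apply/negP => hin; have [c hc1 hc2] := hc _ bm hin.
  have : 0 <= Re (\sum_(e < Y) chi (form m * q%:R ^+ 2 * e%:R ^+ 2)).
    rewrite Re_sum; apply: sumr_ge0 => e _; apply: Re_pos_of_small.
    apply: (dependent_small (Y := Y) sk qD hc2 hc1 hA); exact: ltnW.
  by move: hm; move: (Re _) => z; nra.
have hS : Y%:R <= U%:R * normc (\sum_(e < Y) chi (form m * q%:R ^+ 2 * e%:R ^+ 2)).
  have := Re_le_normc (- \sum_(e < Y) chi (form m * q%:R ^+ 2 * e%:R ^+ 2)).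
  rewrite normc_opp natrM; move: hm; case: (\sum_(e < Y) _) => a b /=; move: (Num.sqrt _) => z; nra.
have U0 : (0 < U)%N by rewrite muln_gt0 V0.
have [q1 /andP[q10 q1U] hq1] := weyl U0 Y1 hS.
have bA' : mx_bounded J (col_mx A m).
  by move=> i j; rewrite mxE; case: splitP => i' _; [exact: bA | exact: bm].
have fA' := row_free_extend fA notin.
have [D' /andP[D'0 D'D] hc'] := cramer J0 k0 bA' fA'.
suff : stage (s + 1) by rewrite addn1.
have q2B : (q1 * D' <= B)%N.
  apply: (@leq_trans (16 * U ^ 2 * Dl)); first exact: leq_mul.
  have U28 : (U ^ 2 <= U ^ 8)%N by rewrite leq_pexp2l.
  apply: leq_trans (base_ge_du k0 Dl0 U8).
  by apply: leq_mul => //; rewrite leq_mul2l U28 orbT.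
(* Multiplying [q] by [q1] makes the new form small; the extra [D'] keeps the square divisible by
   the new denominator. *)
exists (col_mx A m), (q * (q1 * D'))%N, D', (q * q * (q1 * q1) * D')%N; split => //.
- rewrite !muln_gt0 q0 q10 D'0 /= addn1 expnSr; exact: leq_mul.
- by split; [ring | rewrite D'0].
split=> // j; rewrite (_ : (k + 2 - (s + 1) = k + 1 - s)%N); last by lia.
rewrite YB in hA hq1; case: (split_ordP j) => j' ->; rewrite ?rowKu ?rowKd ?row_id.
  have -> : form (row j' A) * (q * q * (q1 * q1) * D')%N%:R =
      (D * (q1 * q1) * D')%N%:R * (form (row j' A) * P%:R) by rewrite qD !natrM; ring.
  apply: (@leq_trans (64 * k * Dl * (D * (q1 * q1) * D' * mag (form (row j' A) * P%:R)%R) * (B ^ (k + 1 - s)) ^ 2)).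
    by rewrite leq_mul2r leq_mul2l magM !orbT.
  apply: scale_old (hA j') _ B0; apply: leq_trans (base_ge_d2 k0 Dl0 U8).
  apply: (@leq_trans (Dl * (16 * U ^ 2 * (16 * U ^ 2)) * Dl)); first by do 2!apply: leq_mul => //; exact: leq_mul.
  rewrite (_ : (Dl * (16 * U ^ 2 * (16 * U ^ 2)) * Dl = 256 * U ^ 4 * (Dl * Dl))%N); last first.
    by rewrite (expnM U 2 2); move: (U ^ 2)%N Dl => u d; ring.
  by rewrite leq_mul2r; apply/orP; right; exact: leq_mul.
have -> : form m * (q * q * (q1 * q1) * D')%N%:R =
    (q1 * D')%N%:R * (q1%:R * (form m * q%:R ^+ 2)) by rewrite !natrM; ring.
apply: (@leq_trans (64 * k * Dl * (q1 * D' * mag (q1%:R * (form m * q%:R ^+ 2))%R) * (B ^ (k + 1 - s)) ^ 2)).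
  by rewrite leq_mul2r leq_mul2l magM !orbT.
apply: scale_new hq1 _ B0.
apply: (@leq_trans (64 * k * Dl * (16 * U ^ 2 * Dl) * (256 * U ^ 6))).
  by rewrite leq_mul2r leq_mul2l leq_mul ?orbT.
rewrite /rec_base (_ : (U ^ 8 = U ^ 2 * U ^ 6)%N); last by rewrite -expnD.
by rewrite base_split.
Qed.

Lemma stages s : (s <= k.+1)%N -> stage s.
Proof. by elim: s => [_|s IH h]; [exact: stage0 | apply: stage_succ => //; apply: IH; exact: ltnW]. Qed.

Lemma no_bad_range : False.
Proof.
have [A [q [D [P [_ fA _ _ _]]]]] := stages (leqnn k.+1).
by have := rank_leq_col (map_mx (intr : int -> rat) A); rewrite (eqP fA) ltnn.
Qed.

End Recurrence.

Lemma quadratic_recurrence (R : realType) (p k T : nat) (al : 'I_k -> 'Z_p.+2) :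
  (0 < k)%N -> (0 < T)%N -> (4 * (T ^ 3).+1 ^ k <= 2 ^ T)%N ->
  exists2 d, (0 < d <= rec_base k T ^ (k + 3))%N &
    forall i, (T * mag (al i * d%:R ^+ 2)%R <= p.+2)%N.
Proof.
move=> k0 T0 TV; apply: contrapT => hn.
apply: (@no_bad_range R p k T al k0 T0 TV) => d hd.
apply: contrapT => hi; apply: hn; exists d => // i.
by rewrite leqNgt; apply/negP => h; apply: hi; exists i.
Qed.

(** * Progressions on which structured functions are almost constant *)

Section Dirichlet.
Variable p : nat.
Local Notation n := (p.+2).
Local Notation G := ('Z_n).
Local Notation mag := (@mag p).

Lemma card_below w : (#|[set y : G | (y < w)%N]| <= w)%N.
Proof.
case: w => [|w]; first by rewrite leqn0 cards_eq0; apply/eqP/setP => y; rewrite !inE.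
pose f (y : G) : 'I_w.+1 := inord y.
have fi : {in [set y : G | (y < w.+1)%N] &, injective f}.
  move=> y y'; rewrite !inE => h h' /(congr1 val); rewrite /= !inordK // => e; exact: val_inj.
by rewrite -(card_in_imset fi); apply: leq_trans (max_card _) _; rewrite card_ord.
Qed.

Lemma dirichlet k (b : 'I_k -> G) T : (0 < T)%N ->
  exists2 q, (0 < q <= T ^ k)%N & forall i, (T * mag (b i * q%:R)%R <= n)%N.
Proof.
move=> T0.
pose f (j : 'I_(T ^ k).+1) : {ffun 'I_k -> 'I_T} := [ffun i => Ordinal (arc_lt (b i * j%:R) T0)].
have : ~~ injectiveb f.
  apply/negP => /injectiveP /leq_card; rewrite card_ffun !card_ord => h.
  by move: (leq_trans (ltnSn _) h); rewrite ltnn.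
case/injectivePn => j [j' ne e].
wlog lt : j j' ne e / (j < j')%N => [hw|].
  case: (ltngtP j j') => h; [exact: hw h | apply: hw h => //; rewrite eq_sym // | ].
  by case/eqP: ne; apply: val_inj.
exists (j' - j)%N => [|i].
  by rewrite subn_gt0 lt /= (leq_trans (leq_subr _ _)) // -ltnS.
have := congr1 (fun g : {ffun 'I_k -> 'I_T} => val (g i)) e; rewrite !ffunE /= => /esym/arc_near.
by rewrite natrB ?(ltnW lt) // mulrBr.
Qed.

Lemma dirichlet_set (Th : {set G}) T : (0 < T)%N ->
  exists2 q, (0 < q <= T ^ #|Th|)%N & forall th, th \in Th -> (T * mag (th * q%:R)%R <= n)%N.
Proof.
move=> T0; have [q hq h] := dirichlet (fun i : 'I_#|Th| => enum_val i) T0.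
by exists q => // th hth; rewrite -(enum_rankK_in hth hth); exact: h.
Qed.

End Dirichlet.

Section Averaging.
Variable R : realType.

Lemma shift_error (Y : nat -> R) l m : (forall j, `|Y j| <= 1) ->
  \sum_(j < l) Y j <= \sum_(j < l) Y (j + m)%N + 2 * m%:R.
Proof.
move=> Y1; elim: m => [|m IH].
  by rewrite mulr0 addr0; apply: ler_sum => j _; rewrite addn0.
apply: le_trans IH _; rewrite -[m.+1%:R]natr1 mulrDr mulr1 addrA addrAC lerD2r.
case: l => [|l]; first by rewrite !big_ord0; lra.
rewrite big_ord_recl [in leRHS]big_ord_recr /= add0n.
have -> : \sum_(i < l) Y (i + m.+1)%N = \sum_(i < l) Y (bump 0 i + m)%N.
  by apply: eq_bigr => i _; congr Y; rewrite /bump /=; lia.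
have := Y1 m; have := Y1 (l + m.+1)%N; rewrite !ler_norml => /andP[a1 a2] /andP[b1 b2].
by move: (\sum_(i < l) _) => s; lra.
Qed.

(** Averaging over the translates by [d * s] with [s < L] changes the sum only near the two ends of
    the interval, within [d * L] of them. *)
Lemma shift_average (Y : nat -> R) (l d L : nat) (e : R) : (0 < L)%N -> (forall j, `|Y j| <= 1) ->
  (forall j, (j < l)%N -> \sum_(s < L) Y (j + d * s)%N <= L%:R * e) ->
  \sum_(j < l) Y j <= l%:R * e + 2 * (d * L)%:R.
Proof.
move=> L0 Y1 h; have Lr : 0 < L%:R :> R by rewrite ltr0n.
rewrite -(ler_pM2l Lr).
have -> : L%:R * \sum_(j < l) Y j = \sum_(s < L) \sum_(j < l) Y j by rewrite sumr_const card_ord mulr_natl.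
apply: (@le_trans _ _ (\sum_(s < L) (\sum_(j < l) Y (j + d * s)%N + 2 * (d * L)%:R))).
  apply: ler_sum => s _; apply: le_trans (shift_error _ (d * s) Y1) _.
  by rewrite lerD2l ler_pM2l // ler_nat leq_mul2l ltnW ?orbT.
rewrite big_split /= sumr_const card_ord -[X in _ + X]mulr_natl mulrDr lerD2r exchange_big /=.
apply: (@le_trans _ _ (\sum_(j < l) L%:R * e)); first by apply: ler_sum => j _; exact: h.
by rewrite sumr_const card_ord -[leLHS]mulr_natl; rewrite le_eqVlt; apply/orP; left; apply/eqP; ring.
Qed.

Lemma average_arith (l b c x k N : R) : l * b <= l * (k * N + c) ->
  N * (l * x) + l * b <= l * ((x + k) * N + c).
Proof. by lra. Qed.

End Averaging.

Lemma index_bound (j l d L s d' Z s' : nat) : (j < l -> s < L -> s' < Z -> d' * Z <= L ->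
  d * (2 * L) <= l -> j + d * (s + d' * s') < 2 * l)%N.
Proof.
move=> h1 h2 h3 h4 h5.
have h6 : (d' * s' <= L)%N by apply: leq_trans h4; rewrite leq_mul2l (ltnW h3) orbT.
have : (d * (s + d' * s') <= d * (2 * L))%N by rewrite leq_mul2l; apply/orP; right; lia.
lia.
Qed.

Lemma curvature_bound (L s d' Z s' : nat) : (s < L -> s' < Z -> d' * Z <= L ->
  2 * s * (d' * s') + (d' * s') ^ 2 <= 3 * L ^ 2)%N.
Proof.
move=> h1 h2 h3.
have h4 : (d' * s' <= L)%N by apply: leq_trans h3; rewrite leq_mul2l (ltnW h2) orbT.
by have := leq_mul h4 h4; have := leq_mul (ltnW h1) h4; rewrite -!mulnn; nia.
Qed.

Section Linearize.
Variables (R : realType) (p : nat).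
Local Notation n := (p.+2).
Local Notation G := ('Z_n).
Local Notation C := R[i].
Local Notation N := (n%:R : R).
Local Notation chi := (@chi R p).
Local Notation mag := (@mag p).
Let hchi : good_char chi := chi_good R p.
Let N0 : 0 < N. Proof. by rewrite ltr0n. Qed.

Variables (k rk rho : nat) (e : R) (S : 'I_k -> G -> R).
Hypothesis k0 : (0 < k)%N.
Hypothesis e0 : 0 <= e.
Hypothesis hS : forall i, structured rk rho e (S i).

Variables (M0 Z L l T1 : nat) (A : pred nat) (tau lip : R) (psi : G -> R).
Hypothesis nM : (n = (2 * M0).+1)%N.
Hypothesis tau01 : 0 <= tau <= 1.
Hypothesis psi01 : forall x, 0 <= psi x <= 1.
Hypothesis lip0 : 0 <= lip.
Hypothesis psiL : forall x y t, (forall i, `|S i x - S i y| <= t) -> `|psi x - psi y| <= lip * t.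
Hypothesis noinc : forall a q, (0 < a)%N -> (0 < q)%N -> (a + Z * q <= M0)%N ->
  \sum_(i < Z) (A (a + i * q)%N)%:R <= tau * Z%:R.
Hypothesis Z2 : (2 <= Z)%N.
Hypothesis hL : ((Z ^ 2) ^ k * Z * Z <= L)%N.
Local Notation T2 := (L ^ 2 * Z)%N.
Hypothesis hT2 : (4 * (T2 ^ 3).+1 ^ k <= 2 ^ T2)%N.
Hypothesis hl : (rec_base k T2 ^ (k + 3) * L * Z <= l)%N.
Hypothesis hT1 : (2 * l * n <= rho * T1)%N.
Local Notation Qm := (T1 ^ (k * rk))%N.

Definition excess (x : G) : R :=
  if (0 < x <= M0)%N then ((A x)%:R - tau) * psi x else 0.

Lemma excess_le x : `|excess x| <= 1.
Proof.
rewrite /excess; case: ifP => _; last by rewrite normr0.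
have /andP[p0 p1] := psi01 x; have /andP[t0 t1] := tau01.
rewrite normrM (ger0_norm p0) mulr_ile1 //.
by rewrite ler_norml; case: (A x) => /=; apply/andP; split; lra.
Qed.

Lemma phase_close (z : C) (u v : G) (m : nat) : normc z <= 1 -> (mag (u - v)%R * Z <= m * n)%N ->
  `|Re (z * chi u) - Re (z * chi v)| <= 16 * m%:R / Z%:R.
Proof.
move=> z1 h; rewrite -Re_sub; apply: le_trans (Re_abs_le _) _.
have -> : z * chi u - z * chi v = - (z * chi v * (1 - chi (u - v))).
  have {1}-> : u = v + (u - v) by ring.
  by rewrite (chiD hchi v (u - v)); ring.
rewrite normc_opp normcM normcM chi_norm1 mulr1.
apply: (@le_trans _ _ (normc (1 - chi (u - v)))); first by rewrite ler_piMl ?normc_ge0.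
apply: le_trans (chi_sub1_le _ _) _.
have Zr : 0 < Z%:R :> R by rewrite ltr0n; lia.
rewrite ler_pdivrMr // mulrAC ler_pdivlMr // -!mulrA ler_pM2l // -!natrM ler_nat mulnC.
by rewrite mulnC.
Qed.

(** Along step [q] the [S i] are quadratic phases; a factor [d] from quadratic recurrence makes the
    quadratic coefficients negligible, and a factor [d'] from Dirichlet, chosen for each starting
    index, the linear ones. On the resulting progressions of length [Z] the function [psi] is almost
    constant and [noinc] applies. Phases are needed up to [2 * l] because subprogressions starting
    before [l] overshoot it. *)
Lemma interior_sum (x : G) (q : nat) : (0 < q)%N -> (0 < x)%N -> (x + q * (2 * l) <= M0)%N ->
  (forall i, exists (z : C) (a1 a2 : G), normc z <= 1 /\ forall j : nat, (j < 2 * l)%N ->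
      `|S i (x + j%:R * q%:R) - Re (z * chi (a1 * j%:R + a2 * j%:R ^+ 2))| <= e) ->
  \sum_(j < l) excess (x + j%:R * q%:R) <= l%:R * (lip * (2 * e + 64 / Z%:R) + 4 / Z%:R).
Proof.
move=> q0 x0 xq hSx.
have Mn : (M0 < n)%N by rewrite nM; lia.
have Z0 : (0 < Z)%N by lia.
have Zr : 0 < Z%:R :> R by rewrite ltr0n.
have [ph hph] := @choice _ _ (fun i (t : C * G * G) => normc t.1.1 <= 1 /\ forall j : nat, (j < 2 * l)%N ->
      `|S i (x + j%:R * q%:R) - Re (t.1.1 * chi (t.1.2 * j%:R + t.2 * j%:R ^+ 2))| <= e)
  (fun i => let: ex_intro z (ex_intro a1 (ex_intro a2 h)) := hSx i in ex_intro _ (z, a1, a2) h).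
have L0 : (0 < L)%N by apply: leq_trans hL; rewrite !muln_gt0 expn_gt0 expn_gt0 Z0.
have T20 : (0 < T2)%N by rewrite muln_gt0 expn_gt0 L0.
have [d /andP[d0 dB] hd] := quadratic_recurrence R (fun i => (ph i).2) k0 T20 hT2.
have dl : (d * L * Z <= l)%N.
  by apply: leq_trans hl; rewrite leq_mul2r leq_mul2r dB !orbT.
have dl2 : (d * (2 * L) <= l)%N by apply: leq_trans dl; rewrite mulnCA mulnC leq_mul2l Z2 orbT.
pose Y j := excess (x + j%:R * q%:R).
have Y1 j : `|Y j| <= 1 by exact: excess_le.
apply: (@le_trans _ _ (l%:R * (lip * (2 * e + 64 / Z%:R) + 2 / Z%:R) + 2 * (d * L)%:R)); last first.
  have : (d * L)%:R <= l%:R / Z%:R :> R by rewrite ler_pdivlMr // -natrM ler_nat.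
  by move: (l%:R : R) (Z%:R^-1 : R) => u v; lra.
apply: (shift_average (Y := Y) L0 Y1) => j0 hj0.
(* The linear coefficient in [s] after substituting [j0 + d * s]: the quadratic term contributes
   [2 * j0 * d]. *)
pose b i := (ph i).1.2 * d%:R + (ph i).2 * (2 * j0 * d)%N%:R.
have Z20 : (0 < Z ^ 2)%N by rewrite expn_gt0 Z0.
have [d' /andP[d'0 d'B] hd'] := dirichlet b Z20.
have d'L2 : (d' * Z * Z <= L)%N by apply: leq_trans hL; rewrite !leq_mul2r d'B !orbT.
have d'L : (d' * Z <= L)%N by apply: leq_trans d'L2; rewrite leq_pmulr.
apply: (@le_trans _ _ (L%:R * (lip * (2 * e + 64 / Z%:R)) + 2 * (d' * Z)%:R)); last first.
  have : (d' * Z)%:R <= L%:R / Z%:R :> R by rewrite ler_pdivlMr // -natrM ler_nat.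
  by move: (L%:R : R) (Z%:R^-1 : R) => u v; lra.
apply: (shift_average (Y := fun s => Y (j0 + d * s)%N) Z0 (fun s => Y1 _)) => s0 hs0.
pose jj s' := (j0 + d * (s0 + d' * s'))%N.
have jl s' : (s' < Z)%N -> (jj s' < 2 * l)%N by move=> h; exact: index_bound hj0 hs0 h d'L dl2.
pose a := (x + q * jj 0%N)%N; pose st := (q * (d * d'))%N.
have aE s' : (x + q * jj s' = a + s' * st)%N by rewrite /a /st /jj; ring.
have vE s' : (s' < Z)%N -> (x + (jj s')%:R * q%:R : G) = (a + s' * st)%N :> nat.
  move=> h; have -> : x + (jj s')%:R * q%:R = (a + s' * st)%N%:R :> G.
    by rewrite -aE natrD natrM natr_val mulrC.
  rewrite val_nat modn_small // -aE.
  apply: leq_ltn_trans Mn; apply: leq_trans xq.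
  by rewrite leq_add2l leq_mul2l (ltnW (jl _ h)) orbT.
have inI s' : (s' < Z)%N -> (0 < a + s' * st <= M0)%N.
  move=> h; rewrite -aE; have := leq_mul (leqnn q) (ltnW (jl _ h)); lia.
have Scl i s' : (s' < Z)%N -> `|S i (x + (jj s')%:R * q%:R) - S i (x + (jj 0%N)%:R * q%:R)| <= 2 * e + 64 / Z%:R.
  move=> h; have [z1 hz] := hph i.
  have h1 := hz _ (jl _ h); have h2 := hz _ (jl _ Z0).
  set P1 := Re _ in h1; set P2 := Re _ in h2.
  suff h3 : `|P1 - P2| <= 64 / Z%:R.
    move: h1 h2 h3; rewrite !ler_norml => /andP[? ?] /andP[? ?] /andP[? ?]; apply/andP; split; lra.
  apply: le_trans (phase_close (m := 4) z1 _) _; last by rewrite -natrM.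
  set a1 := (ph i).1.2; set a2 := (ph i).2.
  have -> : a1 * (jj s')%:R + a2 * (jj s')%:R ^+ 2 - (a1 * (jj 0%N)%:R + a2 * (jj 0%N)%:R ^+ 2) =
     s'%:R * (b i * d'%:R) + (2 * s0 * (d' * s') + (d' * s') ^ 2)%N%:R * (a2 * d%:R ^+ 2).
    by rewrite /b -/a1 -/a2 /jj !(natrD, natrM, natrX); ring.
  apply: (@leq_trans (mag (s'%:R * (b i * d'%:R))%R * Z + mag ((2 * s0 * (d' * s') + (d' * s') ^ 2)%N%:R * (a2 * d%:R ^+ 2))%R * Z)).
    by rewrite -mulnDl leq_mul2r magD orbT.
  rewrite (_ : (4 * n = n + 3 * n)%N); last by lia.
  apply: leq_add.
    apply: (@leq_trans (Z * mag (b i * d'%:R)%R * Z)).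
      by rewrite leq_mul2r; apply/orP; right; apply: leq_trans (magM _ _) _; rewrite leq_mul2r (ltnW h) orbT.
    by apply: leq_trans (hd' i); rewrite mulnAC mulnn.
  apply: (@leq_trans (3 * L ^ 2 * mag (a2 * d%:R ^+ 2)%R * Z)).
    rewrite leq_mul2r; apply/orP; right; apply: leq_trans (magM _ _) _.
    by apply: leq_mul => //; exact: (@curvature_bound L s0 d' Z s').
  rewrite (_ : (3 * L ^ 2 * _ * Z = 3 * (L ^ 2 * Z * mag (a2 * d%:R ^+ 2)%R))%N); last by ring.
  by rewrite leq_mul2l /=; exact: hd.
set y0 := x + (jj 0%N)%:R * q%:R.
(* [psi] is frozen at its value in the first point; as this value is nonnegative, [noinc] makes the
   main term nonpositive. *)
apply: (@le_trans _ _ (\sum_(s' < Z) (((A (a + s' * st)%N)%:R - tau) * psi y0 + lip * (2 * e + 64 / Z%:R)))).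
  apply: ler_sum => s' _; have h := ltn_ord s'.
  rewrite /Y -/(jj s') /excess vE // inI //.
  have hp := psiL (fun i => Scl i s' h); rewrite -/y0 in hp.
  have /andP[t0 t1] := tau01.
  move: hp; rewrite ler_norml => /andP[hp1 hp2].
  have lt0 : 0 <= lip * (2 * e + 64 / Z%:R).
    by rewrite mulr_ge0 // addr_ge0 ?mulr_ge0 // invr_ge0.
  by move: (lip * _) (psi (x + _)) (psi y0) hp1 hp2 lt0 => w u v hp1 hp2 lt0; case: (A _) => /=; nra.
rewrite big_split /= -mulr_suml sumrB !sumr_const !card_ord -(mulr_natl (lip * _)) gerDr.
have /andP[y00 _] := psi01 y0; apply: mulr_le0_ge0 => //.
rewrite subr_le0 -(mulr_natr tau); apply: noinc; rewrite ?muln_gt0 ?q0 ?d0 ?d'0 //.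
  by have := inI 0%N Z0; rewrite mul0n addn0 => /andP[].
apply: leq_trans xq; rewrite -aE leq_add2l leq_mul2l; apply/orP; right.
rewrite /jj; have : (d * (s0 + d' * Z) <= d * (2 * L))%N by rewrite leq_mul2l; apply/orP; right; lia.
by lia.
Qed.

(** Starting points from which a progression of span [w] may leave the interval from 1 to [M0] or
    wrap around. Other starting points beyond [M0] never meet that interval and contribute
    nothing. *)
Definition edge (w : nat) : {set G} :=
  [set x : G | (x == 0) || ((x <= M0) && (M0 < x + w))%N || (n <= x + w)%N].

Lemma card_edge w : (#|edge w| <= 1 + 2 * w)%N.
Proof.
have Mn : (M0 < n)%N by rewrite nM; lia.
have sub : edge w \subset [set 0] :|: ([set x : G | ((x <= M0) && (M0 < x + w))%N] :|: [set x : G | (n <= x + w)%N]).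
  by apply/subsetP => x; rewrite !inE orbA.
apply: leq_trans (subset_leq_card sub) _; apply: leq_trans (leq_card_setU _ _) _.
rewrite cards1 leq_add2l; apply: leq_trans (leq_card_setU _ _) _; rewrite mul2n -addnn.
have inj (c : G) : injective (fun x : G => c - x) by move=> x y /addrI /oppr_inj.
apply: leq_add.
  rewrite -(card_imset _ (inj M0%:R)); apply: leq_trans _ (card_below p w).
  apply: subset_leq_card; apply/subsetP => y /imsetP[x]; rewrite !inE => /andP[h1 h2] ->.
  rewrite -(natr_val x) -natrB // val_nat modn_small; lia.
rewrite -(card_imset _ (inj n.-1%:R)); apply: leq_trans _ (card_below p w).
apply: subset_leq_card; apply/subsetP => y /imsetP[x]; rewrite !inE => h1 ->.
have := val_lt x => h2; rewrite -(natr_val x) -natrB; last by lia.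
by rewrite val_nat modn_small; lia.
Qed.

Lemma linearized_sum :
  \sum_x excess x <= (lip * (2 * e + 64 / Z%:R) + 4 / Z%:R + k%:R * e) * N + (1 + 8 * Qm * l)%:R.
Proof.
have Z0 : (0 < Z)%N by lia.
have L0 : (0 < L)%N by apply: leq_trans hL; rewrite !muln_gt0 expn_gt0 expn_gt0 Z0.
have T20 : (0 < T2)%N by rewrite muln_gt0 expn_gt0 L0.
have [d /andP[d0 dB] _] := quadratic_recurrence R (fun i : 'I_k => 0 : G) k0 T20 hT2.
have l0 : (0 < l)%N by apply: leq_trans hl; rewrite !muln_gt0 (leq_trans d0 dB) L0.
have T10 : (0 < T1)%N by case: T1 hT1; rewrite ?muln0 // leqn0 !muln_eq0; case: l l0.
have [Th [E hTE]] : exists (Th E : 'I_k -> {set G}), forall i, [/\ (#|Th i| <= rk)%N, #|E i|%:R <= e * N &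
    forall x q l, x \notin E i -> (forall th, th \in Th i -> (l * mag (th * q)%R <= rho)%N) ->
    exists (z : C) (a1 a2 : G), normc z <= 1 /\ forall j : nat, (j < l)%N ->
      `|S i (x + j%:R * q) - Re (z * chi (a1 * j%:R + a2 * j%:R ^+ 2))| <= e].
  have [Th hTh] := choice (fun i => (hS i).2); have [E hE] := choice hTh.
  by exists Th, E.
pose ThU := \bigcup_i Th i.
have cU : (#|ThU| <= k * rk)%N.
  apply: (@leq_trans (\sum_(i < k) rk)); last by rewrite sum_nat_const card_ord.
  rewrite /ThU; apply: leq_trans (_ : \sum_i #|Th i| <= _)%N.
    elim/big_rec2: _ => [|i y A' _ h]; first by rewrite cards0.
    by apply: leq_trans (leq_card_setU _ _) _; rewrite leq_add2l.
  by apply: leq_sum => i _; case: (hTE i).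
(* One step [q] serves the at most [k * rk] frequencies of all structured functions together. *)
have [q /andP[q0 qB] hq] := dirichlet_set ThU T10.
have qQ : (q <= Qm)%N by apply: leq_trans qB _; rewrite leq_pexp2l.
have hq2 i th : th \in Th i -> (2 * l * mag (th * q%:R)%R <= rho)%N.
  move=> hth; rewrite -(leq_pmul2r T10); apply: leq_trans hT1.
  rewrite -mulnA leq_mul2l [(_ * T1)%N]mulnC; apply/orP; right; apply: hq.
  by apply/bigcupP; exists i.
pose Bad := (\bigcup_i E i) :|: edge (q * (2 * l)).
pose ep := lip * (2 * e + 64 / Z%:R) + 4 / Z%:R.
have ep0 : 0 <= ep by rewrite addr_ge0 ?mulr_ge0 ?addr_ge0 ?invr_ge0 // mulr_ge0 // invr_ge0.
have cBad : #|Bad|%:R <= k%:R * e * N + (1 + 4 * (Qm * l))%:R.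
  apply: (@le_trans _ _ (#|\bigcup_i E i|%:R + #|edge (q * (2 * l))|%:R)).
    by rewrite -natrD ler_nat leq_card_setU.
  apply: lerD; last first.
    rewrite ler_nat; apply: leq_trans (card_edge _) _; rewrite leq_add2l.
    by have := leq_mul qQ (leqnn l); lia.
  apply: (@le_trans _ _ (\sum_i #|E i|%:R)).
    rewrite -natr_sum ler_nat; elim/big_rec2: _ => [|i y A' _ h]; first by rewrite cards0.
    by apply: leq_trans (leq_card_setU _ _) _; rewrite leq_add2l.
  apply: (@le_trans _ _ (\sum_(i < k) e * N)); first by apply: ler_sum => i _; case: (hTE i).
  by rewrite sumr_const card_ord -[leLHS]mulr_natl mulrA.
have loc (x : G) : \sum_(j < l) excess (x + j%:R * q%:R) <= l%:R * ep + l%:R * (x \in Bad)%:R.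
  case: (boolP (x \in Bad)) => hx.
    apply: (@le_trans _ _ (\sum_(j < l) 1)).
      by apply: ler_sum => j _; apply: le_trans (ler_norm _) (excess_le _).
    by rewrite sumr_const card_ord mulr1 lerDr mulr_ge0.
  rewrite mulr0 addr0; move: hx; rewrite !inE !negb_or negb_and -!leqNgt -!ltnNge => /and3P[hE /andP[x0 hM] hn].
  have x0' : (0 < x)%N by rewrite lt0n; apply: contra x0 => /eqP h; apply/eqP/val_inj.
  have Sx i : exists (z : C) (a1 a2 : G), normc z <= 1 /\ forall j : nat, (j < 2 * l)%N ->
      `|S i (x + j%:R * q%:R) - Re (z * chi (a1 * j%:R + a2 * j%:R ^+ 2))| <= e.
    case: (hTE i) => _ _; apply; last exact: hq2.
    by apply: contra hE => h; apply/bigcupP; exists i.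
  case/orP: hM => hM; last exact: interior_sum.
  rewrite big1 ?mulr_ge0 // => j _; rewrite /excess.
  have -> : (x + j%:R * q%:R : G) = (x + q * j)%N :> nat.
    have -> : x + j%:R * q%:R = (x + q * j)%N%:R by rewrite natrD natrM natr_val mulrC.
    have qj : (q * j <= q * (2 * l))%N by rewrite leq_mul2l; apply/orP; right; have := ltn_ord j; lia.
    by rewrite val_nat modn_small //; lia.
  by rewrite [(_ <= M0)%N]leqNgt (leq_trans hM) ?leq_addr ?andbF.
have lr : 0 < l%:R :> R by rewrite ltr0n.
rewrite -(ler_pM2l lr).
have -> : l%:R * \sum_x excess x = \sum_x \sum_(j < l) excess (x + j%:R * q%:R).
  rewrite exchange_big /= -{1}[l]card_ord mulr_natl -sumr_const; apply: eq_bigr => j _.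
  exact: (reindex_inj (addIr (j%:R * q%:R))).
apply: le_trans (ler_sum _ (fun x _ => loc x)) _.
rewrite big_split /= sumr_const card_ZN -mulr_sumr sum_mem -(mulr_natl (l%:R * ep)).
have hh : (1 + 4 * (Qm * l))%:R <= (1 + 8 * Qm * l)%:R :> R by rewrite ler_nat -mulnA; lia.
rewrite -/ep; have := ler_wpM2l (ltW lr) (le_trans cBad (lerD (lexx _) hh)).
exact: average_arith.
Qed.

End Linearize.

(** * Boosting and counting *)

Section Clamp.
Variable R : realType.

Definition clamp (r : R) : R := Num.max 0 (Num.min 1 r).

Lemma clamp01 r : 0 <= clamp r <= 1.
Proof. by rewrite /clamp /Num.max /Num.min; case: (ltP 1 r) => h1; case: ltP => h2; apply/andP; split; lra. Qed.

Lemma clamp_lip a b : `|clamp a - clamp b| <= `|a - b|.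
Proof.
rewrite /clamp /Num.max /Num.min ler_norml.
have := ler_norm (a - b); have := ler_norm (- (a - b)); rewrite normrN; move: `|a - b| => w h1 h2.
by case: (ltP 1 a) => h3; case: (ltP 1 b) => h4; do 2!case: ltP => ?; apply/andP; split; lra.
Qed.

Lemma clamp_sq f r : 0 <= f <= 1 -> (f - clamp r) ^+ 2 <= (f - r) ^+ 2.
Proof.
case/andP=> f0 f1; rewrite /clamp /Num.max /Num.min.
by case: (ltP 1 r) => h1; case: ltP => h2; nra.
Qed.

Definition posmax (r : R) : R := Num.max 0 r.

Lemma posmax_lip a b : `|posmax a - posmax b| <= `|a - b|.
Proof.
rewrite /posmax /Num.max ler_norml.
have := ler_norm (a - b); have := ler_norm (- (a - b)); rewrite normrN; move: `|a - b| => w h1 h2.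
by case: (ltP 0 a) => h3; case: (ltP 0 b) => h4; apply/andP; split; lra.
Qed.

Lemma posmax_sq r : r * posmax r = posmax r ^+ 2.
Proof. by rewrite /posmax /Num.max; case: ltP => _; rewrite ?mulr0 ?expr0n ?expr2. Qed.

Lemma posmax_ge0 r : 0 <= posmax r. Proof. by rewrite /posmax le_max lexx. Qed.
Lemma posmax_ge r : r <= posmax r. Proof. by rewrite /posmax le_max lexx orbT. Qed.

End Clamp.

Section Boost.
Variables (R : realType) (p rk rho : nat) (e kap : R).
Local Notation n := (p.+2).
Local Notation G := ('Z_n).
Local Notation N := (n%:R : R).
Hypothesis kap01 : 0 < kap <= 1.
Variables (M0 : nat) (A : pred nat).
Local Notation inI x := (0 < nat_of_ord x <= M0)%N.
Local Notation f := (fun x : G => (A x)%:R : R).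

(** An infinite family with [t] relevant members: the boosting steps fill places one by one and
    leave zeros elsewhere, so a fixed number [kk] of functions can be used at every stage. *)
Definition built t (H : G -> R) : Prop := (forall x, 0 <= H x <= 1) /\
  exists2 S : nat -> G -> R, forall i, structured rk rho e (S i) &
  forall x y u, 0 <= u -> (forall i, (i < t)%N -> `|S i x - S i y| <= u) -> `|H x - H y| <= 2 ^+ t * u.

Lemma structured0 : 0 <= e -> structured rk rho e (fun _ : G => 0).
Proof.
move=> e0; split=> [x|]; first by rewrite normr0.
exists finset.set0, finset.set0; rewrite !cards0; split=> // [|x q l _ _]; first by rewrite mulr_ge0.
by exists 0, 0, 0; rewrite normc0; split=> // j _; rewrite mul0r subr0 normr0.
Qed.

Lemma built0 : 0 <= e -> built 0 (fun _ => 0).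
Proof.
move=> e0; split=> [x|]; first by rewrite lexx ler01.
exists (fun _ _ => 0) => [i|x y u u0 _]; first exact: structured0.
by rewrite subrr normr0 expr0 mul1r.
Qed.

Lemma built_structured t H S' : built t H -> structured rk rho e S' ->
  built t.+1 (fun x => clamp (H x + kap * S' x)).
Proof.
have /andP[k0 k1] := kap01.
move=> [H01 [S hS hL]] hS'; split=> [x|]; first exact: clamp01.
exists (fun i => if i == t then S' else S i) => [i|x y u u0 hu]; first by case: eqP.
apply: le_trans (clamp_lip _ _) _.
have h1 : `|H x - H y| <= 2 ^+ t * u.
  apply: hL => // i it; have := hu i (ltnW it); by rewrite ltn_eqF.
have h2 : `|S' x - S' y| <= u by have := hu t (ltnSn t); rewrite eqxx.
have -> : H x + kap * S' x - (H y + kap * S' y) = (H x - H y) + kap * (S' x - S' y) by ring.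
apply: le_trans (ler_normD _ _) _; rewrite normrM (ger0_norm (ltW k0)) exprS.
have h3 : kap * `|S' x - S' y| <= u by apply: le_trans h2; rewrite ler_piMl.
have h4 : u <= 2 ^+ t * u by rewrite ler_peMl // exprn_ege1 // ler1n.
by move: (2 ^+ t * u) h1 h4 (mulrA 2 (2 ^+ t) u) => w h1 h4 <-; lra.
Qed.

Lemma built_self t H F : built t H -> (forall x y, `|F x - F y| <= `|H x - H y|) ->
  built t.+1 (fun x => clamp (H x + kap * F x)).
Proof.
have /andP[k0 k1] := kap01.
move=> [H01 [S hS hL]] hF; split=> [x|]; first exact: clamp01.
exists S => // x y u u0 hu; apply: le_trans (clamp_lip _ _) _.
have h1 : `|H x - H y| <= 2 ^+ t * u by apply: hL => // i it; apply: hu; exact: ltnW.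
have -> : H x + kap * F x - (H y + kap * F y) = (H x - H y) + kap * (F x - F y) by ring.
apply: le_trans (ler_normD _ _) _; rewrite normrM (ger0_norm (ltW k0)) exprS.
have h3 : kap * `|F x - F y| <= `|H x - H y| by apply: le_trans (hF x y); rewrite ler_piMl.
by move: (2 ^+ t * u) h1 (mulrA 2 (2 ^+ t) u) => w h1 <-; lra.
Qed.

Definition defect (H : G -> R) : R := \sum_(x | inI x) (f x - H x) ^+ 2.

(** Expanding the square gains twice [kap ^+ 2 * N] and costs it at most once; clamping only brings
    the values closer to [f], which lies between 0 and 1. *)
Lemma defect_drop H F : (forall x, `|F x| <= 1) -> kap * N <= \sum_(x | inI x) (f x - H x) * F x ->
  defect (fun x => clamp (H x + kap * F x)) <= defect H - kap ^+ 2 * N.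
Proof.
have /andP[k0 k1] := kap01; move=> F1 h.
apply: (@le_trans _ _ (\sum_(x | inI x) ((f x - H x) ^+ 2 - 2 * kap * ((f x - H x) * F x) + kap ^+ 2))).
  apply: ler_sum => x _; apply: le_trans (clamp_sq _ _) _; first by case: (A x) => /=; rewrite ?lexx ?ler01.
  rewrite (_ : (f x - (H x + kap * F x)) ^+ 2 = (f x - H x) ^+ 2 - 2 * kap * ((f x - H x) * F x) + kap ^+ 2 * F x ^+ 2); last by ring.
  by rewrite lerD2l ler_piMr ?sqr_ge0 // -real_normK ?num_real // exprn_ile1.
rewrite big_split /= sumrB -mulr_sumr sumr_const -/(defect H) -[X in _ + X]mulr_natl.
have hc : #|[pred x : G | inI x]|%:R <= N by rewrite ler_nat -[leqRHS](card_ZN p); exact: max_card.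
have := ler_wpM2r (sqr_ge0 kap) hc; have := ler_wpM2l (ltW k0) h.
by rewrite mulrA -expr2; lra.
Qed.

End Boost.

Lemma card_segment p m : (m < p.+2)%N -> #|[set x : 'Z_p.+2 | (0 < x <= m)%N]| = m.
Proof.
move=> mn; pose g (i : 'I_m) : 'Z_p.+2 := i.+1%:R.
have gv i : g i = i.+1 :> nat by rewrite val_nat modn_small //; have := ltn_ord i; lia.
have gi : injective g by move=> i j /(congr1 val) /=; rewrite !gv => -[] /val_inj.
rewrite -[RHS]card_ord -(card_imset _ gi) //; apply/esym; congr #|pred_of_set _|.
apply/setP => x; rewrite inE; apply/imsetP/idP => [[i _ ->]|/andP[x0 xm]].
  by rewrite gv /=; exact: ltn_ord.
have xi : (x.-1 < m)%N by lia.
exists (Ordinal xi) => //; apply: val_inj; transitivity x.-1.+1; first by rewrite prednK.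
exact: esym (gv (Ordinal xi)).
Qed.

(** * Counting progressions with difference in a prescribed set *)

Section Count.
Variables (R : realType) (p M0 : nat) (A D : pred nat).
Local Notation n := (p.+2).
Local Notation G := ('Z_n).
Local Notation N := (n%:R : R).
Hypothesis nM : (n = (2 * M0).+1)%N.
Hypothesis AI : forall x, A x -> (0 < x <= M0)%N.
Hypothesis DI : forall d, D d -> (0 < d)%N /\ (3 * d <= M0)%N.
Hypothesis free : forall x d, A x -> A (x + d)%N -> A (x + 2 * d)%N -> D d -> False.
Local Notation inI x := (0 < nat_of_ord x <= M0)%N.

Definition tri (f1 f2 f3 : G -> R) : R :=
  \sum_x \sum_(d : G) f1 x * f2 (x + d) * f3 (x + d + d) * (D d)%:R.

Local Notation f := (fun x : G => (A x)%:R : R).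

Lemma val_add_small (x d : G) m : (x + d <= m)%N -> (m < n)%N -> (x + d : G) = (x + d)%N :> nat.
Proof. by move=> h1 h2; rewrite val_add modn_small //; exact: leq_ltn_trans h2. Qed.

Lemma tri_free : tri f f f = 0.
Proof.
rewrite /tri big1 // => x _; rewrite big1 // => d _.
case hD: (D d); last by rewrite mulr0.
case hx: (A x); last by rewrite !mul0r.
have /andP[x0 xM] := AI hx; have [d0 dM] := DI hD.
have e1 : (x + d : G) = (x + d)%N :> nat by apply: (@val_add_small x d (2 * M0)); lia.
have e2 : (x + d + d : G) = (x + 2 * d)%N :> nat.
  rewrite (@val_add_small (x + d) d (2 * M0)) ?e1; lia.
rewrite e1 e2; case h1: (A (x + d)%N); last by rewrite !mulr0 !mul0r.
case h2: (A (x + 2 * d)%N); last by rewrite !mulr0 !mul0r.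
by case: (free hx h1 h2 hD).
Qed.

Variables (H : G -> R) (del : R).
Hypothesis H01 : forall x, 0 <= H x <= 1.
Hypothesis del0 : 0 <= del.
Definition cut (x : G) : R := if inI x then H x else 0.
Definition low : {set G} := [set x : G | inI x && (H x < del)].
Hypothesis clow : (18 * #|low| <= M0)%N.

Lemma cut01 x : 0 <= cut x <= 1.
Proof. by rewrite /cut; case: ifP => _; rewrite ?H01 ?lexx ?ler01. Qed.

Lemma tri_cut_ge : del ^+ 3 * (M0%:R / 6) * #|[set d : G | D d]|%:R <= tri cut cut cut.
Proof.
have c0 x : 0 <= cut x by have /andP[] := cut01 x.
rewrite /tri exchange_big /= -sum_mem mulr_sumr; apply: ler_sum => d _; rewrite inE.
case hD: (D d); last first.
  by rewrite mulr0; apply: sumr_ge0 => x _; rewrite mulr0.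
have [d0 dM] := DI hD.
(* At least [M0 / 3] starting points fit, as [3 * d <= M0]; the three translates of [low] remove at
   most [M0 / 6] of them. *)
pose X := [set x : G | (0 < x <= M0 - 2 * d)%N] :\: (low :|: ([set y - d | y in low] :|: [set y - (d + d) | y in low])).
have cX : (M0 <= 6 * #|X|)%N.
  have h1 : (#|[set x : G | (0 < x <= M0 - 2 * d)%N]| <= #|X| + 3 * #|low|)%N.
    have := cardsID (low :|: ([set y - d | y in low] :|: [set y - (d + d) | y in low])) [set x : G | (0 < x <= M0 - 2 * d)%N].
    rewrite -/X => <-; rewrite addnC leq_add2l.
    apply: leq_trans (subset_leq_card (subsetIr _ _)) _.
    apply: leq_trans (leq_card_setU _ _) _; rewrite mulSn leq_add2l.
    apply: leq_trans (leq_card_setU _ _) _; rewrite mul2n -addnn.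
    by apply: leq_add; exact: leq_imset_card.
  have Mn : (2 * M0 < n)%N by rewrite nM.
  rewrite card_segment in h1; last by lia.
  by lia.
have Xge x : x \in X -> del ^+ 3 <= cut x * cut (x + d) * cut (x + d + d).
  rewrite !inE !negb_or => /andP[/and3P[n1 n2 n3] /andP[x0 xM]].
  have e1 : (x + d : G) = (x + d)%N :> nat by apply: (@val_add_small x d (2 * M0)); lia.
  have e2 : (x + d + d : G) = (x + 2 * d)%N :> nat.
    rewrite (@val_add_small (x + d) d (2 * M0)) ?e1; lia.
  have ge y : inI y -> y \notin low -> del <= cut y.
    by rewrite /cut inE => ->; rewrite -leNgt.
  have m2 : x + d \notin low.
    by apply: contra n2 => h; apply/imsetP; exists (x + d) => //; rewrite addrK.
  have m3 : x + d + d \notin low.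
    by apply: contra n3 => h; apply/imsetP; exists (x + d + d) => //; rewrite -[x + d + d]addrA addrK.
  have g1 : del <= cut x by apply: ge; [lia | rewrite inE].
  have g2 : del <= cut (x + d) by apply: ge => //; rewrite e1; lia.
  have g3 : del <= cut (x + d + d) by apply: ge => //; rewrite e2; lia.
  by rewrite exprS expr2 mulrA; apply: ler_pM => //; [exact: mulr_ge0 | exact: ler_pM].
rewrite mulr1; apply: (@le_trans _ _ (\sum_(x in X) del ^+ 3)).
  rewrite sumr_const -[leRHS]mulr_natr ler_wpM2l ?exprn_ge0 //.
  by rewrite ler_pdivrMr // mulrC -natrM ler_nat.
rewrite [leRHS](bigID (mem X)) /= -[leLHS]addr0; apply: lerD.
  by apply: ler_sum => x xX; rewrite mulr1; exact: Xge.
by apply: sumr_ge0 => x _; rewrite mulr1 !mulr_ge0.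
Qed.

End Count.

Lemma odd_half_gt0 p M : (p.+2 = (2 * M).+1 -> 0 < M)%N. Proof. by lia. Qed.
Lemma odd_half_le3 p M : (p.+2 = (2 * M).+1 -> p.+2 <= 3 * M)%N. Proof. by lia. Qed.
Lemma odd_half_lt p M : (p.+2 = (2 * M).+1 -> M < p.+2)%N. Proof. by lia. Qed.
Lemma odd_half_inv p M : (p.+2 = (2 * M).+1 -> M.+1 * 2 = p.+2 + 1)%N. Proof. by lia. Qed.

Lemma low_arith (R : realType) (del M f H s c kap N : R) : f - H < kap * N -> del * M <= f ->
  s <= del / 100 * M -> H <= (1 + 100^-1) * del * M + s - c * (51 / 100 * del) ->
  kap * N <= kap * (3 * M) -> 300 * (200 * kap) * M <= del * M -> 0 <= del * M ->
  del * (18 * c) <= del * M.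
Proof. by lra. Qed.

Lemma step_arith (R : realType) (d N a : R) (t : nat) : d <= N - t%:R * a * N ->
  d - a * N <= N - t.+1%:R * a * N.
Proof. by rewrite -[t.+1%:R]natr1; lra. Qed.

(** * The boosting iteration and its contradiction *)

Section Core.
Variables (R : realType) (p M0 : nat) (A D : pred nat).
Local Notation n := (p.+2).
Local Notation G := ('Z_n).
Local Notation N := (n%:R : R).
Local Notation chi := (@chi R p).
Hypothesis nM : (n = (2 * M0).+1)%N.
Hypothesis AI : forall x, A x -> (0 < x <= M0)%N.
Hypothesis DI : forall d, D d -> (0 < d)%N /\ (3 * d <= M0)%N.
Hypothesis free : forall x d, A x -> A (x + d)%N -> A (x + 2 * d)%N -> D d -> False.
Local Notation inI x := (0 < nat_of_ord x <= M0)%N.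
Local Notation f := (fun x : G => (A x)%:R : R).

Variables (del Dc : R).
Hypothesis del0 : 0 < del.
Local Notation tau := ((1 + 100^-1) * del).
Hypothesis tau1 : tau <= 1.
Hypothesis densA : del * M0%:R <= \sum_(x : G | inI x) f x.
Hypothesis Dc0 : 0 < Dc.
Hypothesis densD : M0%:R <= Dc * #|[set d : G | D d]|%:R.

(** [1296 = 27 * 48]: the model has at least [(del / 2) ^ 3 * (M0 / 6) * (M0 / Dc)] progressions,
    that is [del ^ 3 * M0 ^ 2 / (48 * Dc)]; this is shared among three telescoping terms and
    normalised by [N ^ 2 <= 9 * M0 ^ 2]. *)
Definition count_loss : R := del ^+ 3 / (1296 * Dc).
Local Notation eta := (count_loss ^+ 4).
Hypothesis loss1 : count_loss <= 1.

Let N0 : 0 < N. Proof. by rewrite ltr0n. Qed.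
Let M00 : (0 < M0)%N := odd_half_gt0 nM.
Let Mr : 0 < M0%:R :> R. Proof. by rewrite ltr0n. Qed.
Let N3 : N <= 3 * M0%:R. Proof. by rewrite -natrM ler_nat; exact: odd_half_le3. Qed.
Let del1 : del <= 1. Proof. by move: tau1 del0; lra. Qed.
Let loss0 : 0 < count_loss.
Proof. by rewrite /count_loss divr_gt0 ?exprn_gt0 // mulr_gt0. Qed.

Lemma cardI : \sum_(x : G | inI x) (1 : R) = M0%:R.
Proof.
by rewrite sumr_const -[in RHS](card_segment (odd_half_lt nM)) cardsE.
Qed.

Section Density.
Variable H : G -> R.
Hypothesis H01 : forall x, 0 <= H x <= 1.
Local Notation psi := (fun x => posmax (H x - tau)).

Lemma psi01 x : 0 <= psi x <= 1.
Proof.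
rewrite posmax_ge0 /= /posmax ge_max ler01 /=; have /andP[_ h] := H01 x; move: del0; lra.
Qed.

(** Adding the bounds for the two correlations with [psi] bounds the sum of [psi ^ 2], so [H]
    exceeds [tau] very little on average. Its mean is nevertheless almost [del], and every low point
    lies at least [51 / 100 * del] below [tau]; hence low points are few. *)
Lemma low_small (kap : R) : 0 < kap -> 300 * (200 * kap) <= del ^+ 2 ->
  \sum_(x | inI x) (f x - tau) * psi x <= kap * N -> \sum_(x | inI x) (f x - H x) < kap * N ->
  - (kap * N) < \sum_(x | inI x) (f x - H x) * psi x ->
  (18 * #|low M0 H (del / 2)| <= M0)%N.
Proof.
move=> kap0 kap1 excess_sum h1 h2.
have sq : \sum_(x | inI x) psi x ^+ 2 <= 2 * kap * N.
  have -> : \sum_(x | inI x) psi x ^+ 2 = \sum_(x | inI x) (f x - tau) * psi x - \sum_(x | inI x) (f x - H x) * psi x.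
    rewrite -sumrB; apply: eq_bigr => x _; rewrite -posmax_sq; ring.
  by move: excess_sum h2; move: (\sum_(x | _) _ * _) (\sum_(x | _) (_ - tau) * _) => a b; lra.
have ps : \sum_(x | inI x) psi x <= del / 100 * M0%:R.
  have p0 : 0 <= \sum_(x | inI x) psi x by apply: sumr_ge0 => x _; exact: posmax_ge0.
  have q0 : 0 <= del / 100 * M0%:R by rewrite !mulr_ge0 // ?invr_ge0 // ltW.
  rewrite -(@ler_pXn2r _ 2) ?nnegrE //.
  apply: le_trans (sum_sq_le _ _) _.
  have -> : #|[pred x : G | inI x]|%:R = M0%:R :> R by rewrite -cardI sumr_const.
  apply: (@le_trans _ _ (M0%:R * (2 * kap * N))); first by rewrite ler_pM2l.
  have a1 : kap * N <= kap * (3 * M0%:R) by rewrite ler_pM2l.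
  have a2 := ler_wpM2l (ltW Mr) a1.
  have a3 := ler_wpM2r (mulr_ge0 (ltW Mr) (ltW Mr)) kap1.
  rewrite exprMn expr_div_n; rewrite expr2 in a3 *; move: a2 a3; rewrite expr2.
  by move: (M0%:R : R) => y; lra.
have hs : \sum_(x | inI x) H x <= \sum_(x | inI x) (tau + psi x - (x \in low M0 H (del / 2))%:R * (51 / 100 * del)).
  apply: ler_sum => x hx; have hp := posmax_ge (H x - tau); have hp0 := posmax_ge0 (H x - tau).
  rewrite inE hx /=; case: ltP => hl'; rewrite ?mul1r ?mul0r; move: del0; lra.
have cl : \sum_(x : G | inI x) (x \in low M0 H (del / 2))%:R = #|low M0 H (del / 2)|%:R :> R.
  rewrite -sum_mem [RHS](bigID (fun x : G => inI x)) /= [X in _ + X]big1 ?addr0 // => x hx.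
  by rewrite inE (negbTE hx).
rewrite sumrB big_split /= -(mulr_suml _ _ (fun x => (x \in low M0 H (del / 2))%:R)) cl in hs.
have ts : \sum_(x : G | inI x) tau = tau * M0%:R.
  by rewrite -cardI mulr_sumr; apply: eq_bigr => x _; rewrite mulr1.
rewrite ts in hs; rewrite sumrB in h1.
have a1 : kap * N <= kap * (3 * M0%:R) by rewrite ler_pM2l.
have a2 : 300 * (200 * kap) <= del by apply: le_trans kap1 _; rewrite expr2 ler_piMl // ltW.
have a3 := ler_wpM2r (ltW Mr) a2.
rewrite -(ler_nat R) natrM; set c := #|_|%:R in hs *.
rewrite -(ler_pM2l del0).
exact: low_arith h1 densA ps hs a1 a3 (mulr_ge0 (ltW del0) (ltW Mr)).
Qed.

Lemma tri_telescope (c : G -> R) :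
  tri D f f f - tri D c c c = tri D (fun x => f x - c x) c c + tri D f (fun x => f x - c x) c
    + tri D f f (fun x => f x - c x).
Proof.
rewrite /tri -!big_split -sumrB /=; apply: eq_bigr => x _.
by rewrite -!big_split -sumrB /=; apply: eq_bigr => d _; ring.
Qed.

Lemma cut_diff_le1 x : `|f x - cut M0 H x| <= 1.
Proof.
have /andP[a b] := cut01 M0 H01 x.
by rewrite ler_norml; case: (A x) => /=; apply/andP; split; lra.
Qed.

(** The model has many progressions and [f] has none, so one of the three telescoping terms is
    large; each is handled by the slot lemma for the position of the difference [g]. *)
Lemma peaks_of_low : (18 * #|low M0 H (del / 2)| <= M0)%N ->
  count_loss ^+ 4 * N <= \sum_h wt chi (fun x => f x - cut M0 H x) h (peak chi (fun x => f x - cut M0 H x) h).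
Proof.
move=> hlow; pose c := cut M0 H; pose g x := f x - c x; rewrite -/g.
have d20 : 0 <= del / 2 by move: del0; lra.
have c01 x : 0 <= c x <= 1 by exact: cut01.
have f1 x : `|f x| <= 1 by case: (A x); rewrite ?normr1 ?normr0.
have c1 x : `|c x| <= 1 by have /andP[a b] := c01 x; rewrite ger0_norm.
have g1 x : `|g x| <= 1.
  by have /andP[a b] := c01 x; rewrite /g ler_norml; case: (A x) => /=; apply/andP; split; lra.
have s1 (d : G) : `|(D d)%:R| <= 1 :> R by case: (D d); rewrite ?normr1 ?normr0.
pose half : G := M0.+1%:R.
have hh : half * (1 + 1) = 1.
  rewrite /half -[1 + 1]/(2%:R) -natrM (odd_half_inv nM).
  by rewrite natrD natr_n add0r.
have big : 3 * (count_loss * N ^+ 2) <= tri D c c c.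
  apply: le_trans (tri_cut_ge nM DI H01 d20 hlow).
  have a1 : N ^+ 2 <= 9 * M0%:R ^+ 2.
    apply: (@le_trans _ _ ((3 * M0%:R) ^+ 2)); first by rewrite lerXn2r ?nnegrE ?mulr_ge0 ?(ltW N0).
    by rewrite exprMn; lra.
  have a2 := ler_wpM2l (ltW loss0) a1.
  have a3 : count_loss * (1296 * Dc) = del ^+ 3 by rewrite divfK // gt_eqF // mulr_gt0.
  have l0 := ltW loss0.
  have a4 := ler_wpM2l (mulr_ge0 l0 (ltW Mr)) densD.
  rewrite expr_div_n; rewrite -a3.
  move: a2 a4; rewrite (_ : 2 ^+ 3 = 8 :> R); last by rewrite -natrX.
  by move: (#|_|%:R : R) (M0%:R : R) (N ^+ 2) => z y w; rewrite expr2; lra.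
have tel := tri_telescope c; rewrite (tri_free R nM AI DI free) sub0r in tel.
have cG : #|G|%:R = N by rewrite card_ZN.
rewrite -cG; have hs := chi_good R p; have L0 := ltW loss0.
case: (leP (count_loss * N ^+ 2) `|tri D g c c|) => h1.
  by apply: (slot_first hs (u := c) (s := fun d => (D d)%:R) (v := c) _ _ _ _ hh); rewrite ?cG.
case: (leP (count_loss * N ^+ 2) `|tri D f g c|) => h2.
  by apply: (slot_middle hs (u := c) (s := fun d => (D d)%:R) (v := f)); rewrite ?cG.
case: (leP (count_loss * N ^+ 2) `|tri D f f g|) => h3.
  by apply: (slot_last hs (u := f) (s := fun d => (D d)%:R) (v := f) _ _ _ _ hh); rewrite ?cG.
move: h1 h2 h3; rewrite !ltr_norml => /andP[? ?] /andP[? ?] /andP[? ?].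
by move: big tel; rewrite -/g; lra.
Qed.

End Density.

Variables (kap ee : R) (kk m rho rk : nat).
Hypothesis kap0 : 0 < kap.
Hypothesis kap1 : 300 * (200 * kap) <= del ^+ 2.
Hypothesis kap2 : kap <= peak_mass eta / 2.
Hypothesis kkk : 1 < kk%:R * kap ^+ 2.
Hypothesis ee0 : 0 < ee.
Hypothesis ee1 : 96 * ee <= peak_mass eta.
Hypothesis hm : N < (1 + ee) ^+ m.
Hypothesis hrho : 4 * (130 * (m%:R * rho%:R) + 66) <= ee * freq_radius eta ^+ 2 * N.
Hypothesis hrk : 2 <= freq_radius eta * rk%:R.

Variables (Z L l T1 : nat).
Hypothesis noinc : forall a q, (0 < a)%N -> (0 < q)%N -> (a + Z * q <= M0)%N ->
  \sum_(i < Z) (A (a + i * q)%N)%:R <= tau * Z%:R.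
Hypothesis Z2 : (2 <= Z)%N.
Hypothesis hL : ((Z ^ 2) ^ kk * Z * Z <= L)%N.
Local Notation T2 := (L ^ 2 * Z)%N.
Hypothesis hT2 : (4 * (T2 ^ 3).+1 ^ kk <= 2 ^ T2)%N.
Hypothesis hl : (rec_base kk T2 ^ (kk + 3) * L * Z <= l)%N.
Hypothesis hT1 : (2 * l * n <= rho * T1)%N.
Hypothesis herr : (2 ^+ kk * (2 * (2 * ee) + 64 / Z%:R) + 4 / Z%:R + kk%:R * (2 * ee)) * N
  + (1 + 8 * T1 ^ (kk * rk) * l)%:R <= kap * N.

Let kap01 : 0 < kap <= 1.
Proof.
rewrite kap0 /=; have h1 : del ^+ 2 <= 1 by rewrite exprn_ile1 // ltW.
apply: le_trans (le_trans kap1 h1); rewrite mulrA ler_peMl ?(ltW kap0) //.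
by rewrite -natrM ler1n.
Qed.
Let kk0 : (0 < kk)%N. Proof. by rewrite -(ltr0n R) -(@pmulr_lgt0 _ (kap ^+ 2)) ?exprn_gt0 //; exact: lt_trans ltr01 kkk. Qed.
Let e20 : 0 <= 2 * ee. Proof. by rewrite mulr_ge0 // ltW. Qed.
Let t01 : 0 <= tau <= 1. Proof. by rewrite tau1 andbT mulr_ge0 ?(ltW del0) // addr_ge0 // invr_ge0. Qed.

Section Step.
Variables (t : nat) (H : G -> R).
Hypothesis hb : built rk rho (2 * ee) t H.
Hypothesis tk : (t < kk)%N.
Local Notation psi := (fun x => posmax (H x - tau)).

Let H01 : forall x, 0 <= H x <= 1. Proof. by case: hb. Qed.

Lemma excess_sum : \sum_(x : G | inI x) (f x - tau) * psi x <= kap * N.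
Proof.
case: hb => _ [S hS hLip].
have lip0 : 0 <= 2 ^+ kk :> R by rewrite exprn_ge0.
have hpsi x y u : (forall i : 'I_kk, `|S i x - S i y| <= u) -> `|psi x - psi y| <= 2 ^+ kk * u.
  move=> h; have u0 : 0 <= u := le_trans (normr_ge0 _) (h (Ordinal kk0)).
  apply: le_trans (posmax_lip _ _) _; rewrite (_ : H x - tau - (H y - tau) = H x - H y); last by ring.
  apply: (@le_trans _ _ (2 ^+ t * u)).
    by apply: hLip => // i it; exact: (h (Ordinal (ltn_trans it tk))).
  by apply: ler_wpM2r => //; rewrite ler_eXn2l ?ltr1n // ltnW.
have := linearized_sum kk0 e20 (fun i : 'I_kk => hS i) nM t01 (psi01 H01) lip0 hpsi noinc Z2 hL hT2 hl hT1.
move=> h; apply: le_trans (le_trans h herr).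
by rewrite big_mkcond /= /excess.
Qed.

Lemma correlated : (18 * #|low M0 H (del / 2)| <= M0)%N ->
  exists2 S, structured rk rho (2 * ee) S & kap * N <= \sum_(x | inI x) (f x - H x) * S x.
Proof.
move=> hlow; have en := peaks_of_low H01 hlow.
have g1 := cut_diff_le1 H01.
have hh : M0.+1%:R * (1 + 1) = 1 :> G.
  by rewrite -[1 + 1]/(2%:R) -natrM (odd_half_inv nM) natrD natr_n add0r.
have eta0 : 0 < eta by rewrite exprn_gt0.
have eta1 : eta <= 1 by rewrite exprn_ile1 // ltW.
have [S [sS hS]] := inverse g1 hh eta0 eta1 en ee0 ee1 hm hrho hrk.
exists S => //; apply: (@le_trans _ _ (peak_mass eta / 2 * N)); first by rewrite ler_pM2r.
apply: le_trans hS _; rewrite le_eqVlt; apply/orP; left; apply/eqP.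
rewrite [RHS]big_mkcond; apply: eq_bigr => x _; rewrite /cut; case: ifP => // hx.
have -> : A x = false by apply/negP => /AI; rewrite hx.
by rewrite subr0 mul0r.
Qed.

(** The constant 1 and [- psi] are tried first: only when both fail to correlate are low points rare
    enough for the counting argument to produce a structured function. *)
Lemma boost_step : exists2 H' : G -> R, built rk rho (2 * ee) t.+1 H' &
  defect M0 A H' <= defect M0 A H - kap ^+ 2 * N.
Proof.
case: (leP (kap * N) (\sum_(x | inI x) (f x - H x))) => h1.
  exists (fun x => clamp (H x + kap * 1)).
    by apply: (built_self kap01 hb) => x y; rewrite subrr normr0.
  apply: defect_drop => // [x|]; first by rewrite normr1.
  by under eq_bigr do rewrite mulr1.
case: (leP (kap * N) (\sum_(x | inI x) (f x - H x) * - psi x)) => h2.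
  exists (fun x => clamp (H x + kap * - psi x)).
    apply: (built_self kap01 hb) => x y; rewrite -opprD normrN.
    by apply: le_trans (posmax_lip _ _) _; rewrite (_ : H x - tau - (H y - tau) = H x - H y) //; ring.
  apply: defect_drop => // x; rewrite normrN; have /andP[a b] := psi01 H01 x; by rewrite ger0_norm.
have [|S sS hS] := correlated.
  apply: (low_small kap0 kap1 excess_sum h1); rewrite -ltrN2 opprK -sumrN; apply: le_lt_trans h2.
  by rewrite le_eqVlt; apply/orP; left; apply/eqP; apply: eq_bigr => x _; rewrite mulrN.
exists (fun x => clamp (H x + kap * S x)); first exact: built_structured.
by apply: defect_drop => //; case: sS.
Qed.

End Step.

Lemma boosting t : (t <= kk)%N -> exists2 H : G -> R, built rk rho (2 * ee) t H &
  defect M0 A H <= N - t%:R * kap ^+ 2 * N.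
Proof.
elim: t => [_|t IH tk].
  exists (fun _ => 0); first by apply: built0.
  rewrite !mul0r subr0 /defect; apply: (@le_trans _ _ (\sum_(x : G | inI x) 1)).
    by apply: ler_sum => x _; rewrite subr0; case: (A x); rewrite ?expr1n ?expr0n.
  by rewrite cardI ler_nat ltnW // odd_half_lt.
have [H hb hd] := IH (ltnW tk); have [H' hb' hd'] := boost_step hb tk.
by exists H' => //; apply: le_trans hd' _; exact: step_arith hd.
Qed.

Lemma core : False.
Proof.
have [H _ hd] := boosting (leqnn kk).
have : 0 <= defect M0 A H by apply: sumr_ge0 => x _; exact: sqr_ge0.
have := kkk; rewrite -(ltr_pM2r N0) mul1r => h1 h2; move: (le_trans h2 hd) h1.
by rewrite subr_ge0 => /le_lt_trans h /h; rewrite ltxx.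
Qed.

End Core.

(** * Parameters *)

Lemma succ_cube t : (2 <= t -> (t ^ 3).+1 <= t ^ 4)%N.
Proof.
move=> t2; rewrite [in leqRHS]expnS; have := leq_mul t2 (leqnn (t ^ 3)).
have : (0 < t ^ 3)%N by rewrite expn_gt0; apply/orP; left; lia.
by move: (t ^ 3)%N (t * _)%N => x y; lia.
Qed.

Lemma sq_mul2 x y : ((2 * (x * y)) ^ 2 = 4 * (x * x) * y ^ 2)%N.
Proof. by rewrite -!mulnn; ring. Qed.

Section ParameterBounds.
Variables (k Z : nat).
Hypothesis k1000 : (1000 <= k)%N.
Hypothesis hZ : (2 ^ (40 * k) <= Z)%N.

Let k0 : (0 < k)%N. Proof. exact: leq_trans k1000. Qed.

Lemma pow_kZ (j : nat) : (j <= 40 * k -> 2 ^ j <= Z)%N.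
Proof. by move=> h; apply: leq_trans hZ; rewrite leq_exp2l. Qed.

Lemma kZ : (k <= Z)%N.
Proof. by apply: leq_trans (pow_kZ (leq_pmull k _)) => //; exact: ltnW (ltn_expl _ _). Qed.

Lemma Z_gt0 : (0 < Z)%N. Proof. exact: leq_trans kZ. Qed.

Lemma Z_ge (j : nat) : (j <= 2 ^ 20 -> j <= Z)%N.
Proof. by move=> h; apply: leq_trans h (pow_kZ _); move: k1000; lia. Qed.

Lemma leZ a b : (a <= b -> Z ^ a <= Z ^ b)%N.
Proof. by move=> h; rewrite leq_pexp2l // Z_gt0. Qed.

Lemma kpow i : (1000 * k ^ i <= k ^ i.+1)%N.
Proof. by rewrite expnS leq_mul2r k1000 orbT. Qed.

Lemma kpow_ge1 i : (0 < k ^ i)%N. Proof. by rewrite expn_gt0 k0. Qed.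

Local Notation L := (Z ^ (2 * k + 2))%N.
Local Notation T2 := (L ^ 2 * Z)%N.
Local Notation a := (3 * (4 * k + 5))%N.

Lemma T2E : T2 = (Z ^ (4 * k + 5))%N.
Proof. by rewrite -expnM -expnSr; congr (_ ^ _)%N; lia. Qed.

Lemma JE : (T2 ^ 3 = Z ^ a)%N.
Proof. by rewrite T2E -expnM mulnC. Qed.

Lemma quad_exp : (2 + (4 * k + 5) * (4 * k) <= k ^ 3)%N.
Proof.
have h := kpow 2; apply: leq_trans h; have : (1000 * k <= k ^ 2)%N := kpow 1.
by rewrite -mulnn; move: k1000; nia.
Qed.

Lemma recurrence_range : (4 * (T2 ^ 3).+1 ^ k <= 2 ^ T2)%N.
Proof.
have Z0 := Z_gt0.
have T22 : (2 <= T2)%N.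
  by rewrite T2E; apply: (@leq_trans (Z ^ 1)); [rewrite expn1 Z_ge | apply: leZ; lia].
apply: (@leq_trans (4 * (T2 ^ 4) ^ k)).
  by apply: leq_mul => //; rewrite leq_exp2r //; exact: succ_cube.
rewrite -expnM {1}T2E -expnM; apply: (@leq_trans (2 ^ 2 * (2 ^ Z) ^ ((4 * k + 5) * (4 * k)))).
  apply: leq_mul => //; rewrite leq_exp2r; first by rewrite ltnW // ltn_expl.
  by rewrite !muln_gt0 k0 addn_gt0 orbT.
rewrite -expnM -expnD leq_exp2l //; apply: (@leq_trans (Z * k ^ 3)).
  have := leq_mul (leqnn Z) quad_exp; rewrite mulnDr; have := leq_mul Z0 (leqnn 2).
  by move: (Z * (_ * _))%N (Z * k ^ 3)%N => x y; lia.
rewrite T2E; apply: (@leq_trans (Z * Z ^ 3)); first by rewrite leq_mul2l leq_exp2r // kZ orbT.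
by rewrite -expnS; apply: leZ; lia.
Qed.

Lemma fact_le_pow j : (j`! <= j ^ j)%N.
Proof.
rewrite fact_prod; apply: leq_trans (_ : \prod_(1 <= i < j.+1) j <= _)%N.
  by rewrite big_nat [leqRHS]big_nat; apply: leq_prod => i /andP[_ h]; rewrite -ltnS.
by rewrite prod_nat_const_nat subn1.
Qed.

Lemma pow_mulZ u x y : (x <= Z ^ u -> y <= Z -> x * y <= Z ^ u.+1)%N.
Proof. by move=> h1 h2; rewrite expnSr leq_mul. Qed.

Lemma cramer_le u J : (J <= Z ^ u -> cramer_bound J k <= Z ^ (1 + (u + (k + u * k))))%N.
Proof.
move=> h; rewrite /cramer_bound (expnD Z 1) (expnD Z u) (expnD Z k) expn1 (expnM Z u).
apply: leq_mul; first exact: kZ.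
apply: leq_mul => //; apply: leq_mul; last by rewrite leq_exp2r.
by apply: leq_trans (fact_le_pow _) _; rewrite leq_exp2r // kZ.
Qed.

Lemma volume_le u J : (J <= Z ^ u -> 2 * J.+1 ^ k <= Z ^ (1 + u.+1 * k))%N.
Proof.
move=> h; rewrite (expnD Z 1) expn1 (expnM Z u.+1); apply: leq_mul; first exact: Z_ge.
rewrite leq_exp2r //; apply: leq_trans (pow_mulZ (leqnn _) (Z_ge (_ : 2 <= _)%N)) => //.
have : (0 < Z ^ u)%N by rewrite expn_gt0 Z_gt0.
by move: h; move: (Z ^ u)%N => x; lia.
Qed.

Lemma rec_base_le : (rec_base k T2 <= Z ^ (k ^ 3))%N.
Proof.
have Z0 := Z_gt0.
have hD := cramer_le (eq_leq JE).
have hV := volume_le (eq_leq JE).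
have hV8 : ((2 * (T2 ^ 3).+1 ^ k) ^ 8 <= Z ^ ((1 + a.+1 * k) * 8))%N by rewrite expnM leq_exp2r.
apply: (@leq_trans (Z * Z * (Z ^ (1 + (a + (k + a * k))) * Z ^ (1 + (a + (k + a * k)))) * Z ^ ((1 + a.+1 * k) * 8))).
  apply: leq_mul => //; apply: leq_mul; last exact: leq_mul.
  apply: leq_mul; last exact: kZ.
  have -> : (4096 * 64 = 2 ^ 18)%N by rewrite -[4096%N]/(2 ^ 12)%N -[64%N]/(2 ^ 6)%N -expnD.
  by apply: pow_kZ; move: k1000; lia.
rewrite mulnn -!expnD; apply: leZ.
have h := kpow 2; apply: leq_trans h; have : (1000 * k <= k ^ 2)%N := kpow 1.
by rewrite -mulnn; move: k1000; nia.
Qed.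

Lemma length_bound : (rec_base k T2 ^ (k + 3) * L * Z <= Z ^ (k ^ 5))%N.
Proof.
have Z0 := Z_gt0.
apply: (@leq_trans (Z ^ (k ^ 3 * (k + 3)) * L * Z)).
  by rewrite leq_mul2r leq_mul2r expnM leq_exp2r ?rec_base_le ?orbT // addn3.
rewrite -expnD -expnSr; apply: leZ.
have := kpow 4; have := kpow 3; have := kpow 2; have := kpow 1; rewrite mulnDr expn1 -expnSr.
by move: (k ^ 2)%N (k ^ 3)%N (k ^ 4)%N (k ^ 5)%N k1000 => x2 x3 x4 x5; lia.
Qed.

Lemma dirichlet_range n : (Z ^ 3 <= n)%N -> (2 * Z ^ (k ^ 5) * n <= n %/ Z ^ 3 * Z ^ (k ^ 6))%N.
Proof.
have Z0 := Z_gt0; move=> hn.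
have Z3 : (0 < Z ^ 3)%N by rewrite expn_gt0 Z0.
have r0 : (0 < n %/ Z ^ 3)%N by rewrite divn_gt0.
have h1 : (n <= n %/ Z ^ 3 * Z ^ 3 * 2)%N.
  have r : (n %% Z ^ 3 < Z ^ 3)%N by rewrite ltn_mod.
  have := leq_mul r0 (leqnn (Z ^ 3)); rewrite mul1n; have := divn_eq n (Z ^ 3).
  by move: r; move: (n %/ Z ^ 3 * Z ^ 3)%N (n %% Z ^ 3)%N (Z ^ 3)%N => x y z; lia.
apply: leq_trans (leq_mul (leqnn _) h1) _.
rewrite (_ : (2 * Z ^ (k ^ 5) * (n %/ Z ^ 3 * Z ^ 3 * 2) = n %/ Z ^ 3 * (Z ^ (k ^ 5) * Z ^ 3 * 4))%N); last first.
  by move: (n %/ Z ^ 3)%N (Z ^ 3)%N (Z ^ (k ^ 5))%N => x y z; ring.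
rewrite leq_mul2l -expnD; apply/orP; right; apply: leq_trans (pow_mulZ (leqnn _) _) _; first exact: Z_ge.
apply: leZ; have := kpow 5; have := kpow_ge1 5; move: (k ^ 5)%N (k ^ 6)%N => x y; lia.
Qed.

Lemma edge_bound rk : (rk <= k)%N -> (1 + 8 * (Z ^ (k ^ 6)) ^ (k * rk) * Z ^ (k ^ 5) <= Z ^ (k ^ 9))%N.
Proof.
have Z0 := Z_gt0; move=> hr.
have h1 : ((Z ^ (k ^ 6)) ^ (k * rk) <= Z ^ (k ^ 8))%N.
  by rewrite -expnM; apply: leZ; rewrite (expnD k 6 2) leq_mul2l -mulnn leq_mul2l hr !orbT.
apply: (@leq_trans (Z ^ (k ^ 8) * Z ^ (k ^ 5) * 9)).
  have := leq_mul h1 (leqnn (Z ^ (k ^ 5))); have : (0 < Z ^ (k ^ 8) * Z ^ (k ^ 5))%N by rewrite muln_gt0 !expn_gt0 Z0.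
  rewrite -mulnA; move: (_ * Z ^ (k ^ 5))%N (_ * Z ^ (k ^ 5))%N => x y; lia.
rewrite -expnD; apply: leq_trans (pow_mulZ (leqnn _) _) _; first exact: Z_ge.
apply: leZ; have := kpow 8; have := kpow_ge1 8.
have : (k ^ 5 <= k ^ 8)%N by rewrite leq_pexp2l.
by move: (k ^ 5)%N (k ^ 8)%N (k ^ 9)%N => x y z; lia.
Qed.

Lemma radius_bound n : (Z ^ 3 <= n)%N ->
  (4 * (130 * ((2 ^ k) ^ 4 * Z * (n %/ Z ^ 3)) + 66) * (2 ^ k) ^ 5 <= n)%N.
Proof.
have Z0 := Z_gt0; move=> hn.
have hE (c j : nat) : (c <= 2 ^ k -> j < 40 -> c * (2 ^ k) ^ j <= Z)%N.
  move=> h hj; apply: (@leq_trans ((2 ^ k) ^ j.+1)); first by rewrite expnS leq_mul.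
  by rewrite -expnM; apply: pow_kZ; rewrite mulnC leq_mul2r hj orbT.
have k2 c : (c <= 2 ^ 12 -> c <= 2 ^ k)%N.
  by move=> h; apply: leq_trans h _; rewrite leq_exp2l //; apply: leq_trans k1000.
have h1 := leq_trunc_div n (Z ^ 3).
have b1 : (1040 * (2 ^ k) ^ 9 <= Z)%N by apply: hE => //; apply: k2; lia.
have b2 : (528 * (2 ^ k) ^ 5 <= Z)%N by apply: hE => //; apply: k2; lia.
have e9 : ((2 ^ k) ^ 9 = (2 ^ k) ^ 4 * (2 ^ k) ^ 5)%N by rewrite -expnD.
have z3 : (Z * Z * Z = Z ^ 3)%N by rewrite !expnS expn0 muln1 mulnA.
have b3 : (1040 * (2 ^ k) ^ 9 * (Z * (n %/ Z ^ 3)) <= n)%N.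
  apply: leq_trans h1; apply: leq_trans (leq_mul b1 (leqnn _)) _.
  by rewrite -z3; move: (n %/ _)%N => x; have := leq_pmull (Z * (Z * x)) Z0; nia.
have b4 : (528 * (2 ^ k) ^ 5 <= n)%N.
  apply: leq_trans b2 (leq_trans _ hn); rewrite -z3; have := leq_mul Z0 Z0; nia.
rewrite e9 in b3; move: b3 b4; move: ((2 ^ k) ^ 4)%N ((2 ^ k) ^ 5)%N (n %/ _)%N => x y z b3 b4.
by rewrite -(@leq_pmul2l 2) //; nia.
Qed.

(** [log Z] is at most about [2 * sqrt Z] and [k ^ 10] at most [sqrt Z / 4], so their product stays
    below [Z]. *)
Lemma log_bound N0 : (N0 < (Z.+1) ^ (k ^ 10))%N -> ((2 * N0).+1 < 2 ^ Z)%N.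
Proof.
have Z0 := Z_gt0; move=> hN; pose z := trunc_log 2 Z.
have z1 : (2 ^ z <= Z)%N by exact: trunc_logP.
have z2 : (Z < 2 ^ z.+1)%N by exact: trunc_log_ltn.
have hlog : ((z.+1) ^ 2 <= 4 * Z)%N.
  pose j := z./2; have zj := odd_double_half z.
  have h1 : (j < 2 ^ j)%N by exact: ltn_expl.
  have h2 : (2 ^ j * 2 ^ j <= Z)%N.
    by apply: leq_trans z1; rewrite -expnD addnn leq_exp2l // -[leqRHS]zj leq_addl.
  have h3 : (z.+1 <= 2 * 2 ^ j)%N by rewrite -/j in zj; case: (odd z) zj => /=; lia.
  have := leq_mul h3 h3; rewrite mulnn; lia.
have b1 : (16 * (k ^ 10 * k ^ 10) <= Z)%N.
  have h1 : (k ^ 10 <= (2 ^ k) ^ 10)%N by rewrite leq_exp2r // ltnW // ltn_expl.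
  apply: leq_trans (leq_mul (leqnn 16) (leq_mul h1 h1)) _.
  rewrite -expnD -[16%N]/(2 ^ 4)%N -expnM -expnD; apply: pow_kZ; move: k1000; lia.
have b2 : (k ^ 10 * z.+1 + 2 <= Z)%N.
  rewrite -(@leq_exp2r _ _ 2) //; apply: (@leq_trans ((2 * (k ^ 10 * z.+1)) ^ 2)).
    rewrite leq_exp2r //; have : (2 <= k ^ 10 * z.+1)%N.
      apply: (@leq_trans (2 * 1)) => //; apply: leq_mul => //.
      by apply: leq_trans (_ : k ^ 1 <= _)%N; [apply: leq_trans k1000 | rewrite leq_pexp2l].
    by move: (_ * _)%N => x; lia.
  rewrite sq_mul2; have := leq_mul (leqnn (4 * (k ^ 10 * k ^ 10))) hlog; have := leq_mul b1 (leqnn Z).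
  by rewrite -!mulnn; move: (k ^ 10 * k ^ 10)%N (z.+1 * z.+1)%N (Z * Z)%N => x y w; lia.
apply: (@leq_trans (2 ^ (k ^ 10 * z.+1 + 2))); last by rewrite leq_exp2l.
have : ((Z.+1) ^ (k ^ 10) <= 2 ^ (k ^ 10 * z.+1))%N.
  by rewrite mulnC expnM leq_exp2r // kpow_ge1.
rewrite expnD -[(2 ^ 2)%N]/4%N; move: hN; move: (2 ^ _)%N (Z.+1 ^ _)%N => x y; lia.
Qed.

Lemma final_range kp : (2 * kp <= Z)%N -> (kp * 2 * Z ^ (k ^ 9) <= Z ^ (k ^ 10))%N.
Proof.
move=> h; rewrite mulnC; apply: leq_trans (pow_mulZ (leqnn _) _) _; first by rewrite mulnC.
apply: leZ; have := kpow 9; have := kpow_ge1 9; move: (k ^ 9)%N (k ^ 10)%N => x y; lia.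
Qed.

Lemma cube_le N0 : (Z ^ (k ^ 10) <= N0 -> Z ^ 3 <= N0)%N.
Proof.
apply: leq_trans; apply: leZ; apply: leq_trans (_ : k ^ 1 <= _)%N; last by rewrite leq_pexp2l.
exact: leq_trans k1000.
Qed.

End ParameterBounds.

(** * Polynomial dependence of the inverse theorem on its parameter *)

Section PolynomialBounds.
Variable R : realType.

(** The condition [2 <= b] lets constants be absorbed into the exponent. The two classes are then
    closed under the operations building [peak_mass] and [freq_radius], and their exponents need not
    be computed. *)
Definition poly_lower (F : R -> R) := exists a : nat, forall b eta : R,
  2 <= b -> b^-1 <= eta -> eta <= 1 -> (b ^+ a)^-1 <= F eta.
Definition poly_upper (F : R -> R) := exists a : nat, forall b eta : R,
  2 <= b -> b^-1 <= eta -> eta <= 1 -> 0 < F eta <= b ^+ a.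

Let pow_gt0 (b : R) a : 2 <= b -> 0 < b ^+ a.
Proof. by move=> h; rewrite exprn_gt0 //; lra. Qed.

Lemma poly_lowerM F G : poly_lower F -> poly_lower G -> poly_lower (fun x => F x * G x).
Proof.
move=> [a ha] [c hc]; exists (a + c)%N => b eta b2 h1 h2.
by rewrite exprD invfM ler_pM ?invr_ge0 ?(ltW (pow_gt0 _ b2)) ?ha ?hc.
Qed.

Lemma poly_upperM F G : poly_upper F -> poly_upper G -> poly_upper (fun x => F x * G x).
Proof.
move=> [a ha] [c hc]; exists (a + c)%N => b eta b2 h1 h2.
have /andP[f0 f1] := ha _ _ b2 h1 h2; have /andP[g0 g1] := hc _ _ b2 h1 h2.
by rewrite mulr_gt0 // exprD ler_pM // ltW.
Qed.

Lemma poly_lower1 (c : R) : 0 < c -> poly_lower (fun _ => c).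
Proof.
move=> c0; exists (Num.truncn c^-1).+1 => b eta b2 _ _.
have ci : 0 <= c^-1 by rewrite invr_ge0 ltW.
have /andP[_ h] := truncn_itv ci.
rewrite -[leRHS]invrK lef_pV2 ?posrE ?invr_gt0 ?pow_gt0 //; apply: le_trans (ltW h) _.
apply: (@le_trans _ _ (2 ^+ (Num.truncn c^-1).+1)).
  by rewrite -natrX ler_nat ltnW // ltn_expl.
by rewrite lerXn2r ?nnegrE //; lra.
Qed.

Lemma poly_upper_inv F : poly_lower F -> poly_upper (fun x => (F x)^-1).
Proof.
move=> [a ha]; exists a => b eta b2 h1 h2; have h := ha _ _ b2 h1 h2.
have f0 : 0 < F eta by apply: lt_le_trans h; rewrite invr_gt0 pow_gt0.
by rewrite invr_gt0 f0 /= -[leRHS]invrK lef_pV2 ?posrE ?invr_gt0 ?pow_gt0.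
Qed.

Lemma poly_lower_inv F : poly_upper F -> poly_lower (fun x => (F x)^-1).
Proof.
move=> [a ha]; exists a => b eta b2 h1 h2; have /andP[f0 h] := ha _ _ b2 h1 h2.
by rewrite lef_pV2 ?posrE ?pow_gt0.
Qed.

Lemma poly_upper1 (c : R) : 0 < c -> poly_upper (fun _ => c).
Proof.
move=> c0; have ci : 0 < c^-1 by rewrite invr_gt0.
by have [a ha] := poly_upper_inv (poly_lower1 ci); exists a => b eta b2 h1 h2; have := ha b eta b2 h1 h2; rewrite invrK.
Qed.

Lemma poly_lower_id : poly_lower (fun x => x).
Proof. by exists 1%N => b eta _ h _; rewrite expr1. Qed.

Lemma poly_lowerX F m : poly_lower F -> poly_lower (fun x => F x ^+ m).
Proof.
move=> [a ha]; exists (a * m)%N => b eta b2 h1 h2.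
rewrite exprM -exprVn; apply: lerXn2r; rewrite ?nnegrE ?invr_ge0 ?(ltW (pow_gt0 _ b2)) //; last exact: ha.
by apply: le_trans (ha _ _ b2 h1 h2); rewrite invr_ge0 ltW // pow_gt0.
Qed.

Lemma poly_upperX F m : poly_upper F -> poly_upper (fun x => F x ^+ m).
Proof.
move=> [a ha]; exists (a * m)%N => b eta b2 h1 h2; have /andP[f0 h] := ha _ _ b2 h1 h2.
by rewrite exprn_gt0 //= exprM; apply: lerXn2r => //; rewrite nnegrE ltW // pow_gt0.
Qed.

Lemma model_density_poly : poly_lower (@model_density R).
Proof.
have two : 0 < 2 ^+ 47 :> R by rewrite exprn_gt0.
have dc : poly_upper (@doubling_const R).
  exact: poly_upperM (poly_upper1 two) (poly_upper_inv (poly_lowerX 24 poly_lower_id)).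
have t2 : 0 < 2 :> R by [].
have fb : poly_upper (@fibre_bound R).
  exact: poly_upperM (poly_upper1 t2) (poly_upperX 13 (poly_upperM (poly_upper1 t2) (poly_upperX 2 dc))).
have c0 : 0 < 64 * 128 :> R by rewrite mulr_gt0.
exact: poly_lowerM (poly_lowerX 3 poly_lower_id)
  (poly_lower_inv (poly_upperM (poly_upper1 c0) (poly_upperX 14 fb))).
Qed.

Lemma peak_mass_poly : poly_lower (@peak_mass R).
Proof.
have h0 : 0 < 2^-1 :> R by rewrite invr_gt0.
exact: poly_lowerM (poly_lowerX 4 (poly_lowerM poly_lower_id (poly_lower1 h0)))
  (poly_lowerX 4 model_density_poly).
Qed.

Lemma freq_radius_poly : poly_lower (@freq_radius R).
Proof.
have h16 : 0 < 16^-1 :> R by rewrite invr_gt0.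
have h12 : 0 < 12^-1 :> R by rewrite invr_gt0.
have h32 : 0 < 32^-1 :> R by rewrite invr_gt0.
have sd : poly_lower (@sym_density R).
  exact: poly_lowerM (poly_lowerM (poly_lowerX 4 poly_lower_id) (poly_lower1 h32)) model_density_poly.
exact: poly_lowerM (poly_lowerM (poly_lowerM peak_mass_poly (poly_lower1 h16)) (poly_lowerX 4 sd)) (poly_lower1 h12).
Qed.

(** [76 = 4 * 19]: the inverse theorem is applied with the fourth power of a quantity that is at
    least [K ^ -19]. *)
Lemma scales : exists a : nat, forall (K : nat) (eta : R), (2 <= K)%N ->
  (K ^ 76)%:R^-1 <= eta -> eta <= 1 ->
  (K ^ a)%:R^-1 <= peak_mass eta /\ (K ^ a)%:R^-1 <= freq_radius eta.
Proof.
have [a1 h1] := peak_mass_poly; have [a2 h2] := freq_radius_poly.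
exists (76 * (a1 + a2))%N => K eta K2 he e1.
have b2 : 2 <= (K ^ 76)%:R :> R.
  by rewrite ler_nat; apply: leq_trans (_ : K ^ 1 <= _)%N; [| rewrite leq_pexp2l // ltnW].
have mono j : (j <= a1 + a2)%N -> (K ^ (76 * (a1 + a2)))%:R^-1 <= ((K ^ 76)%:R ^+ j)^-1 :> R.
  move=> hj; rewrite -natrX -expnM lef_pV2 ?posrE ?ltr0n ?expn_gt0 ?(ltnW K2) //.
  by rewrite ler_nat leq_pexp2l ?(ltnW K2) // leq_mul2l hj orbT.
split; [apply: le_trans (h1 _ _ b2 he e1) | apply: le_trans (h2 _ _ b2 he e1)]; apply: mono.
  exact: leq_addr.
exact: leq_addl.
Qed.

End PolynomialBounds.

Section Choice.
Variables (a K : nat).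
Hypothesis K2 : (2 <= K)%N.
Local Notation kp := (K ^ (a + 20))%N.
Local Notation kk := (K ^ (2 * a + 41))%N.

Let K0 : (0 < K)%N. Proof. exact: ltnW. Qed.

(** With [kap = 1 / kp] the extra factor [K] makes [kk * kap ^+ 2] exceed 1, so [kk] boosting steps
    would exhaust the defect. *)
Lemma kk_split : kk = (kp * kp * K)%N.
Proof. by rewrite -expnD -expnSr; congr (K ^ _)%N; lia. Qed.

Lemma pow2K c j : (c <= 2 ^ j -> c <= K ^ j)%N.
Proof. by move=> h; apply: leq_trans h _; case: j => [|j] //; rewrite leq_exp2r. Qed.

Lemma leK i j : (i <= j -> K ^ i <= K ^ j)%N.
Proof. by move=> h; rewrite leq_pexp2l. Qed.

Lemma kk1000 : (1000 <= kk)%N.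
Proof. by apply: leq_trans (@pow2K 1000 10 _) (leK _) => //; lia. Qed.

Lemma kap_small : (300 * (200 * K ^ 2) <= kp)%N.
Proof.
apply: (@leq_trans (K ^ 9 * (K ^ 8 * K ^ 2))).
  by apply: leq_mul; [exact: pow2K | apply: leq_mul => //; exact: pow2K].
by rewrite -!expnD; apply: leK; lia.
Qed.

Lemma kp_half : (2 * K ^ a <= kp)%N.
Proof. by apply: (@leq_trans (K * K ^ a)); [exact: leq_mul | rewrite -expnS; apply: leK; lia]. Qed.

Lemma kp_le : (kp <= kk)%N. Proof. by apply: leK; lia. Qed.
Lemma Ka_le : (K ^ a <= kk)%N. Proof. by apply: leK; lia. Qed.
Lemma rk_le : (K ^ a.+1 <= kk)%N. Proof. by apply: leK; lia. Qed.

Lemma loss_nat : (1296 * (6 * K ^ 2) <= K ^ 16)%N.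
Proof.
apply: (@leq_trans (K ^ 11 * (K ^ 3 * K ^ 2))); last by rewrite -!expnD.
by apply: leq_mul; [exact: pow2K | apply: leq_mul => //; exact: pow2K].
Qed.

End Choice.

Section Assembly.
Variables (R : realType) (a : nat).
Hypothesis ha : forall (K : nat) (eta : R), (2 <= K)%N ->
  (K ^ 76)%:R^-1 <= eta -> eta <= 1 ->
  (K ^ a)%:R^-1 <= peak_mass eta /\ (K ^ a)%:R^-1 <= freq_radius eta.

Lemma error_arith (E Zi k kp : R) : 2 <= E -> 148 <= E ^+ 2 -> 0 < kp -> kp <= E -> 0 <= k -> k <= E ->
  0 <= Zi -> Zi <= (E ^+ 4)^-1 ->
  E * (2 * (2 * (E ^+ 4)^-1) + 64 * Zi) + 4 * Zi + k * (2 * (E ^+ 4)^-1) <= kp^-1 / 2.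
Proof.
move=> E2 E148 kp0 kpE k0 kE Z0 ZE; have E0 : 0 < E by lra.
set x := (E ^+ 4)^-1 in ZE *.
have x0 : 0 < x by rewrite invr_gt0 exprn_gt0.
have h1 : E * (2 * (2 * x) + 64 * Zi) <= E * (68 * x) by rewrite ler_pM2l //; lra.
have h2 : k * (2 * x) <= E * (2 * x) by rewrite ler_pM2r //; lra.
have h3 : x <= E * x by rewrite ler_peMl ?(ltW x0) //; lra.
have h4 : 74 * (E * x) <= kp^-1 / 2.
  apply: (@le_trans _ _ (E^-1 / 2)); last by rewrite ler_pM2r ?invr_gt0 // lef_pV2.
  have -> : E^-1 = E ^+ 2 * (E * x) by rewrite /x; field; rewrite gt_eqF.
  have y0 : 0 <= E * x by rewrite mulr_ge0 // ltW.
  by have := ler_wpM2r y0 E148; move: (E ^+ 2 * (E * x)) (E * x) => u v; lra.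
by clearbody x; lra.
Qed.

Lemma div_nat_le (c u v : nat) : (0 < u)%N -> (0 < v)%N -> (c * v <= u)%N ->
  c%:R / u%:R <= v%:R^-1 :> R.
Proof.
move=> u0 v0 h; rewrite ler_pdivrMr ?ltr0n // [leRHS]mulrC ler_pdivlMr ?ltr0n //.
by rewrite -natrM ler_nat.
Qed.

Lemma no_increment_absurd (K p N0 Z : nat) (del : R) (A D : pred nat) :
  (2 <= K)%N -> (p.+2 = (2 * N0).+1)%N ->
  (forall x, A x -> (0 < x <= N0)%N) ->
  (forall d, D d -> (0 < d)%N /\ (3 * d <= N0)%N) ->
  (forall x d, A x -> A (x + d)%N -> A (x + 2 * d)%N -> D d -> False) ->
  K%:R^-1 <= del -> (1 + 100^-1) * del <= 1 ->
  del * N0%:R <= \sum_(x : 'Z_p.+2 | (0 < nat_of_ord x <= N0)%N) (A x)%:R ->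
  N0%:R <= 6 * (K ^ 2)%:R * #|[set d : 'Z_p.+2 | D d]|%:R :> R ->
  (2 ^ (40 * K ^ (2 * a + 41)) <= Z)%N ->
  (Z ^ ((K ^ (2 * a + 41)) ^ 10) <= N0)%N -> (N0 < Z.+1 ^ ((K ^ (2 * a + 41)) ^ 10))%N ->
  (forall b q, (0 < b)%N -> (0 < q)%N -> (b + Z * q <= N0)%N ->
    \sum_(i < Z) (A (b + i * q)%N)%:R <= (1 + 100^-1) * del * Z%:R) -> False.
Proof.
move=> K2 nM AI DI free hdel tau1 densA densD hZ hN1 hN2 noinc.
have k1000 := kk1000 a K2; have ks := kk_split a K2.
have kpk := kp_le a K2; have rkk := rk_le a K2; have Kak := Ka_le a K2.
have kps := kap_small a K2; have kph := kp_half a K2.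
move: k1000 ks kpk rkk Kak hZ hN1 hN2.
move E2k : (K ^ (2 * a + 41))%N => kk k1000 ks kpk rkk Kak hZ hN1 hN2.
have K0 : (0 < K)%N by exact: ltnW.
have Kr : 0 < K%:R :> R by rewrite ltr0n.
have del0 : 0 < del by apply: lt_le_trans hdel; rewrite invr_gt0.
have del1 : del <= 1 by move: tau1 del0; clear; lra.
have Dc0 : 0 < 6 * (K ^ 2)%:R :> R by rewrite mulr_gt0 // ltr0n expn_gt0 K0.
have Zn : (Z ^ 3 <= p.+2)%N.
  by apply: leq_trans (cube_le k1000 hZ hN1) _; rewrite nM -add1n mul2n -addnn addnA leq_addl.
have lossE : count_loss del (6 * (K ^ 2)%:R) = del ^+ 3 / (1296 * (6 * K ^ 2))%N%:R.
  by rewrite /count_loss !natrM.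
have lossL : (K ^ 19)%:R^-1 <= count_loss del (6 * (K ^ 2)%:R).
  rewrite lossE; apply: (@le_trans _ _ ((K%:R ^- 3) * (K ^ 16)%:R^-1)).
    by rewrite -invfM -natrX -natrM -expnD.
  apply: ler_pM; rewrite ?invr_ge0 ?exprn_ge0 //.
    by rewrite -exprVn lerXn2r ?nnegrE ?invr_ge0 // ltW.
  rewrite lef_pV2 ?posrE ?ltr0n ?muln_gt0 ?expn_gt0 ?K0 // ler_nat; exact: loss_nat.
have loss0 : 0 < count_loss del (6 * (K ^ 2)%:R).
  by apply: lt_le_trans lossL; rewrite invr_gt0 ltr0n expn_gt0 K0.
have loss1 : count_loss del (6 * (K ^ 2)%:R) <= 1.
  rewrite lossE ler_pdivrMr ?ltr0n ?muln_gt0 ?expn_gt0 ?K0 // mul1r.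
  apply: (@le_trans _ _ 1); first by rewrite exprn_ile1 // ltW.
  by rewrite ler1n !muln_gt0 ?expn_gt0 ?K0.
move: lossL loss0 loss1; set loss := count_loss _ _ => lossL loss0 loss1.
have etaL : (K ^ 76)%:R^-1 <= loss ^+ 4.
  rewrite (expnM K 19 4) natrX -exprVn lerXn2r ?nnegrE ?invr_ge0 //; exact: ltW.
have eta1 : loss ^+ 4 <= 1 by rewrite exprn_ile1 // ltW.
have [hpk hfr] := ha K2 etaL eta1.
set kp := (K ^ (a + 20))%N in ks kpk kps kph.
have kp0 : (0 < kp)%N by rewrite expn_gt0 K0.
have kpr : 0 < kp%:R :> R by rewrite ltr0n.
have Ka0 : 0 < (K ^ a)%:R :> R by rewrite ltr0n expn_gt0 K0.
(* The Lipschitz constant of the model after all steps; the error [ee = E ^ -4] of the structured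
   functions is chosen small against it. *)
pose E := (2 ^ kk)%N.
have E0 : 0 < E%:R :> R by rewrite ltr0n expn_gt0.
have kE : (kk <= E)%N by rewrite ltnW // ltn_expl.
have E1000 : (1000 <= E)%N by exact: leq_trans kE.
have EZ : (E ^ 4 <= Z)%N.
  by apply: leq_trans hZ; rewrite -expnM leq_exp2l // mulnC leq_mul2r orbT.
have E40 : (0 < E ^ 4)%N by rewrite !expn_gt0.
pose ee : R := (E ^ 4)%:R^-1.
have Z0 := Z_gt0 k1000 hZ.
apply: (@core R p N0 A D nM AI DI free del (6 * (K ^ 2)%:R) del0 tau1 densA Dc0 densD loss1
  kp%:R^-1 ee kk (E ^ 4 * Z)%N (p.+2 %/ Z ^ 3)%N (K ^ a.+1)%N _ _ _ _ _ _ _ _ _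
  Z (Z ^ (2 * kk + 2))%N (Z ^ (kk ^ 5))%N (Z ^ (kk ^ 6))%N noinc _ _ _ _ _ _).
- by rewrite invr_gt0.
- apply: (@le_trans _ _ (K%:R ^- 2)); last first.
    by rewrite -exprVn lerXn2r ?nnegrE ?invr_ge0 // ltW.
  rewrite mulrA -natrM -natrX; apply: div_nat_le; rewrite // ?expn_gt0 ?K0 //.
  by rewrite -mulnA.
- rewrite ler_pdivlMr // mulrC; apply: le_trans hpk.
  by apply: div_nat_le; rewrite // expn_gt0 K0.
- have -> : kk%:R * kp%:R^-1 ^+ 2 = K%:R :> R by rewrite ks !natrM; field; rewrite gt_eqF.
  by rewrite ltr1n.
- by rewrite invr_gt0 ltr0n.
- apply: le_trans hpk; rewrite -/ee /ee ler_pdivrMr ?ltr0n // mulrC ler_pdivlMr // -natrM ler_nat.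
  apply: (@leq_trans (E * E)); first by rewrite mulnC leq_mul // ?(leq_trans Kak kE) // (leq_trans _ E1000).
  by rewrite mulnn leq_pexp2l // expn_gt0.
(* By Bernoulli's inequality [E ^ 4] factors [1 + ee] reach 2, so [m = E ^ 4 * Z] of them reach
   [2 ^ Z], which exceeds the modulus. *)
- rewrite exprM; apply: (@lt_le_trans _ _ (2 ^+ Z)).
    by rewrite -natrX ltr_nat nM; exact: log_bound k1000 hZ _ hN2.
  by rewrite lerXn2r ?nnegrE ?exprn_ge0 ?addr_ge0 ?invr_ge0 //; exact: bernoulli_two.
- have h := radius_bound k1000 hZ Zn; rewrite -/E in h.
  have E5 : 0 < (E ^ 5)%:R :> R by rewrite ltr0n expn_gt0 expn_gt0.
  apply: (@le_trans _ _ ((E ^ 5)%:R^-1 * p.+2%:R)).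
    rewrite [leRHS]mulrC ler_pdivlMr //; move: h; rewrite -(ler_nat R) !(natrM, natrD).
    by [].
  rewrite ler_wpM2r // (_ : (E ^ 5 = E ^ 4 * E)%N); last by rewrite -expnSr.
  rewrite natrM invfM ler_wpM2l ?invr_ge0 //.
  apply: (@le_trans _ _ ((K ^ a)%:R^-1 ^+ 2)); last by rewrite lerXn2r ?nnegrE ?invr_ge0 // ltW // (lt_le_trans _ hfr) // invr_gt0.
  rewrite exprVn lef_pV2 ?posrE ?exprn_gt0 // -natrX ler_nat; apply: leq_trans kE.
  rewrite ks -mulnn; apply: leq_trans (leq_pmulr _ K0); apply: leq_mul; apply: leq_trans kph; exact: leq_pmull.
- apply: (@le_trans _ _ ((K ^ a)%:R^-1 * (K ^ a.+1)%:R)); last by rewrite ler_wpM2r.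
  by rewrite expnS natrM mulrCA mulVf ?gt_eqF // mulr1 ler_nat.
- exact: Z_ge k1000 hZ _ _.
- by rewrite -expnM -!expnSr leq_eqVlt; apply/orP; left; apply/eqP; congr (Z ^ _)%N; clear; lia.
- exact: recurrence_range k1000 hZ.
- exact: length_bound k1000 hZ.
- exact: dirichlet_range k1000 hZ _ Zn.
have N0r : 0 < p.+2%:R :> R by rewrite ltr0n.
have eb := edge_bound k1000 hZ rkk.
have kpZ : (2 * kp <= Z)%N.
  apply: leq_trans EZ; apply: (@leq_trans (E * E)); last by rewrite mulnn leq_pexp2l // expn_gt0.
  by apply: leq_mul; [exact: leq_trans E1000 | exact: leq_trans kpk kE].
have fr := final_range k1000 hZ kpZ.
have last : (1 + 8 * (Z ^ (kk ^ 6)) ^ (kk * K ^ a.+1) * Z ^ (kk ^ 5))%:R <= kp%:R^-1 / 2 * p.+2%:R :> R.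
  have -> : kp%:R^-1 / 2 * p.+2%:R = p.+2%:R / (kp * 2)%N%:R :> R by rewrite natrM; field; rewrite gt_eqF.
  rewrite ler_pdivlMr ?ltr0n ?muln_gt0 ?kp0 // -natrM ler_nat.
  apply: leq_trans (_ : kp * 2 * Z ^ (kk ^ 9) <= _)%N.
    by rewrite mulnC leq_mul2l eb orbT.
  apply: leq_trans fr (leq_trans hN1 _); rewrite nM -addn1 mul2n -addnn -addnA; exact: leq_addr.
have Er : E%:R = 2 ^+ kk :> R by rewrite natrX.
have hea := @error_arith E%:R Z%:R^-1 kk%:R kp%:R _ _ kpr _ _ _ _ _.
rewrite -Er; have -> : kp%:R^-1 * p.+2%:R = kp%:R^-1 / 2 * p.+2%:R + kp%:R^-1 / 2 * p.+2%:R :> R by field; rewrite gt_eqF.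
apply: lerD last; apply: ler_wpM2r => //; rewrite /ee natrX; apply: hea.
- by rewrite ler_nat; apply: leq_trans E1000.
- rewrite -natrX ler_nat; apply: (@leq_trans (E ^ 1)); first exact: leq_trans E1000.
  by rewrite leq_pexp2l // expn_gt0.
- by rewrite ler_nat; exact: leq_trans kpk kE.
- by [].
- by rewrite ler_nat.
- by rewrite invr_ge0.
- by rewrite -natrX lef_pV2 ?posrE ?ltr0n // ler_nat.
Qed.

End Assembly.

(** * Passing from sets of integers to the cyclic group *)

Section Translation.

Lemma root_exists (b n : nat) : (0 < b)%N -> exists2 z, (z ^ b <= n)%N & (n < z.+1 ^ b)%N.
Proof.
move=> b0.
have e0 : exists i, (i ^ b <= n)%N by exists 0%N; rewrite exp0n.
have ub i : (i ^ b <= n)%N -> (i <= n)%N.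
  by apply: leq_trans; case: i => // i; rewrite -{1}(expn1 i.+1) leq_pexp2l.
case: (ex_maxnP e0 ub) => z hz hmax; exists z => //.
by rewrite ltnNge; apply/negP => /hmax; rewrite ltnn.
Qed.

Lemma fset_count (p : nat) (A : {fset nat}) : (forall x, x \in A -> (x < p.+2)%N) ->
  (#|` A| <= #|[set x : 'Z_p.+2 | nat_of_ord x \in A]|)%N.
Proof.
move=> hA; rewrite cardE -(size_map (@nat_of_ord p.+2)).
apply: uniq_leq_size; first exact: fset_uniq.
move=> x xA; have hx := hA x xA; apply/mapP; exists (x%:R : 'Z_p.+2).
  by rewrite mem_enum inE val_nat modn_small.
by rewrite val_nat modn_small.
Qed.

Lemma prog_uniq b q Z : (0 < q)%N -> uniq [seq (b + i * q)%N | i <- iota 0 Z].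
Proof.
move=> q0; rewrite map_inj_uniq ?iota_uniq // => i j /addnI/eqP.
by rewrite eqn_pmul2r // => /eqP.
Qed.

Lemma prog_mem b q Z : [fset (b + i * q)%N | i in iota 0 Z]%fset =i [seq (b + i * q)%N | i <- iota 0 Z].
Proof.
move=> x; apply/imfsetP/mapP => [[i hi ->]|[i hi ->]]; first by exists i.
by exists i.
Qed.

Lemma prog_card b q Z : (0 < q)%N -> #|` [fset (b + i * q)%N | i in iota 0 Z]%fset| = Z.
Proof.
move=> q0; rewrite -[RHS](size_iota 0 Z) -(size_map (fun i => b + i * q)%N (iota 0 Z)).
apply: perm_size; apply: uniq_perm; [exact: fset_uniq | exact: prog_uniq | exact: prog_mem].
Qed.

Lemma prog_meet_card (A : {fset nat}) b q Z : (0 < q)%N ->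
  #|` (A `&` [fset (b + i * q)%N | i in iota 0 Z])%fset| = (\sum_(i < Z) ((b + i * q)%N \in A))%N.
Proof.
move=> q0; transitivity (size [seq x <- [seq (b + i * q)%N | i <- iota 0 Z] | x \in A]).
  apply: perm_size; apply: uniq_perm; first exact: fset_uniq.
    by rewrite filter_uniq // prog_uniq.
  by move=> x; rewrite in_fsetI mem_filter prog_mem.
rewrite size_filter -sum1_count big_map big_mkcond /= -(big_mkord xpredT (fun i => (b + i * q)%N \in A : nat)).
by rewrite /index_iota subn0; apply: eq_bigr => i _; case: (_ \in A).
Qed.

(** For each [m] up to [N0 / (3 M)] pick [t <= M] with [m * t] in [S]. The pair of [m * t] and [t]
    determines [m], so at most [M] values of [m] share a product. *)
Lemma syndetic_card (p M N0 : nat) (S : set nat) (D : pred nat) : (0 < M)%N -> mult_syndetic M S ->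
  (forall d, S d -> (0 < d)%N -> (3 * d <= N0)%N -> D d) -> (3 * M <= N0)%N -> (N0 < p.+2)%N ->
  (N0 <= 6 * (M ^ 2) * #|[set d : 'Z_p.+2 | D d]|)%N.
Proof.
move=> M0 hS hD MN Np; pose Q := (N0 %/ (3 * M))%N.
have ex m : exists t : nat, (0 < m)%N -> (1 <= t <= M)%N /\ S (m * t)%N.
  case: (posnP m) => [->|m0]; first by exists 0%N.
  by have [t h] := hS m m0; exists t.
have [t ht] := choice ex.
have Q0 : (0 < Q)%N by rewrite divn_gt0 // muln_gt0.
have QN : (Q * (3 * M) <= N0)%N by exact: leq_trunc_div.
have dP (i : 'I_Q) : [/\ (0 < i.+1 * t i.+1)%N, (3 * (i.+1 * t i.+1) <= N0)%N & S (i.+1 * t i.+1)%N].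
  have [/andP[t1 t2] hs] := ht i.+1 (ltn0Sn i); split=> //; first by rewrite muln_gt0.
  by apply: leq_trans QN; have := leq_mul (ltn_ord i) t2; lia.
have tP (i : 'I_Q) : ((t i.+1).-1 < M)%N by have [/andP[t1 t2] _] := ht i.+1 (ltn0Sn i); lia.
pose f (i : 'I_Q) : 'Z_p.+2 * 'I_M := ((i.+1 * t i.+1)%N%:R, Ordinal (tP i)).
have fi : injective f.
  move=> i j [e1 e2]; have [a1 a2 _] := dP i; have [b1 b2 _] := dP j.
  have [/andP[t1 _] _] := ht i.+1 (ltn0Sn i); have [/andP[t2 _] _] := ht j.+1 (ltn0Sn j).
  have e3 : t i.+1 = t j.+1 by lia.
  have := congr1 (@nat_of_ord _) e1; rewrite !val_nat !modn_small; try lia.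
  rewrite -e3 => /eqP; rewrite eqn_pmul2r // => /eqP -[] h; exact: val_inj.
have cQ : (Q <= #|[set d : 'Z_p.+2 | D d]| * M)%N.
  rewrite -{1}(card_ord Q) -cardsT -(card_imset _ fi).
  have -> : (#|[set d : 'Z_p.+2 | D d]| * M = #|setX [set d : 'Z_p.+2 | D d] [set: 'I_M]|)%N.
    by rewrite cardsX cardsT card_ord.
  apply: subset_leq_card; apply/subsetP => x /imsetP[i _ ->]; rewrite !inE andbT /=.
  have [a1 a2 a3] := dP i; rewrite val_nat modn_small; last by lia.
  exact: hD.
have r : (N0 %% (3 * M) < 3 * M)%N by rewrite ltn_mod muln_gt0.
have e := divn_eq N0 (3 * M); rewrite -/Q in e.
have h1 : (N0 <= 2 * (Q * (3 * M)))%N by have := leq_mul Q0 (leqnn (3 * M)); lia.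
apply: leq_trans h1 _; have := leq_mul cQ (leqnn (6 * M)); rewrite -mulnn.
by move: #|_| => c; nia.
Qed.

End Translation.

Section Constants.
Variable R : realType.

Lemma two_pow_le_exp (x : nat) : (2 ^ x)%:R <= expR (x%:R : R).
Proof.
rewrite -[x%:R]mulr1 expRM_natl natrX; apply: lerXn2r; rewrite ?nnegrE ?expR_ge0 //.
by have := expR_ge1Dx (1 : R); lra.
Qed.

Lemma root_le (N0 Z b : nat) : (0 < b)%N -> (N0 < Z.+1 ^ b)%N -> N0%:R `^ (b%:R^-1) <= Z.+1%:R :> R.
Proof.
move=> b0 h; have br : b%:R != 0 :> R by rewrite pnatr_eq0 -lt0n.
apply: (@le_trans _ _ ((Z.+1 ^ b)%:R `^ (b%:R^-1))).
  by apply: ge0_ler_powR; rewrite ?invr_ge0 ?nnegrE ?ler_nat // ltnW.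
by rewrite natrX -powR_mulrn // -powRrM mulfV // powRr1.
Qed.

End Constants.

Local Open Scope classical_set_scope.
Local Open Scope ring_scope.

Theorem theorem4p8 (R : realType) :
  exists C0 C c c' : R,
    [/\ 1 < C0, 0 < C, 0 < c & 0 < c'] /\
    forall (M N : nat) (delta : R) (A : {fset nat}) (S : set nat),
      (2 <= M)%N -> (0 < N)%N -> 0 < delta ->
      [set` A] `<=` initseg (N%:R : R) ->
      delta * N%:R <= (#|` A|)%:R ->
      S `<=` posint ->
      mult_syndetic M S ->
      ~ (exists x d : nat,
          x \in A /\ (S `&` initseg (N%:R / 3 : R)) d /\
          [set x; (x + d)%N; (x + 2 * d)%N] `<=` [set` A]) ->
      expR (C0 * delta `^ (- C0) * M%:R `^ C0) < N%:R ->
      exists P : {fset nat},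
        [/\ arith_prog P,
            [set` P] `<=` initseg (N%:R : R),
            c' * N%:R `^ (c * delta `^ C * M%:R `^ (- C)) <= (#|` P|)%:R
          & (1 + c) * delta <= (#|` (A `&` P)%fset|)%:R / (#|` P|)%:R].
Proof.
have [a ha] := scales R.
pose b1 := (2 * a + 41)%N; have b10 : (0 < b1)%N by rewrite addn_gt0 orbT.
(* With [X = M / delta], [K <= X ^+ 3] and [kk = K ^ b1], the factors [36 = 3 * 12] and
   [30 = 3 * 10] come from the requirement [2 ^ (kk ^ 12) <= N] and from the root of order [kk ^ 10]
   of [N]. The constant [2^-1] pays for rounding that root down. *)
exists (36 * b1)%N%:R, (30 * b1)%N%:R, 100^-1, 2^-1; split.
  by split; rewrite ?ltr0n ?invr_gt0 ?muln_gt0 // ltr1n (leq_trans _ (leq_pmulr 36 b10)).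
move=> M N delta A S M2 N0 d0 AI cA Spos hS hfree hN.
have AI' x : x \in A -> (0 < x <= N)%N.
  by move=> xA; have [h1 h2] := AI x xA; rewrite h1 /= -(ler_nat R).
have Nr : 0 < N%:R :> R by rewrite ltr0n.
have Mr : 2 <= M%:R :> R by rewrite ler_nat.
have cAN : (#|` A| <= N)%N.
  have := uniq_leq_size (fset_uniq A) (_ : {subset A <= iota 1 N}); rewrite size_iota; apply.
  by move=> x /AI'; rewrite mem_iota add1n ltnS.
have d1 : delta <= 1.
  by rewrite -(ler_pM2r Nr) mul1r; apply: le_trans cA _; rewrite ler_nat.
pose X : R := M%:R / delta.
have X2 : 2 <= X by rewrite ler_pdivlMr //; nra.
have X0 : 0 < X by lra.
have MX : M%:R <= X by rewrite ler_pdivlMr //; nra.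
have dX : delta^-1 <= X by rewrite ler_pdivlMr // mulVf ?gt_eqF //; lra.
pose K := (Num.truncn (2 * X)).+1.
have X20 : 0 <= 2 * X by lra.
have /andP[tr1 tr2] := truncn_itv X20.
have KE : K%:R = (Num.truncn (2 * X))%:R + 1 :> R by rewrite natr1.
have K2 : (2 <= K)%N by rewrite -(ler_nat R); apply: ltW; apply: le_lt_trans tr2; lra.
have MK : (M <= K)%N by rewrite -(ler_nat R); apply: ltW; apply: le_lt_trans tr2; lra.
have KX : K%:R <= X ^+ 3.
  rewrite KE; apply: (@le_trans _ _ (3 * X)); first by lra.
  have h4 : 4 <= X ^+ 2 by nra.
  by rewrite exprSr; have := ler_wpM2r (ltW X0) h4; lra.
have KXn j : (K ^ j)%:R <= X ^+ (3 * j).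
  by rewrite natrX exprM; apply: lerXn2r; rewrite ?nnegrE ?exprn_ge0 // ltW.
have XE j : delta `^ (- j%:R) * M%:R `^ j%:R = X ^+ j.
  rewrite powRN !powR_mulrn ?(ltW d0) // /X exprMn exprVn mulrC //.
have XE2 j : delta `^ j%:R * M%:R `^ (- j%:R) = X ^- j.
  by rewrite powRN !powR_mulrn ?(ltW d0) // /X exprMn exprVn invfM invrK mulrC.
pose kk := (K ^ b1)%N; pose bb := (kk ^ 10)%N.
have k1000 : (1000 <= kk)%N := kk1000 a K2.
have kk0 : (0 < kk)%N by exact: leq_trans k1000.
have bb0 : (0 < bb)%N by rewrite expn_gt0 kk0.
have Nbig : (2 ^ (kk ^ 12) <= N)%N.
  rewrite -(ler_nat R); apply: le_trans (two_pow_le_exp R _) (ltW (le_lt_trans _ hN)).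
  rewrite ler_expR -mulrA XE; apply: (@le_trans _ _ (X ^+ (36 * b1))).
    apply: le_trans (_ : (K ^ (12 * b1))%:R <= _); first by rewrite mulnC expnM.
    by apply: le_trans (KXn _) _; rewrite mulnA.
  by rewrite ler_peMl ?exprn_ge0 ?(ltW X0) // ler1n muln_gt0 b10.
have [Z hZ1 hZ2] := root_exists N bb0.
have hZ : (2 ^ (40 * kk) <= Z)%N.
  (* Otherwise [Z.+1 ^ bb] would be at most [2 ^ (40 * kk ^ 11)], hence at most [2 ^ (kk ^ 12)]
     because [40 <= kk], contradicting the maximality of the root. *)
  rewrite leqNgt; apply/negP => lt; suff : (Z.+1 ^ bb <= N)%N by rewrite leqNgt hZ2.
  apply: (@leq_trans ((2 ^ (40 * kk)) ^ bb)); first by rewrite leq_exp2r.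
  apply: leq_trans Nbig; rewrite -expnM leq_exp2l // /bb -mulnA -expnS (expnS kk 11).
  by rewrite leq_mul2r (leq_trans _ k1000) ?orbT.
have Z0 : (0 < Z)%N := Z_gt0 k1000 hZ.
have N3M : (3 * M <= N)%N.
  apply: leq_trans (cube_le k1000 hZ hZ1).
  rewrite (expnS Z 2); apply: leq_mul; first exact: Z_ge k1000 hZ _ _.
  have kZ' : (kk <= Z)%N := kZ hZ.
  have Kkk : (K <= kk)%N by rewrite /kk -{1}(expn1 K) leq_pexp2l ?(ltnW K2).
  apply: leq_trans MK (leq_trans Kkk (leq_trans kZ' _)).
  by rewrite -{1}(expn1 Z) leq_pexp2l.
apply: contrapT => hnoP.
pose p := (2 * N).-1.
have nM : (p.+2 = (2 * N).+1)%N by rewrite /p prednK // muln_gt0.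
pose D : pred nat := fun d => `[< S d >] && ((0 < d)%N && (3 * d <= N)%N).
(* The cap keeps [(1 + 100^-1) * del] at most 1, as the boosting argument requires. *)
pose del : R := Num.min delta (100 / 101).
have del_le : del <= delta by rewrite ge_min lexx.
apply: (@no_increment_absurd R a ha K p N Z del (fun x => x \in A) D K2 nM AI').
- by move=> d /andP[_ /andP[]].
- move=> x d xA xdA x2dA /andP[/asboolP Sd /andP[dp d3]]; apply: hfree; exists x, d; split=> //; split.
    split=> //; split=> //; rewrite ler_pdivlMr // mulrC -natrM ler_nat //.
  by move=> y [[->|->]|->].
- rewrite le_min; apply/andP; split.
    rewrite -[leRHS]invrK lef_pV2 ?posrE ?invr_gt0 ?ltr0n //.
    by apply: ltW; apply: le_lt_trans tr2; lra.
  apply: (@le_trans _ _ (2^-1)); last by lra.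
  by rewrite lef_pV2 ?posrE ?ltr0n // ler_nat.
- have : del <= 100 / 101 by rewrite ge_min lexx orbT.
  lra.
- apply: (@le_trans _ _ (#|` A|%:R)).
    by apply: le_trans cA; rewrite ler_pM2r.
  apply: (@le_trans _ _ (#|[set x : 'Z_p.+2 | nat_of_ord x \in A]%SET|%:R)).
    rewrite ler_nat; apply: fset_count => x /AI'/andP[_ xN]; exact: leq_ltn_trans xN (odd_half_lt nM).
  rewrite -sum_mem [leRHS]big_mkcond; apply: ler_sum => x _; rewrite inE.
  by case: ifP => // hx; case hA: (_ \in A) => //; move: (AI' _ hA); rewrite hx.
- rewrite -!natrM ler_nat; apply: (@leq_trans (6 * M ^ 2 * #|[set d : 'Z_p.+2 | D d]%SET|)).
    apply: (@syndetic_card p M N S D) => //; first exact: ltnW.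
      by move=> d Sd dp d3; rewrite /D dp d3 andbT andbT; apply/asboolP.
    exact: odd_half_lt.
  by rewrite leq_mul2r; apply/orP; right; rewrite leq_mul2l leq_exp2r // MK orbT.
- exact: hZ.
- exact: hZ1.
- exact: hZ2.
move=> b q bp q0 hbq; rewrite leNgt; apply/negP => lt; apply: hnoP.
pose P := [fset (b + i * q)%N | i in iota 0 Z]%fset.
have cP : #|` P| = Z by exact: prog_card.
have cAP : #|` (A `&` P)%fset|%:R = \sum_(i < Z) ((b + i * q)%N \in A)%:R :> R.
  by rewrite prog_meet_card // natr_sum.
have Zr : 0 < Z%:R :> R by rewrite ltr0n.
have lt2 : (1 + 100^-1) * del * Z%:R < #|` (A `&` P)%fset|%:R by rewrite cAP.
exists P; split.
- by exists b, q, Z.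
- move=> x /imfsetP[i /=]; rewrite mem_iota add0n => /andP[_ iZ] ->.
  split; first by rewrite /posint /= addn_gt0 bp.
  rewrite ler_nat; apply: leq_trans hbq; rewrite leq_add2l leq_mul2r (ltnW iZ) orbT //.
- rewrite cP; apply: (@le_trans _ _ (2^-1 * Z.+1%:R)); last first.
    by have h1 : 1 <= Z%:R :> R; [rewrite ler1n | rewrite -[Z.+1%:R]natr1; lra].
  rewrite ler_pM2l ?invr_gt0 //; apply: le_trans (root_le R bb0 hZ2).
  apply: ler_powR; first by rewrite ler1n.
  rewrite -mulrA XE2; apply: (@le_trans _ _ (X ^- (30 * b1))).
    by rewrite ler_piMl ?invr_ge0 ?exprn_ge0 ?(ltW X0) // invf_le1 ?ler1n ?ltr0n.
  rewrite lef_pV2 ?posrE ?exprn_gt0 ?ltr0n // /bb /kk -expnM.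
  by apply: le_trans (KXn _) _; rewrite mulnCA mulnC.
(* If the cap is active, the threshold equals 1 and [lt2] would place more than [Z] points of [A] on
   [P], which is absurd. *)
rewrite cP ler_pdivlMr //; case: (leP delta (100 / 101)) => hd.
  by rewrite /del (min_idPl hd) in lt2; exact: ltW.
have dE : del = 100 / 101 by apply/min_idPr; exact: ltW.
suff : #|` (A `&` P)%fset|%:R <= Z%:R :> R by rewrite dE in lt2; lra.
rewrite ler_nat -cP; apply: fsubset_leq_card; exact: fsubsetIr.
Qed.
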